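(* For all integers $1\le i\le n$, there is a bijection between the set of connected top-cycle-free chord diagrams $C$ with $n$ chords and $t_1(C)=i$ and the set of rooted triangulations with $n-i$ interior vertices and $i+1$ exterior vertices.
   Context: Chord diagrams: a chord diagram of size $n$ is a perfect matching of $\{1,\dots,2n\}$; chords are ordered pairs $(a,b)$ with $a<b$, $a$ the source and $b$ the sink; the root is the chord containing $1$. A subset of chords is a subdiagram, viewed as a diagram by order-preserving relabelling of endpoints. For chords $c_1=(a_1,b_1)$, $c_2=(a_2,b_2)$ with $a_1<a_2$, they cross if $a_2<b_1<b_2$, and then $c_2$ is a right neighbor of $c_1$. A diagram is connected if its intersection graph (chords as vertices, crossings as edges) is connected. A chord is terminal if it has no right neighbors. The standard order of chords is the order of their sources. Intersection order on a connected diagram: starting with label 1, label the root with the next available label, remove it, and then label the resulting connected components recursively, one after another, in the standard order of their roots. $t_1(C)$ is the index in the intersection order of the first terminal chord of $C$. For $m\ge3$ the top cycle diagram of size $m$ is $T_m=\{(2i-1,2i+2):1\le i\le m-1\}\cup\{(2,2m-1)\}$; a diagram is top-cycle-free if no subdiagram of it equals (after relabelling) some $T_m$, $m\ge3$. Triangulations: a triangulation (of a disk) is a simple plane graph whose boundary (outer) face is bounded by a simple cycle and in which every bounded face is a triangle; in addition a single edge counts as a triangulation (with 2 exterior and 0 interior vertices). Exterior vertices are those incident to the boundary face, all others are interior. A triangulation is rooted if it has a distinguished edge (the root) on its boundary; rooted triangulations are considered up to orientation-preserving isomorphism of plane graphs preserving the root. *)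

(* Defs.v *)
From HB Require Import structures.
From mathcomp Require Import all_boot all_fingroup.

Set Implicit Arguments.
Unset Strict Implicit.
Unset Printing Implicit Defensive.

(* Endpoints are numbered from 0: the point k of {1, ..., 2n} is k - 1 : 'I_(2 * n). *)
Definition chord n := ('I_(2 * n) * 'I_(2 * n))%type.

Definition source n (c : chord n) : nat := c.1.
Definition sink n (c : chord n) : nat := c.2.

Section ChordSets.
Variable n : nat.
Implicit Types (c d : chord n) (S : {set chord n}).

(* The n in chord n only bounds the endpoints, so S may be a subdiagram on
   arbitrary endpoints; all notions below, being defined from comparisons of
   endpoints, are insensitive to order-preserving relabelling. *)

Definition endpoints S : {set 'I_(2 * n)} :=
  [set x | [exists c in S, (x == c.1) || (x == c.2)]].

Definition perfect_matching S : bool :=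
  [forall c in S, source c < sink c]
  && [forall x : 'I_(2 * n), #|[set c in S | (x == c.1) || (x == c.2)]| == 1].

Definition right_neighbor c d : bool :=
  [&& source c < source d, source d < sink c & sink c < sink d].

Definition crossing c d : bool := right_neighbor c d || right_neighbor d c.

Definition crossing_in S : rel (chord n) :=
  [rel c d | [&& c \in S, d \in S & crossing c d]].

Definition connected S : bool :=
  [forall c in S, forall d in S, connect (crossing_in S) c d].

Definition component S c : {set chord n} :=
  [set d in S | connect (crossing_in S) c d].

Definition terminal S c : bool := ~~ [exists d in S, right_neighbor c d].

Definition standard_order S : seq (chord n) :=
  sort (fun c d => source c <= source d) (enum S).

Definition component_root S c : bool :=
  [forall d in component S c, source c <= source d].

(* k bounds the recursion depth. *)
Fixpoint intersection_order_rec k S : seq (chord n) :=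
  if k is k'.+1 then
    if standard_order S is r :: _ then
      r :: flatten [seq intersection_order_rec k' (component (S :\ r) c)
                   | c <- standard_order (S :\ r) & component_root (S :\ r) c]
    else [::]
  else [::].

Definition intersection_order S := intersection_order_rec #|S| S.

Definition t1 S : nat := (find (terminal S) (intersection_order S)).+1.

Definition rank S (x : 'I_(2 * n)) : nat := #|[set y in endpoints S | y < x]|.

Definition relabel S : {set chord #|S|} :=
  [set c' : chord #|S|
     | [exists c in S, (rank S c.1 == source c') && (rank S c.2 == sink c')]].

End ChordSets.

(* With 0-based endpoints, the chord (2i - 1, 2i + 2), 1 <= i <= m - 1, becomes
   (2i, 2i + 3), i < m - 1, and the chord (2, 2m - 1) becomes (1, 2m - 2). *)
Definition top_cycle m : {set chord m} :=
  [set c : chord m |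
       [exists i : 'I_m.-1, (source c == 2 * i) && (sink c == 2 * i + 3)]
    || (source c == 1) && (sink c == 2 * m - 2)].

Definition top_cycle_free n (S : {set chord n}) : bool :=
  [forall S' : {set chord n},
     (S' \subset S) && (3 <= #|S'|) ==> (relabel S' != top_cycle #|S'|)].

Definition chord_diagram n := {S : {set chord n} | perfect_matching S}.

(* A connected plane graph is encoded by its combinatorial map. D is the set of
   darts (edges with a direction); edge reverses a dart; node sends a dart to
   the next one counterclockwise around its origin. Vertices, edges and faces
   are the orbits of node, edge and face, where face x = node (edge x) is the
   dart following x along the boundary of the face on its right.
   outer is the set of darts of the boundary face, root_edge the pair of darts of the
   root edge. *)
Record plane_map (D : finType) := PlaneMap {
  node : {perm D};
  edge : {perm D};
  outer : {set D};
  root_edge : {set D}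
}.

Section PlaneMapChoice.
Variable D : finType.

Definition plane_map_tuple (M : plane_map D) := (node M, edge M, outer M, root_edge M).
Definition tuple_plane_map (t : {perm D} * {perm D} * {set D} * {set D}) :=
  PlaneMap t.1.1.1 t.1.1.2 t.1.2 t.2.
Lemma plane_map_tupleK : cancel plane_map_tuple tuple_plane_map.
Proof. by case. Qed.
HB.instance Definition _ := Choice.copy (plane_map D) (can_type plane_map_tupleK).

End PlaneMapChoice.

Section Triangulations.
Variable D : finType.
Implicit Type M : plane_map D.

Definition face M : {perm D} := (edge M * node M)%g.

Definition vertices M : {set {set D}} := porbits (node M).
Definition edges M : {set {set D}} := porbits (edge M).
Definition faces M : {set {set D}} := porbits (face M).

Definition origin M (x : D) : {set D} := porbit (node M) x.

Definition edge_involution M : bool :=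
  [forall x, (edge M x != x) && (edge M (edge M x) == x)].

Definition map_connected M : bool :=
  [forall x, forall y,
     connect [rel u v | (v == node M u) || (v == edge M u)] x y].

(* Euler's formula: a connected map has genus 0. *)
Definition euler_planar M : bool :=
  #|vertices M| + #|faces M| == #|edges M| + 2.

Definition loopless M : bool := [forall x, origin M x != origin M (edge M x)].

Definition no_multiple_edge M : bool :=
  [forall x, forall y, (origin M x == origin M y)
     && (origin M (edge M x) == origin M (edge M y)) ==> (x == y)].

Definition simple_plane_graph M : bool :=
  [&& edge_involution M, map_connected M, euler_planar M, loopless M,
      no_multiple_edge M & outer M \in faces M].

Definition outer_simple_cycle M : bool :=
  (3 <= #|outer M|)
  && [forall x in outer M, forall y in outer M,
        (origin M x == origin M y) ==> (x == y)].

Definition inner_triangles M : bool :=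
  [forall F in faces M, (F != outer M) ==> (#|F| == 3)].

Definition single_edge M : bool := #|edges M| == 1.

Definition triangulation M : bool :=
  simple_plane_graph M
  && (single_edge M || outer_simple_cycle M && inner_triangles M).

Definition rooted_triangulation M : bool :=
  [&& triangulation M, root_edge M \in edges M & root_edge M :&: outer M != set0].

Definition exterior_vertices M : {set {set D}} :=
  [set v in vertices M | v :&: outer M != set0].

Definition interior_vertices M : {set {set D}} :=
  vertices M :\: exterior_vertices M.

End Triangulations.

(* Orientation-preserving isomorphism respecting boundary face and root. *)
Definition map_iso (D D' : finType) (M : plane_map D) (N : plane_map D')
    (f : D -> D') : Prop :=
  [/\ bijective f,
      forall x, f (node M x) = node N (f x),
      forall x, f (edge M x) = edge N (f x),
      f @: outer M = outer N & f @: root_edge M = root_edge N].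

Definition map_isob (D D' : finType) (M : plane_map D) (N : plane_map D') : bool :=
  [exists f : {ffun D -> D'},
    [&& injectiveb f, [forall y, y \in codom f],
        [forall x, f (node M x) == node N (f x)],
        [forall x, f (edge M x) == edge N (f x)],
        f @: outer M == outer N & f @: root_edge M == root_edge N]].

Lemma map_isoP (D D' : finType) (M : plane_map D) (N : plane_map D') :
  reflect (exists f, map_iso M N f) (map_isob M N).
Proof.
apply: (iffP existsP) => [[f /and5P[/injectiveP fI /forallP fS /forallP fn
    /forallP fe /andP[/eqP fo /eqP fr]]]|[f [fB fn fe fo fr]]].
  exists f; split=> // [|x|x]; [|exact/eqP/fn|exact/eqP/fe].
  exists (fun y => iinv (fS y)) => [x|y]; last exact: f_iinv.
  by apply: fI; rewrite f_iinv.
exists (finfun f).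
have fE : finfun f =1 f by move=> x; rewrite ffunE.
apply/and5P; split; last (apply/andP; split).
- by apply/injectiveP=> x y; rewrite !fE; apply: bij_inj.
- apply/forallP=> y; case: fB => g _ gK.
  by apply/codomP; exists (g y); rewrite fE gK.
- by apply/forallP=> x; rewrite !fE fn.
- by apply/forallP=> x; rewrite !fE fe.
- by rewrite (eq_imset _ fE) fo.
- by rewrite (eq_imset _ fE) fr.
Qed.

Section Classes.
Variables p q : nat.

(* A finite plane graph has finitely many darts, which may be taken to be the
   elements of some 'I_d. *)
Definition labelled_triangulation :=
  {M : {d : nat & plane_map 'I_d} |
     [&& rooted_triangulation (tagged M),
         #|interior_vertices (tagged M)| == p
       & #|exterior_vertices (tagged M)| == q]}.

Definition triangulation_iso : rel labelled_triangulation :=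
  fun M N => map_isob (tagged (val M)) (tagged (val N)).

Lemma triangulation_iso_refl : reflexive triangulation_iso.
Proof.
move=> M; apply/map_isoP; exists id; split=> //; first by exists id.
- by rewrite imset_id.
- by rewrite imset_id.
Qed.

Lemma triangulation_iso_sym : symmetric triangulation_iso.
Proof.
suff H M N : triangulation_iso M N -> triangulation_iso N M.
  by move=> M N; apply/idP/idP; apply: H.
case/map_isoP=> f [[g fK gK] fn fe fo fr]; apply/map_isoP; exists g.
split=> [|x|x||]; first by exists f.
- by rewrite -{1}(gK x) -fn fK.
- by rewrite -{1}(gK x) -fe fK.
- by rewrite -fo -imset_comp (eq_imset _ fK) imset_id.
- by rewrite -fr -imset_comp (eq_imset _ fK) imset_id.
Qed.

Lemma triangulation_iso_trans : transitive triangulation_iso.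
Proof.
move=> N M P /map_isoP[f [fB fn fe fo fr]] /map_isoP[g [gB gn ge go gr]].
apply/map_isoP; exists (g \o f); split=> [|x|x||].
- exact: bij_comp.
- by rewrite /= fn gn.
- by rewrite /= fe ge.
- by rewrite imset_comp fo.
- by rewrite imset_comp fr.
Qed.

Canonical triangulation_iso_equiv :=
  EquivRel triangulation_iso triangulation_iso_refl triangulation_iso_sym
           triangulation_iso_trans.

(* Isomorphism classes of rooted triangulations with p interior and q exterior
   vertices. *)
Definition triangulation_class := {eq_quot triangulation_iso}%qT.

End Classes.

(* Main.v *)
(* Both sides are in bijection with the same family of binary trees.

   Triangulations: let the root edge be deleted. If the third vertex of the
   triangle on it was interior, what remains is a triangulation with one more
   exterior vertex, and this step can be reversed as long as no double edge is
   created; otherwise two triangulations sharing one vertex remain. Between two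
   steps of the second kind there is a run of steps of the first kind, whose
   possible lengths depend only on the number of exterior vertices of the second
   of the two triangulations. Thus a triangulation is a binary tree, each of whose
   nodes carries a number j between 1 and the width of its right subtree, where
   the width of a leaf is 1 and that of a node is the width of its left
   subtree plus j. The leaves count the vertices but one, and the width counts the
   exterior vertices but one.

   Chord diagrams: remove the root and let K be the component containing the next
   source. The other chords, with the root, form a connected diagram A, all of
   whose endpoints but the first lie in one gap of K; gluing A and K back
   together creates no top cycle exactly when the gap follows one of the
   "allowed" endpoints of K. Their number obeys the same recursion as the width,
   so that one gets the same trees, with leaves as chords. The first
   terminal chord of the diagram is that of K, hence its index is the length
   of the rightmost branch. A bijection of the trees exchanges this length with
   the width. *)
Require Import Defs.
From HB Require Import structures.
From mathcomp Require Import all_boot all_fingroup zify.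

Set Implicit Arguments.
Unset Strict Implicit.
Unset Printing Implicit Defensive.

(** Edges are never removed from the type of darts: a deleted dart becomes a fixed point of both
    permutations, and every condition on a map is restricted to the component of its root. Hence the
    two halves of a cut can live in one pair of permutations. Planarity is equality in a genus
    inequality for pairs of permutations; it is what makes the cut at a repeated boundary vertex
    separate the halves, and each inverse step has to preserve it. Top-cycle-freeness is traded for
    [clean], which speaks of reachability along right neighbors instead of a cycle of unknown
    length. The count of allowed endpoints follows the width because gluing makes the last endpoint
    of [A] allowed, forbids the chosen endpoint of [K] and those before it, and changes nothing
    else. The exchange of statistics rests on [graft]: it adds to the spine a number bounded by the
    spine of its second argument, just as [Node] does with the width, and every tree other than a
    leaf is a [graft] in one way. Replacing each [Node] by [graft] therefore turns width into
    spine. *)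

(** * Connectivity, cycle counts and genus of two permutations *)

Section PermPairs.
Variable D : finType.
Implicit Types (a b s : {perm D}) (x y z : D).

Lemma porbit_step s x : s x \in porbit s x.
Proof. by rewrite -{1}[s]expg1 mem_porbit. Qed.

Lemma porbit_trans s x y z : x \in porbit s y -> y \in porbit s z -> x \in porbit s z.
Proof. by rewrite -!eq_porbit_mem => /eqP-> /eqP->. Qed.

Lemma porbit_ind s (P : D -> Prop) x y :
  (forall z, P z -> P (s z)) -> P x -> y \in porbit s x -> P y.
Proof.
move=> HP Px /porbitP[i ->]; elim: i => [|i IH]; first by rewrite expg0 perm1.
by rewrite expgSr permM; apply: HP.
Qed.

Lemma porbit_sub s s' x y : (forall z, s' z \in porbit s z) ->
  y \in porbit s' x -> y \in porbit s x.
Proof.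
move=> H; apply: (porbit_ind (P := fun w => w \in porbit s x)) => [z zx|].
  exact: porbit_trans (H z) zx.
exact: porbit_id.
Qed.

Definition step a b : rel D := [rel u v | (v == a u) || (v == b u)].
Definition conn a b : rel D := connect (step a b).

Lemma conn_refl a b x : conn a b x x.
Proof. exact: connect0. Qed.

Lemma conn_trans a b : transitive (conn a b).
Proof. exact: connect_trans. Qed.

Lemma conn1l a b x : conn a b x (a x).
Proof. by apply: connect1; rewrite /step /= eqxx. Qed.

Lemma conn1r a b x : conn a b x (b x).
Proof. by apply: connect1; rewrite /step /= eqxx orbT. Qed.

Lemma conn_ind a b (P : D -> Prop) x y :
  (forall z, P z -> P (a z)) -> (forall z, P z -> P (b z)) ->
  P x -> conn a b x y -> P y.
Proof.
move=> Ha Hb Px /connectP[p]; elim: p x Px => [|z p IH] x Px /=; first by move=> _ ->.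
by case/andP=> /orP[]/eqP-> ; apply: IH; [apply: Ha|apply: Hb].
Qed.

Lemma porbit_conn a b s x y : (forall z, conn a b z (s z)) ->
  y \in porbit s x -> conn a b x y.
Proof.
move=> H; apply: (porbit_ind (P := conn a b x)) => [z xz|].
  exact: conn_trans (H z).
exact: conn_refl.
Qed.

Lemma conn_porbitl a b x y : y \in porbit a x -> conn a b x y.
Proof. by apply: porbit_conn => z; apply: conn1l. Qed.

Lemma conn_porbitr a b x y : y \in porbit b x -> conn a b x y.
Proof. by apply: porbit_conn => z; apply: conn1r. Qed.

Lemma conn_sym a b : symmetric (conn a b).
Proof.
suff H x y : conn a b x y -> conn a b y x by move=> x y; apply/idP/idP; apply: H.
apply: (conn_ind (P := fun w => conn a b w x)); last exact: conn_refl.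
  move=> z; apply: conn_trans.
  by apply: conn_porbitl; rewrite porbit_sym porbit_step.
move=> z; apply: conn_trans.
by apply: conn_porbitr; rewrite porbit_sym porbit_step.
Qed.

Lemma conn_sub a b a' b' x y :
  (forall z, conn a b z (a' z)) -> (forall z, conn a b z (b' z)) ->
  conn a' b' x y -> conn a b x y.
Proof.
move=> Ha Hb; apply: (conn_ind (P := conn a b x)); last exact: conn_refl.
  by move=> z zx; apply: conn_trans (Ha z).
by move=> z zx; apply: conn_trans (Hb z).
Qed.

Lemma conn_swap a b : conn a b =2 conn b a.
Proof.
move=> x y; apply/idP/idP; apply: conn_sub => z; rewrite ?conn1l ?conn1r //.
Qed.

Lemma conn_mul a b x : conn a b x ((a * b)%g x).
Proof. by rewrite permM; apply: conn_trans (conn1l _ _ _) (conn1r _ _ _). Qed.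

Definition nclass (R : rel D) : nat := #|[set [set y | R x y] | x : D]|.

Lemma eq_nclass (R R' : rel D) : R =2 R' -> nclass R = nclass R'.
Proof.
move=> RR; rewrite /nclass; congr #|pred_of_set _|; apply: eq_imset => x.
by apply/setP=> y; rewrite !inE RR.
Qed.

(** The formula for [R] merges the classes of [x] and [y], which costs one class exactly when they
    were distinct. *)
Lemma nclass_merge (R R' : rel D) x y :
  equivalence_rel R' ->
  (forall u v, R u v = [|| R' u v, R' u x && R' y v | R' u y && R' x v]) ->
  nclass R + ~~ R' x y = nclass R'.
Proof.
move=> eR RE.
have R'r u : R' u u by case: (eR u u u).
have R't u v w : R' u v -> R' u w = R' v w by case: (eR u v w).
have R's u v : R' u v = R' v u.
  by apply/idP/idP => H; rewrite -(R't _ _ _ H) R'r.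
have R'tr u v w : R' u v -> R' v w -> R' u w by move=> /R't->.
have [Rxy|nRxy] /= := boolP (R' x y).
  rewrite addn0; apply: eq_nclass => u v; rewrite RE.
  apply/or3P/idP => [[//|/andP[h1 h2]|/andP[h1 h2]]|]; last by constructor 1.
    exact: R'tr (R'tr _ _ _ h1 Rxy) h2.
  by apply: R'tr h1 (R'tr _ _ _ _ h2); rewrite R's.
pose cl (Q : rel D) u := [set v | Q u v].
have clE u v : (cl R' u == cl R' v) = R' u v.
  apply/eqP/idP => [/setP/(_ v)|H]; first by rewrite !inE R'r.
  by apply/setP=> w; rewrite !inE (R't _ _ _ H).
have ncl : cl R' x != cl R' y by rewrite clE.
have memcl (Q : rel D) u : cl Q u \in [set cl Q x | x : D] by apply: imset_f.
rewrite /nclass (cardsD1 (cl R' x) [set cl R' x | x : D]) memcl.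
rewrite (cardsD1 (cl R' y) ([set cl R' x | x : D] :\ _)) !inE memcl eq_sym ncl.
rewrite (cardsD1 (cl R x) [set cl R x | x : D]) memcl /=.
rewrite addn1 -add1n; congr (_ + (_ + #|pred_of_set _|)).
have same u : ~~ R' u x -> ~~ R' u y -> cl R u = cl R' u.
  by move=> h1 h2; apply/setP=> v; rewrite !inE RE (negPf h1) (negPf h2) ?orbF.
have Rx u : (cl R u == cl R x) = R' u x || R' u y.
  apply/eqP/idP => [/setP/(_ x)|].
    rewrite !inE !RE !R'r (R's y x) (negPf nRxy) /=.
    by case: (R' u x); case: (R' u y).
  have clxy : cl R y = cl R x.
    by apply/setP=> v; rewrite !inE !RE !R'r /= (R's y x) (negPf nRxy) /= orbF orbC.
  have cong v w : R' v w -> cl R v = cl R w.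
    by move=> vw; apply/setP=> z; rewrite !inE !RE !(R't _ _ _ vw).
  by case/orP=> /cong-> //.
apply/setP=> X; rewrite !inE; apply/andP/and3P.
  case=> Xx /imsetP[u _ Xu]; subst X; rewrite Rx negb_or in Xx.
  case/andP: Xx => h1 h2.
  by rewrite same // !clE h1 h2; split=> //; apply: imset_f.
case=> Xy Xx /imsetP[u _ Xu]; subst X; rewrite !clE in Xx Xy.
by rewrite -same // Rx negb_or Xx Xy; split=> //; apply: imset_f.
Qed.

Definition comps a b := nclass (conn a b).

(* Replacing a by tperm x y * a cuts the common cycle of x and y into two. *)
Lemma conn_cut a b x y u v : x \in porbit a y ->
  conn a b u v =
    [|| conn (tperm x y * a) b u v,
        conn (tperm x y * a) b u x && conn (tperm x y * a) b y v
      | conn (tperm x y * a) b u y && conn (tperm x y * a) b x v].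
Proof.
move=> xy; set a' := (_ * a)%g.
have aE z : a' z = a (tperm x y z) by rewrite permM.
have a'E z : a z = a' (tperm x y z) by rewrite aE tpermK.
have xya : conn a b x y by apply: conn_porbitl; rewrite porbit_sym.
have sub w z : conn a' b w z -> conn a b w z.
  apply: conn_sub => q; last exact: conn1r.
  rewrite aE; apply: conn_trans (conn1l _ _ _).
  by case: tpermP => [->|->|_ _]; rewrite ?conn_refl // conn_sym.
apply/idP/or3P => [|[/sub//|/andP[h1 h2]|/andP[h1 h2]]]; last first.
- apply: conn_trans (sub _ _ h1) (conn_trans _ (sub _ _ h2)).
  by rewrite conn_sym.
- exact: conn_trans (sub _ _ h1) (conn_trans xya (sub _ _ h2)).
move=> uv; apply/or3P.
pose P z := [|| conn a' b u z, conn a' b u x && conn a' b y z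
                            | conn a' b u y && conn a' b x z].
apply: (conn_ind (P := P)) uv; last by rewrite /P conn_refl.
  move=> z; rewrite /P a'E; case: tpermP => [->|->|_ _].
  - case/or3P=> [h|/andP[h1 h2]|/andP[h1 h2]]; apply/or3P.
    + by constructor 2; rewrite h conn1l.
    + by constructor 2; rewrite h1 conn1l.
    + by constructor 1; rewrite (conn_trans h1) // conn1l.
  - case/or3P=> [h|/andP[h1 h2]|/andP[h1 h2]]; apply/or3P.
    + by constructor 3; rewrite h conn1l.
    + by constructor 1; rewrite (conn_trans h1) // conn1l.
    + by constructor 3; rewrite h1 conn1l.
  - case/or3P=> [h|/andP[h1 h2]|/andP[h1 h2]]; apply/or3P.
    + by constructor 1; apply: conn_trans h (conn1l _ _ _).
    + by constructor 2; rewrite h1; apply: conn_trans h2 (conn1l _ _ _).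
    + by constructor 3; rewrite h1; apply: conn_trans h2 (conn1l _ _ _).
move=> z; case/or3P=> [h|/andP[h1 h2]|/andP[h1 h2]]; apply/or3P.
- by constructor 1; apply: conn_trans h (conn1r _ _ _).
- by constructor 2; rewrite h1; apply: conn_trans h2 (conn1r _ _ _).
- by constructor 3; rewrite h1; apply: conn_trans h2 (conn1r _ _ _).
Qed.

Lemma conn_equiv a b : equivalence_rel (conn a b).
Proof.
move=> u v w; split=> [|uv]; first exact: conn_refl.
by apply/idP/idP; apply: conn_trans; rewrite // conn_sym.
Qed.

Lemma comps_cut a b x y : x \in porbit a y ->
  comps a b + ~~ conn (tperm x y * a) b x y = comps (tperm x y * a) b.
Proof.
by move=> xy; apply: nclass_merge => [|u v]; [apply: conn_equiv|apply: conn_cut].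
Qed.


Definition ncyc a : nat := #|porbits a|.

Lemma ncyc_mul_tperm a x y :
  ncyc (tperm x y * a) + (x \notin porbit a y).*2 = ncyc a + (x != y).
Proof. exact: porbits_mul_tperm. Qed.

Lemma ncyc_cut a x y : x != y -> x \in porbit a y ->
  ncyc (tperm x y * a) = (ncyc a).+1.
Proof. move=> xy xya; move: (ncyc_mul_tperm a x y) => /=; rewrite xya xy /=; lia. Qed.

Lemma ncyc_cut_mul a b x y : x != y ->
  let a' := (tperm x y * a)%g in
  ncyc (a * b) + (x \notin porbit (a' * b) y).*2 = (ncyc (a' * b)).+1.
Proof.
move=> xy a'; have := ncyc_mul_tperm (a' * b) x y.
by rewrite /= xy {1}/a' !mulgA tperm2 mul1g addn1.
Qed.

Lemma conn_of_porbit_mul a b x y : x \in porbit (a * b) y -> conn a b x y.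
Proof.
by move=> xy; rewrite conn_sym; apply: porbit_conn xy => z; apply: conn_mul.
Qed.

(** Vertices, edges and faces together: [a * b] is conjugate to the face permutation [b * a]. *)
Definition euler_sum a b := ncyc a + ncyc b + ncyc (a * b).

(* The genus of a pair of permutations is not negative. *)
Lemma euler_le a b : euler_sum a b <= #|D| + (comps a b).*2.
Proof.
rewrite /euler_sum.
have zD (c : {perm D}) : ncyc c <= #|D|.
  by rewrite /ncyc /porbits (leq_trans (leq_imset_card _ _)) // max_card.
(* Induction on [#|D| - ncyc a]: separating a moved point from its image adds a cycle to [a]. For
   the identity, the components are the cycles of [b]. *)
elim: {a}_.+1 {-2}a (ltnSn (#|D| - ncyc a)) => // k IH a ak.
have [a1|] := altP (a =P 1%g).
  have -> : comps a b = ncyc b.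
    rewrite /comps /nclass /ncyc /porbits; congr #|pred_of_set _|; apply: eq_imset => x.
    apply/setP=> y; rewrite inE; apply/idP/idP; last by apply: conn_porbitr.
    apply: (conn_ind (P := fun w => w \in porbit b x)); last exact: porbit_id.
      by move=> z zx; rewrite a1 perm1.
    by move=> z zx; apply: porbit_trans (porbit_step b z) zx.
  by rewrite a1 mul1g; have := zD 1%g; lia.
move/eqP/permP=> /[dup] _ na.
have [x ax] : exists x, a x != x.
  by apply/existsP; apply: contraT; rewrite negb_exists => /forallP H;
     case: na => x; rewrite perm1; apply/eqP; move: (H x); rewrite negbK.
rewrite eq_sym in ax.
have xya : x \in porbit a (a x) by rewrite porbit_sym porbit_step.
have z1 := ncyc_cut ax xya.
have /= := ncyc_cut_mul a b ax; have := comps_cut b xya.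
have := IH (tperm x (a x) * a)%g; rewrite z1.
move=> IH1; have {IH1} := IH1 ltac:(by have := zD (tperm x (a x) * a)%g; lia).
(* A cut that disconnects [x] from [a x] also puts them in different cycles of the product, which
   pays for the new component. *)
have := @conn_of_porbit_mul (tperm x (a x) * a)%g b x (a x).
set A := conn _ _ _ _; set B := x \in _.
case: A; case: B => /= H; try (by have := H isT); lia.
Qed.

(** Genus 0 in every component, the deficit in [euler_le] being twice the sum of the genera. *)
Definition planar a b := euler_sum a b == #|D| + (comps a b).*2.

(** The second conclusion is a form of the Jordan curve theorem: if [x] and [y] stayed connected but
    fell into different cycles of the product, the cut would raise [euler_sum] by 2 without a new
    component, against [euler_le]. *)
Lemma planar_cut a b x y : x != y -> x \in porbit a y -> planar a b ->
  planar (tperm x y * a) b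
  /\ (conn (tperm x y * a) b x y -> x \in porbit (tperm x y * a * b) y).
Proof.
move=> xy xya /eqP; rewrite /planar /euler_sum.
have z1 := ncyc_cut xy xya.
have /= := ncyc_cut_mul a b xy; have := comps_cut b xya.
have := euler_le (tperm x y * a)%g b; rewrite /euler_sum z1.
have := @conn_of_porbit_mul (tperm x y * a)%g b x y.
set A := conn _ _ _ _; set B := x \in _.
by case: A; case: B => /= H H1 H2 H3 H4; try (by have := H isT); split=> //; lia.
Qed.

(** Merging two vertices creates no handle when they belong to different components, or when the two
    corners to be merged lie on one face. *)
Lemma planar_join a b x y : x != y -> x \notin porbit a y ->
  ~~ conn a b x y || (x \in porbit (a * b) y) ->
  planar a b -> planar (tperm x y * a) b.
Proof.
move=> xy xya C /eqP; rewrite /planar /euler_sum.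
pose a' : {perm D} := (tperm x y * a)%g; rewrite -/a'.
have aE : a = (tperm x y * a')%g by rewrite mulgA tperm2 mul1g.
have xya' : x \in porbit a' y.
  have := ncyc_mul_tperm a x y; have := ncyc_mul_tperm a' x y.
  rewrite /= -aE xy xya -/a'.
  by case: (x \in _) => //=; lia.
have := ncyc_cut xy xya'; rewrite -aE => z1.
have /= := ncyc_cut_mul a' b xy; have := comps_cut b xya'; rewrite /= -aE.
move: C; have := @conn_of_porbit_mul a b x y.
set A := conn _ _ _ _; set B := x \in porbit _ _.
case: A; case: B => /= H; try (by have := H isT); move=> //= _ H1 H2 H3; lia.
Qed.

(** [s] maps the cycles of [s * t] bijectively onto those of [t * s]. *)
Lemma ncycC (s t : {perm D}) : ncyc (s * t) = ncyc (t * s).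
Proof.
have J i x : ((t * s) ^+ i)%g (s x) = s (((s * t) ^+ i)%g x).
  elim: i => [|i IH]; first by rewrite !expg0 !perm1.
  by rewrite !expgSr [LHS]permM IH !permM.
have porbitJ x : porbit (t * s) (s x) = [set s y | y in porbit (s * t) x].
  apply/setP=> y; apply/porbitP/imsetP => [[i ->]|[_ /porbitP[i ->] ->]].
    by exists (((s * t) ^+ i)%g x); rewrite ?mem_porbit ?J.
  by exists i; rewrite J.
rewrite /ncyc.
suff -> : porbits (t * s) = [set [set s x | x in X] | X : {set D} in porbits (s * t)].
  by rewrite card_imset //; apply: imset_inj; apply: perm_inj.
apply/setP=> X; apply/imsetP/imsetP => [[x _ ->]|[_ /imsetP[x _ ->] ->]].
  exists (porbit (s * t) ((s^-1)%g x)); first exact: imset_f.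
  by rewrite -porbitJ permKV.
by exists (s x); rewrite ?porbitJ.
Qed.

(** Lets the cuts and joins of the first permutation be applied to the second, hence to edges as
    well as to vertices. *)
Lemma planarC a b : planar a b = planar b a.
Proof.
by rewrite /planar /euler_sum /comps (eq_nclass (conn_swap a b)) [ncyc a + _]addnC ncycC.
Qed.

End PermPairs.

(** * Cycles as lists, and the removal of a point from a cycle *)

Section Cycles.
Variable D : finType.
Implicit Types (s : {perm D}) (x y z : D) (p : seq D).

(** With the identity as second permutation, [conn_cut] becomes a statement about cycles. *)
Lemma porbit1 s u v : conn s 1 u v = (v \in porbit s u).
Proof.
apply/idP/idP; last exact: conn_porbitl.
apply: (conn_ind (P := fun w => w \in porbit s u)) => [z|z|]; last exact: porbit_id.
  by move=> zu; apply: porbit_trans (porbit_step s z) zu.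
by rewrite perm1.
Qed.

Lemma porbit_cut s x y u v : x \in porbit s y ->
  v \in porbit s u =
    [|| v \in porbit (tperm x y * s) u,
        (x \in porbit (tperm x y * s) u) && (v \in porbit (tperm x y * s) y)
      | (y \in porbit (tperm x y * s) u) && (v \in porbit (tperm x y * s) x)].
Proof. by move=> xy; rewrite -porbit1 (conn_cut 1 u v xy) !porbit1. Qed.

Lemma porbit_closed s x y : (s y \in porbit s x) = (y \in porbit s x).
Proof.
by have := porbit_perm s 1 y; rewrite expg1 -!eq_porbit_mem => ->.
Qed.

Lemma cycle_porbit s p x y : fcycle s p -> x \in p -> (y \in porbit s x) = (y \in p).
Proof.
move=> cp xp; rewrite -(fconnect_cycle cp xp).
have PF : (y \in porbit s x) = fconnect s x y.
  apply/porbitP/idP => [[i ->]|xy]; first by rewrite permX fconnect_iter.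
  by exists (findex s x y); rewrite permX iter_findex.
by rewrite PF.
Qed.

Lemma porbit_cycle s x : exists p, fcycle s (x :: p) /\ uniq (x :: p).
Proof.
have [k kE] : exists k, #|porbit s x| = k.+1.
  by exists #|porbit s x|.-1; rewrite prednK // lt0n card_porbit_neq0.
exists (traject s (s x) k); split; last by have := uniq_traject_porbit s x; rewrite kE.
have E : rcons (traject s (s x) k) x = traject s (s x) k.+1.
  by rewrite trajectSr -iterSr -kE iter_porbit.
by rewrite /= E; apply: fpath_traject.
Qed.

Lemma fcycle_uniq s x p q : fcycle s (x :: p) -> uniq (x :: p) ->
  fcycle s (x :: q) -> uniq (x :: q) -> p = q.
Proof.
move=> cp up cq uq.
have pq : size (x :: p) = size (x :: q).
  rewrite -(card_uniqP up) -(card_uniqP uq); apply: eq_card => y.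
  by rewrite -(cycle_porbit y cp (mem_head x p)) -(cycle_porbit y cq (mem_head x q)).
move/eqP: pq => /=; rewrite eqSS => /eqP pq.
suff: rcons p x = rcons q x by move/rcons_inj => [].
move: cp cq => /= /fpathP[k kE] /fpathP[l lE].
have := congr1 size kE; rewrite size_rcons size_traject => kp.
have := congr1 size lE; rewrite size_rcons size_traject => lq.
by rewrite kE lE -kp -lq pq.
Qed.

Lemma fpath_eq_src (f g : D -> D) x p : {in belast x p, f =1 g} ->
  fpath f x p = fpath g x p.
Proof.
elim: p x => //= y p IH x fg; rewrite fg ?mem_head // IH // => z zp.
by apply: fg; rewrite inE zp orbT.
Qed.

(** The transposition exchanges the images of [x] and of the last point of [z :: p]: that arc closes
    up on itself, and [x] jumps over it to [y]. *)
Lemma fcycle_cut s x z p y q : uniq (x :: (z :: p) ++ y :: q) ->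
  fcycle s (x :: (z :: p) ++ y :: q) =
  fcycle (tperm x (last z p) * s)%g (x :: y :: q)
  && fcycle (tperm x (last z p) * s)%g (z :: p).
Proof.
set l := last z p; set s' := (_ * s)%g; rewrite cons_uniq cat_uniq.
case/and4P=> xN up /hasPn/= pq uq.
have lp : l \in z :: p by apply: mem_last.
have s'x : s' x = s l by rewrite permM tpermL.
have s'l : s' l = s x by rewrite permM tpermR.
have s'E w : w != x -> w != l -> s' w = s w.
  by move=> wx wl; rewrite permM tpermD // eq_sym.
have yqE : path (frel s') y (rcons q x) = path (frel s) y (rcons q x).
  apply: fpath_eq_src => w; rewrite belast_rcons => wq; apply: s'E.
    by apply: contraNneq xN => <-; rewrite mem_cat wq orbT.
  by apply: contraTneq wq => ->; apply: contraL lp => /pq.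
have zpE : path (frel s') z p = path (frel s) z p.
  apply: fpath_eq_src => w wp; apply: s'E.
    by apply: contraNneq xN => <-; rewrite mem_cat (mem_belast wp).
  apply: contraTneq wp => ->.
  by have := up; rewrite lastI rcons_uniq => /andP[].
rewrite /= rcons_cat cat_path /= yqE (rcons_path _ z p) zpE s'x /= -/l s'l.
by case: (_ == z); case: (path _ z p); case: (_ == y); case: (path _ _ _).
Qed.

Lemma porbit_fix s x y : s x = x -> x \in porbit s y -> y = x.
Proof.
move=> sx; rewrite porbit_sym.
by apply: (porbit_ind (P := fun w => w = x)) => // w ->.
Qed.

Lemma conn_fix s (t : {perm D}) x y : s x = x -> t x = x -> conn s t x y -> y = x.
Proof. by move=> sx tx; apply: (conn_ind (P := fun w => w = x)) => // w ->. Qed.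

(** Deletes [x] without changing [D]: [x] becomes a fixed point and its predecessor inherits its
    image. *)
Definition bypass s x : {perm D} := (tperm x ((s^-1)%g x) * s)%g.

Lemma bypassE s x z :
  bypass s x z = if z == x then x else if s z == x then s x else s z.
Proof.
rewrite permM; case: tpermP => [->|->|/eqP zx /eqP sz].
- by rewrite permKV eqxx.
- rewrite permKV eqxx; case: eqP => // E; by rewrite -{1}E permKV.
- rewrite (negPf zx); case: eqP => // szx; case/eqP: sz.
  by rewrite -szx permK.
Qed.

Lemma porbit_bypass s x z y : z != x -> y != x ->
  (y \in porbit (bypass s x) z) = (y \in porbit s z).
Proof.
move=> zx yx; apply/idP/idP => [|H].
  apply: porbit_sub => w; rewrite bypassE.
  case: eqP => [->|_]; first exact: porbit_id.
  case: eqP => [<-|_]; last exact: porbit_step.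
  by rewrite !porbit_closed porbit_id.
(* While the walk along [s] stands at [x], the walk along [bypass s x] is already at [s x]. *)
pose P w := if w == x then s x \in porbit (bypass s x) z else w \in porbit (bypass s x) z.
suff: P y by rewrite /P (negPf yx).
apply: (porbit_ind (P := P)) H => [w|]; last by rewrite /P (negPf zx) porbit_id.
rewrite /P; have [->|wx] := eqVneq w x.
  by case: eqP => // ->.
rewrite -(porbit_closed _ _ w) bypassE (negPf wx).
by case: eqP.
Qed.

Lemma planar_bypass s t x : planar s t -> planar (bypass s x) t.
Proof.
move=> pl; rewrite /bypass; have [E|sx] := eqVneq x ((s^-1)%g x).
  by rewrite -E tperm1 mul1g.
by case: (planar_cut sx _ pl) => //; rewrite -porbitV porbit_sym porbit_step.
Qed.
End Cycles.

(** * Deletion and reinsertion of the root edge *)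

Section Open.
Variable D : finType.
Implicit Types (n e : {perm D}) (r x y z : D) (p : seq D).

(* The face on the inner side of the root edge {r, e r} is the triangle
   (n r, n (e (n r)), e r). *)
Record root_triangle n e r : Prop := RootTriangle {
  rt_e : e r != r;
  rt_ee : e (e r) = r;
  rt_a : n r != r;
  rt_ae : n r != e r;
  rt_b : n (e (n r)) != r;
  rt_be : n (e (n r)) != e r;
  rt_ab : n (e (n r)) != n r;
  rt_c : n (e r) != r;
  rt_ce : n (e r) != e r;
  rt_f : n (e (n (e (n r)))) = e r
}.

Definition open_node n e r : {perm D} := bypass (bypass n r) (e r).
(** In the 2-cycle of [r] and [e r], a single bypass fixes both darts. *)
Definition open_edge e r : {perm D} := bypass e r.

Lemma perm_eqE (s : {perm D}) x y z : s y = z -> (s x == z) = (x == y).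
Proof. by move<-; rewrite (inj_eq perm_inj). Qed.

Section Facts.
Variables (n e : {perm D}) (r : D).
Hypothesis RT : root_triangle n e r.
Let r' := e r.
Let a := n r.
Let b := n (e a).
Let n1 := open_node n e r.
Let e1 := open_edge e r.

Lemma er_eq z : (e z == r) = (z == r').
Proof. exact: perm_eqE (rt_ee RT). Qed.

Lemma open_nodeE z : n1 z =
  if z == r then r else if z == r' then r' else
  if n z == r then a else if n z == r' then n r' else n z.
Proof.
rewrite /n1 /open_node !bypassE -/r'.
have r'r : (r' == r) = false by apply: negbTE (rt_e RT).
have [->|zr] := eqVneq z r; first by rewrite eq_sym !r'r.
have [//|zr'] := eqVneq z r'; rewrite r'r.
have cr : (n r' == r) = false by apply: negbTE (rt_c RT).
rewrite cr; have [nz|] := eqVneq (n z) r; last by [].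
by rewrite (negbTE (rt_ae RT)).
Qed.

Lemma open_edgeE z : e1 z = if z == r then r else if z == r' then r' else e z.
Proof.
rewrite /e1 /open_edge bypassE er_eq; case: eqP => // _; case: eqP => // ->.
Qed.

Lemma open_node_r : n1 r = r. Proof. by rewrite open_nodeE eqxx. Qed.
Lemma open_node_r' : n1 r' = r'. Proof. by rewrite open_nodeE eqxx; case: eqP. Qed.
Lemma open_edge_r : e1 r = r. Proof. by rewrite open_edgeE eqxx. Qed.
Lemma open_edge_r' : e1 r' = r'. Proof. by rewrite open_edgeE eqxx; case: eqP. Qed.

Lemma ea_r : (e a == r) = false. Proof. by rewrite er_eq; apply: negbTE (rt_ae RT). Qed.
Lemma ea_r' : (e a == r') = false. Proof. by rewrite (inj_eq perm_inj); apply: negbTE (rt_a RT). Qed.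
Lemma eb_r : (e b == r) = false. Proof. by rewrite er_eq; apply: negbTE (rt_be RT). Qed.
Lemma eb_r' : (e b == r') = false. Proof. by rewrite (inj_eq perm_inj); apply: negbTE (rt_b RT). Qed.
Lemma ar : (a == r) = false. Proof. exact: negbTE (rt_a RT). Qed.
Lemma ar' : (a == r') = false. Proof. exact: negbTE (rt_ae RT). Qed.
Lemma br : (b == r) = false. Proof. exact: negbTE (rt_b RT). Qed.
Lemma br' : (b == r') = false. Proof. exact: negbTE (rt_be RT). Qed.
Lemma r'r : (r' == r) = false. Proof. exact: negbTE (rt_e RT). Qed.

Lemma open_edge_a : e1 a = e a. Proof. by rewrite open_edgeE ar ar'. Qed.
Lemma open_edge_b : e1 b = e b. Proof. by rewrite open_edgeE br br'. Qed.
Lemma open_node_ea : n1 (e a) = b.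
Proof. by rewrite open_nodeE ea_r ea_r' -/b br br'. Qed.
Lemma open_node_eb : n1 (e b) = n r'.
Proof. by rewrite open_nodeE eb_r eb_r' (rt_f RT) r'r eqxx. Qed.

Lemma porbit_open z y : z != r -> z != r' -> y != r -> y != r' ->
  (y \in porbit n1 z) = (y \in porbit n z).
Proof. by move=> *; rewrite /n1 /open_node !porbit_bypass. Qed.

Lemma conn_open1_neq z : conn n1 e1 a z -> z != r /\ z != r'.
Proof.
move=> az; split.
  apply: (conn_ind (P := fun w => w != r)) az => [w|w|]; last by rewrite ar.
    by apply: contra_neq => E; apply: (@perm_inj _ n1); rewrite open_node_r.
  by apply: contra_neq => E; apply: (@perm_inj _ e1); rewrite open_edge_r.
apply: (conn_ind (P := fun w => w != r')) az => [w|w|]; last by rewrite ar'.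
  by apply: contra_neq => E; apply: (@perm_inj _ n1); rewrite open_node_r'.
by apply: contra_neq => E; apply: (@perm_inj _ e1); rewrite open_edge_r'.
Qed.

Lemma conn_open_step z : conn n e z (n1 z) /\ conn n e z (e1 z).
Proof.
rewrite open_nodeE open_edgeE; split.
  have [->|zr] := eqVneq z r; first exact: conn_refl.
  have [->|zr'] := eqVneq z r'; first exact: conn_refl.
  have nz := conn1l n e z.
  case: eqP => [E|_]; first by rewrite E in nz; apply: conn_trans nz (conn1l _ _ _).
  case: eqP => [E|//]; first by rewrite E in nz; apply: conn_trans nz (conn1l _ _ _).
have [->|zr] := eqVneq z r; first exact: conn_refl.
have [->|zr'] := eqVneq z r'; first exact: conn_refl.
exact: conn1r.
Qed.

Lemma conn_open z : conn n1 e1 a z = [&& conn n e r z, z != r & z != r'].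
Proof.
apply/idP/and3P => [az|[rz zr zr']].
  have [-> ->] := conn_open1_neq az; split=> //.
  apply: conn_trans (conn1l n e r) _; apply: conn_sub az => w.
    by case: (conn_open_step w).
  by case: (conn_open_step w).
pose P w := [|| w == r, w == r' | conn n1 e1 a w].
suff: P z by rewrite /P (negPf zr) (negPf zr').
have cea : conn n1 e1 a (e a) by rewrite -open_edge_a conn1r.
have cb : conn n1 e1 a b by rewrite -open_node_ea; apply: conn_trans cea (conn1l _ _ _).
have ceb : conn n1 e1 a (e b).
  by rewrite -open_edge_b; apply: conn_trans cb (conn1r _ _ _).
apply: (conn_ind (P := P)) rz => [w|w|]; last by rewrite /P eqxx.
  case/or3P=> [/eqP->|/eqP->|aw].
  - by rewrite /P conn_refl !orbT.
  - rewrite /P -open_node_eb; apply/or3P; constructor 3.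
    exact: conn_trans ceb (conn1l _ _ _).
  have [wr wr'] := conn_open1_neq aw.
  have := conn1l n1 e1 w; rewrite {1}open_nodeE (negPf wr) (negPf wr') /P.
  case: eqP => //= _; case: eqP => //= _ ww; exact: conn_trans aw ww.
case/or3P=> [/eqP->|/eqP->|aw].
- by rewrite /P eqxx orbT.
- by rewrite /P /r' (rt_ee RT) eqxx.
have [wr wr'] := conn_open1_neq aw.
have := conn1r n1 e1 w; rewrite {1}open_edgeE (negPf wr) (negPf wr') /P => ww.
by rewrite (conn_trans aw ww) !orbT.
Qed.

Lemma planar_open : planar n e -> planar n1 e1.
Proof.
move=> pl; rewrite planarC; apply: planar_bypass; rewrite planarC.
by do 2!apply: planar_bypass.
Qed.

(** Three joins undo the deletion: [r] and [r'] form an edge of their own, then [r'] is attached to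
    the map, both times across components; the last join attaches [r] at a corner of the same
    face. *)
Lemma planar_close : planar n1 e1 -> planar n e.
Proof.
move=> pl1.
have rr' : r != r' by rewrite eq_sym r'r.
have eE : e = (tperm r r' * e1)%g.
  have er : (e^-1)%g r = r' by rewrite -{1}(rt_ee RT) permK.
  by rewrite /e1 /open_edge /bypass er mulgA tperm2 mul1g.
have pl2 : planar n1 e.
  rewrite planarC eE; apply: planar_join => //; last by rewrite planarC.
    by apply/negP => /(porbit_fix open_edge_r)/eqP; rewrite r'r.
  apply/orP; left; apply/negP => /(conn_fix open_edge_r open_node_r)/eqP.
  by rewrite r'r.
pose m := bypass n r.
have mea : m (e a) = b by rewrite bypassE ea_r -/b br.
have meb : m (e b) = r' by rewrite bypassE eb_r (rt_f RT) r'r.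
have mE : m = (tperm r' (e b) * n1)%g.
  have mr : (m^-1)%g r' = e b by rewrite -meb permK.
  by rewrite /n1 /open_node -/r' -/m /bypass mr mulgA tperm2 mul1g.
have r'eb : r' != e b by rewrite eq_sym eb_r'.
have pl3 : planar m e.
  rewrite mE; apply: planar_join => //.
    by apply/negP => /(porbit_fix open_node_r')/eqP; rewrite eb_r'.
  apply/orP; left; apply/negP => C.
  have : (e b == r') || (e b == r).
    apply: (conn_ind (P := fun w => (w == r') || (w == r))) C => [z|z|].
    - by case/orP=> /eqP->; rewrite ?open_node_r' ?open_node_r eqxx ?orbT.
    - by case/orP=> /eqP->; rewrite ?(rt_ee RT) eqxx ?orbT.
    - by rewrite eqxx.
  by rewrite eb_r eb_r'.
pose q := (n^-1)%g r.
have nq : n q = r by rewrite permKV.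
have nE : n = (tperm r q * m)%g by rewrite /m /bypass mulgA tperm2 mul1g.
have rq : r != q.
  by apply: contraFneq ar => E; rewrite /a E nq -E.
rewrite nE; apply: planar_join => //.
  apply/negP => /porbit_fix E; move/eqP: rq; apply; rewrite E //.
  by rewrite bypassE eqxx.
apply/orP; right.
have mq : m q = a by rewrite bypassE eq_sym (negPf rq) nq eqxx.
(* The face in question passes through [q], [e a], [e b] and [r]. *)
have S w v : v = e (m w) -> (v \in porbit (m * e) q) = (w \in porbit (m * e) q).
  by move->; rewrite -permM porbit_closed.
rewrite (S (e b)) ?meb ?(rt_ee RT) // (S (e a)) ?mea // (S q) ?mq //.
exact: porbit_id.
Qed.

Lemma faceE z : (e * n)%g z = n (e z).
Proof. exact: permM. Qed.

Lemma open_faceE z : z != r -> z != r' ->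
  (e1 * n1)%g z = if n (e z) == r then a else if z == b then n r' else n (e z).
Proof.
move=> zr zr'; rewrite permM open_edgeE (negPf zr) (negPf zr') open_nodeE.
have -> : (e z == r) = false by rewrite er_eq (negPf zr').
have -> : (e z == r') = false by rewrite (inj_eq perm_inj) (negPf zr).
by rewrite (perm_eqE _ (rt_f RT)) (inj_eq perm_inj).
Qed.

Lemma fpath_open z p : (forall w, w \in z :: p -> [&& w != r, w != r', w != a & w != b]) ->
  fpath (e * n)%g z (rcons p r) = fpath (e1 * n1)%g z (rcons p a).
Proof.
elim: p z => [|c p IH] z H /=.
  have /and4P[zr zr' _ zb] := H z (mem_head _ _).
  rewrite faceE open_faceE // (negPf zb); case: (n (e z) == r); rewrite ?eqxx //.
  by rewrite (inj_eq perm_inj) er_eq (negPf zr').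
have /and4P[zr zr' _ zb] := H z (mem_head _ _).
have /and4P[cr cr' ca cb] : [&& c != r, c != r', c != a & c != b].
  by apply: H; rewrite inE mem_head orbT.
rewrite IH => [|w wc]; last by apply: H; rewrite inE wc orbT.
rewrite faceE open_faceE // (negPf zb); case: (eqVneq (n (e z)) r) => // ->.
by rewrite ![_ == c]eq_sym (negPf cr) (negPf ca).
Qed.

Lemma nr'_a : (n r' == a) = false.
Proof. by rewrite (inj_eq perm_inj) r'r. Qed.

(** Deleting the root edge merges its triangle [e r], [a], [b] with the boundary face, where [a],
    [b] take the place of [r]. *)
Lemma fcycle_open p : uniq (a :: b :: p) -> r \notin p -> r' \notin p ->
  fcycle (e * n)%g (r :: p) = fcycle (e1 * n1)%g [:: a, b & p].
Proof.
have fr : (e * n)%g r = n r' by rewrite faceE.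
have fa : (e1 * n1)%g a = b by rewrite permM open_edge_a open_node_ea.
have fb : (e1 * n1)%g b = n r' by rewrite permM open_edge_b open_node_eb.
case: p => [|c p] U rp r'p /=.
  by rewrite fr fa fb eqxx nr'_a (negbTE (rt_c RT)).
rewrite fr fa fb eqxx /= fpath_open // => w wp.
move: U => /= /and3P[]; rewrite inE negb_or => /andP[_ ap] bp _.
by rewrite !(contraTneq _ wp) // => ->.
Qed.
End Facts.
End Open.

(** * Disks, and what deleting the root edge does to them *)

Section Disk.
Variable D : finType.
Implicit Types (n e : {perm D}) (r x y z : D) (p : seq D).

(* r :: p lists the darts of the boundary face. Two of them may start at the
   same vertex: the map is a disk when this does not happen. *)
Record predisk n e r p : Prop := Predisk {
  pd_cycle : fcycle (e * n)%g (r :: p);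
  pd_uniq : uniq (r :: p);
  pd_ee : forall x, conn n e r x -> e (e x) = x;
  pd_loop : forall x, conn n e r x -> e x \notin porbit n x;
  pd_simple : forall x y, conn n e r x -> y \in porbit n x ->
    e y \in porbit n (e x) -> x = y;
  pd_inner : forall x, conn n e r x -> x \notin r :: p ->
    (e * n)%g ((e * n)%g ((e * n)%g x)) = x
}.

Definition separated n (q : seq D) := {in q &, forall x y, y \in porbit n x -> x = y}.

Definition disk n e r p := predisk n e r p /\ separated n (r :: p).

Definition adj n e x y := [exists z in porbit n x, e z \in porbit n y].

Lemma adjP n e x y :
  reflect (exists2 z, z \in porbit n x & e z \in porbit n y) (adj n e x y).
Proof. exact: exists_inP. Qed.

Lemma fcycle_closed (s : {perm D}) q z : fcycle s q -> (s z \in q) = (z \in q).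
Proof.
move=> cq; apply/idP/idP => [sz|zq].
  by rewrite -(cycle_porbit _ cq sz) porbit_sym porbit_step.
by rewrite -(cycle_porbit _ cq zq) porbit_step.
Qed.

Lemma face_conn n e r p z : fcycle (e * n)%g (r :: p) -> z \in r :: p -> conn n e r z.
Proof.
move=> cp; rewrite -(cycle_porbit z cp (mem_head _ _)).
apply: porbit_conn => w; rewrite permM; exact: conn_trans (conn1r _ _ _) (conn1l _ _ _).
Qed.

(** If [e r] lies on the boundary too, then [n (e r)] and [e r] are boundary darts at one vertex,
    hence equal, and the disk is a single edge. Otherwise the inner face of [e r] is a triangle,
    nondegenerate since there are no loops and its other two darts are not on the boundary. *)
Lemma disk_cases n e r p : disk n e r p ->
  [/\ n r = r, n (e r) = e r & p = [:: e r]] \/ root_triangle n e r /\ e r \notin p.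
Proof.
case=> [[cp up ee lo si inn] sep].
have rr := conn_refl n e r.
have cl z : ((e * n)%g z \in r :: p) = (z \in r :: p) by apply: fcycle_closed.
have fE z : (e * n)%g z = n (e z) by apply: permM.
have rp := mem_head r p.
have err : e r != r by apply: contraNneq (lo _ rr) => ->; apply: porbit_id.
have [er|er] := boolP (e r \in r :: p).
  have A : n (e r) = e r.
    apply/esym/sep => //; last by rewrite porbit_step.
    by rewrite -fE cl.
  have B : n r = r.
    apply/esym/sep => //; last by rewrite porbit_step.
    by rewrite -{1}(ee _ rr) -fE cl.
  left; split=> //; apply: (fcycle_uniq cp up); last first.
    by rewrite /= andbT inE eq_sym.
  by rewrite /= !fE A (ee _ rr) B !eqxx.
right; split; last by apply: contra er => er; rewrite inE er orbT.
have f3 : n (e (n (e (n r)))) = e r.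
  by have := inn _ (conn1r n e r) er; rewrite !fE (ee _ rr).
have ca : conn n e r (n r) by apply: conn1l.
have aN : n r \notin r :: p by rewrite -{1}(ee _ rr) -fE cl.
have bN : n (e (n r)) \notin r :: p by rewrite -fE cl.
have Nr z : z \notin r :: p -> z != r by apply: contraNneq => ->.
have loa := lo _ ca.
have a_er : n r != e r.
  by apply: contraNneq (lo _ rr) => <-; apply: porbit_step.
split=> //.
- exact: ee.
- exact: Nr.
- exact: Nr.
- apply: contraNneq a_er => E; apply/eqP.
  by move: f3; rewrite E (ee _ rr).
- by apply: contraNneq loa => E; rewrite porbit_sym -{1}E porbit_step.
- apply: contraNneq (lo _ rr) => E; rewrite porbit_sym -{1}E porbit_step //.
- by apply: contraNneq er => E; rewrite -E -fE cl.
Qed.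

Section Open.
Variables (n e : {perm D}) (r : D) (p : seq D).
Let n1 := open_node n e r.
Let e1 := open_edge e r.
Let a := n r.
Let b := n (e a).
Hypothesis RT : root_triangle n e r.

Lemma open_conn z : conn n1 e1 a z -> [/\ conn n e r z, z != r, z != e r & e1 z = e z].
Proof.
rewrite conn_open // => /and3P[rz zr zr']; split=> //.
by rewrite (open_edgeE RT) (negPf zr) (negPf zr').
Qed.

Lemma open_conn' z : conn n1 e1 a z -> [/\ e z != r, e z != e r & conn n1 e1 a (e z)].
Proof.
move=> az; have [rz zr zr' E] := open_conn az.
rewrite (er_eq RT) zr' (inj_eq perm_inj) zr; split=> //.
by rewrite -E; apply: conn_trans az (conn1r _ _ _).
Qed.

Lemma conn_cases z : conn n e r z -> [\/ z = r, z = e r | conn n1 e1 a z].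
Proof.
move=> rz; have [->|zr] := eqVneq z r; first by constructor 1.
have [->|zr'] := eqVneq z (e r); first by constructor 2.
by constructor 3; rewrite conn_open // rz zr zr'.
Qed.

Lemma conn1a z y : conn n1 e1 a z -> y \in porbit n1 z -> conn n1 e1 a y.
Proof. by move=> az /(conn_porbitl e1); apply: conn_trans. Qed.

Lemma open_a : conn n1 e1 a a. Proof. exact: conn_refl. Qed.

Lemma open_b : conn n1 e1 a b.
Proof.
have <- : n1 (e a) = b := open_node_ea RT.
apply: conn_trans (conn1l _ _ _).
by have <- : e1 a = e a := open_edge_a RT; rewrite conn1r.
Qed.

Lemma open_c : conn n1 e1 a (n (e r)).
Proof.
have <- : n1 (e b) = n (e r) := open_node_eb RT.
apply: conn_trans (conn1l _ _ _).
apply: conn_trans open_b _.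
by have <- : e1 b = e b := open_edge_b RT; rewrite conn1r.
Qed.

Lemma porbit_open1 z y : conn n1 e1 a z -> y != r -> y != e r ->
  (y \in porbit n1 z) = (y \in porbit n z).
Proof. by move=> /open_conn[_ zr zr' _] yr yr'; rewrite porbit_open. Qed.

(* Every vertex keeps a dart other than those of the root edge, with which the
   darts of the root edge can be replaced when comparing origins. *)
Lemma porbit_r y : (y \in porbit n r) = (y \in porbit n a).
Proof. by have := porbit_perm n 1 r; rewrite expg1 => ->. Qed.

Lemma porbit_r' y : (y \in porbit n (e r)) = (y \in porbit n (n (e r))).
Proof. by have := porbit_perm n 1 (e r); rewrite expg1 => ->. Qed.

(** Only a [predisk] remains: the third vertex of the root triangle may already lie on the boundary,
    which then passes through it twice. *)
Lemma open_predisk : disk n e r p -> e r \notin p -> predisk n1 e1 a (b :: p).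
Proof.
case=> [[cp up ee lo si inn] sep] er.
have rr := conn_refl n e r.
have cl z : ((e * n)%g z \in r :: p) = (z \in r :: p) by apply: fcycle_closed.
have fE z : (e * n)%g z = n (e z) by apply: permM.
have rp : r \notin p by case/andP: up.
have er' : e r \notin r :: p by rewrite inE negb_or er (rt_e RT).
have aN : a \notin r :: p by rewrite /a -{1}(rt_ee RT) -fE cl.
have bN : b \notin r :: p by rewrite -[b]fE cl.
have uabp : uniq [:: a, b & p].
  move: aN bN up; rewrite !inE !negb_or /= !inE !negb_or => /andP[_ ->] /andP[_ ->] /andP[_ ->].
  by rewrite eq_sym (rt_ab RT).
split=> // [|x|x|x y|x].
- by rewrite -fcycle_open.
- move=> ax; have [rx _ _ ->] := open_conn ax; have [_ _ aex] := open_conn' ax.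
  by have [_ _ _ ->] := open_conn aex; apply: ee.
- move=> ax; have [rx _ _ ->] := open_conn ax; have [h1 h2 _] := open_conn' ax.
  by rewrite porbit_open1 //; apply: lo.
- move=> ax xy; have ay := conn1a ax xy.
  have [rx _ _ ->] := open_conn ax; have [_ _ aex] := open_conn' ax.
  have [ry yr yr' ->] := open_conn ay; have [h1 h2 _] := open_conn' ay.
  by rewrite porbit_open1 //; apply: si => //; rewrite -porbit_open1.
move=> ax; rewrite !inE !negb_or => /and3P[xa xb xp].
have [rx xr xr' _] := open_conn ax.
have xN : x \notin r :: p by rewrite inE negb_or xr.
have step_open y : y != r -> y != e r -> y \notin r :: p -> y != a -> y != b ->
    [/\ (e1 * n1)%g y = (e * n)%g y, (e * n)%g y != r, (e * n)%g y != e r,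
        (e * n)%g y \notin r :: p & (e * n)%g y != a /\ (e * n)%g y != b].
  move=> yr yr' yN ya yb; have := yN; rewrite -cl => fyN.
  have fyr : (e * n)%g y != r by apply: contraNneq fyN => ->; apply: mem_head.
  rewrite open_faceE // -fE (negPf fyr) (negPf yb) fyN; split=> //.
    by rewrite -(rt_f RT) -[n (e (n _))]fE (inj_eq perm_inj).
  rewrite -{1}[a]/(n r) -{1}(rt_ee RT) -[n (e (e r))]fE -[b]fE.
  by rewrite !(inj_eq perm_inj).
have [-> f1r f1r' f1N [f1a f1b]] := step_open x xr xr' xN xa xb.
have [-> f2r f2r' f2N [f2a f2b]] := step_open _ f1r f1r' f1N f1a f1b.
have [-> _ _ _ _] := step_open _ f2r f2r' f2N f2a f2b.
exact: inn.
Qed.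

Lemma conn_outer z : fcycle (e * n)%g (r :: p) -> z \in p -> uniq (r :: p) ->
  e r \notin p -> conn n1 e1 a z.
Proof.
move=> cp zp /andP[rp _] er; rewrite conn_open // (face_conn cp) ?inE ?zp ?orbT //=.
by apply/andP; split; [apply: contraNneq rp => <-|apply: contraNneq er => <-].
Qed.

(** [a] and [n (e r)] start at the two ends of the deleted edge; an edge left between them would
    have been parallel to it. *)
Lemma open_separated : disk n e r p -> e r \notin p ->
  [/\ separated n1 (a :: p), b \notin porbit n1 a & ~~ adj n1 e1 a (n (e r))].
Proof.
case=> [[cp up ee lo si inn] sep] er.
have rr := conn_refl n e r.
have rp : r \notin p by case/andP: up.
have pc z : z \in p -> conn n1 e1 a z by move=> zp; apply: conn_outer.
have sub z y : conn n1 e1 a z -> y \in porbit n1 z -> y \in porbit n z.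
  move=> az zy; have [_ yr yr' _] := open_conn (conn1a az zy).
  by rewrite -porbit_open1.
have na z : z \in p -> z \notin porbit n1 a.
  move=> zp; apply/negP => /(sub _ _ open_a); rewrite -porbit_r => H.
  by case/negP: rp; rewrite (sep _ _ _ _ H) // ?mem_head // inE zp orbT.
split.
- move=> x y; rewrite !inE => /predU1P[->|xp] /predU1P[->|yp] // xy.
  + by have := na _ yp; rewrite xy.
  + by have := na _ xp; rewrite porbit_sym xy.
  + by apply: sep; rewrite ?inE ?xp ?yp ?orbT //; apply: sub => //; apply: pc.
- apply/negP => /(sub _ _ open_a) H; have [ra _ _ _] := open_conn open_a.
  by move: (lo _ ra); rewrite -porbit_closed -/b H.
apply/negP => /adjP[z az zc].
have [rz zr zr' ez] := open_conn (conn1a open_a az).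
have [ezr ezr' aez] := open_conn' (conn1a open_a az).
have H1 : z \in porbit n r by rewrite porbit_r; apply: sub az; apply: open_a.
have H2 : e z \in porbit n (e r).
  by rewrite porbit_r' -ez; apply: sub zc; apply: open_c.
by case/eqP: zr; rewrite (si _ _ rr H1 H2).
Qed.

Lemma close_root_notin : fcycle (e1 * n1)%g [:: a, b & p] -> r \notin p /\ e r \notin p.
Proof.
move=> cp.
have H z : z \in p -> z != r /\ z != e r.
  move=> zp; have /open_conn[] // : conn n1 e1 a z.
  by apply: (face_conn cp); rewrite !inE zp !orbT.
by split; apply/negP => /H[]; rewrite eqxx.
Qed.

Lemma close_head : fcycle (e1 * n1)%g [:: a, b & p] -> exists q, p = n (e r) :: q.
Proof.
case: p => [|c q] /= /and3P[_].
  by rewrite permM (open_edge_b RT) (open_node_eb RT) nr'_a.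
by rewrite permM (open_edge_b RT) (open_node_eb RT) => /eqP-> _; exists q.
Qed.

(** Non-adjacency of the two ends is what prevents a double edge. The origin of [b] may or may not
    occur again in [p]: it becomes an interior vertex or stays on the boundary. *)
Lemma close_disk : predisk n1 e1 a (b :: p) -> separated n1 (a :: p) ->
  ~~ adj n1 e1 a (n (e r)) -> disk n e r p.
Proof.
case=> cp1 up1 ee1 lo1 si1 inn1 sep nadj.
have [rp er] := close_root_notin cp1.
have [q pE] := close_head cp1.
have cp : fcycle (e * n)%g (r :: p) by rewrite fcycle_open.
have up : uniq (r :: p) by move: up1; rewrite /= rp => /and3P[].
have cl z : ((e1 * n1)%g z \in [:: a, b & p]) = (z \in [:: a, b & p]).
  exact: fcycle_closed.
have fE z : (e * n)%g z = n (e z) by apply: permM.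
have cp' : n (e r) \in p by rewrite pE mem_head.
have ap : a \notin p by move: up1; rewrite /= inE negb_or => /and3P[/andP[]].
have lor : e r \notin porbit n r.
  rewrite porbit_r -porbit_closed.
  have [_ cr cr' _] := open_conn open_c.
  rewrite -porbit_open1 ?open_a //; apply/negP => H.
  case/negP: ap; rewrite (sep _ _ _ _ H) // ?mem_head // inE cp' orbT //.
have er1 : e (e r) = r := rt_ee RT.
have noadj y : conn n1 e1 a y -> y \in porbit n r -> e y \in porbit n (e r) -> False.
  move=> ay yr eyr; have [_ yr1 yr2 e1y] := open_conn ay.
  have [ey1 ey2 aey] := open_conn' ay.
  case/negP: nadj; apply/adjP; exists y; first by rewrite porbit_open1 ?open_a // -porbit_r.
  by rewrite e1y porbit_open1 ?open_c // -porbit_r'.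
have ee x : conn n e r x -> e (e x) = x.
  case/conn_cases => [->|->|ax] //; first by rewrite er1.
  have [_ _ aex] := open_conn' ax; rewrite -[RHS]ee1 //.
  by have [_ _ _ ->] := open_conn ax; have [_ _ _ ->] := open_conn aex.
have rr := conn_refl n e r.
split; first split => //.
- move=> x /conn_cases[->|->|ax] //; first by rewrite er1 porbit_sym.
  have [_ _ _ e1x] := open_conn ax; have [ex1 ex2 aex] := open_conn' ax.
  by rewrite -porbit_open1 // -e1x; apply: lo1.
- move=> x y rx yx eyx.
  have ry : conn n e r y by apply: conn_trans rx (conn_porbitl _ yx).
  have A z : conn n e r z -> z \in porbit n r -> e z \in porbit n (e r) -> z = r.
    case/conn_cases => [//|->|az] H1 H2; last by case: (noadj z).
    by case/negP: lor.
  case/conn_cases: rx yx eyx => [->|->|ax] yx eyx.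
  + by rewrite (A y).
  + apply: (@perm_inj _ e); rewrite er1 (A (e y)) //.
      by apply: conn_trans ry (conn1r _ _ _).
    by rewrite er1 in eyx.
    by rewrite ee.
  case/conn_cases: ry yx eyx => [->|->|ay] yx eyx.
  + by case: (noadj x) => //; rewrite porbit_sym.
  + case: (noadj (e x)).
    * by have [_ _] := open_conn' ax.
    * by rewrite er1 porbit_sym in eyx.
    * rewrite ee 1?porbit_sym //.
      by have [] := open_conn ax.
  have [rx xr1 xr2 e1x] := open_conn ax; have [ex1 ex2 aex] := open_conn' ax.
  have [ry yr1 yr2 e1y] := open_conn ay; have [ey1 ey2 aey] := open_conn' ay.
  by apply: si1 => //; rewrite ?e1x ?e1y porbit_open1.
- move=> x rx; rewrite inE negb_or => /andP[xr xp]; rewrite !fE.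
  case/conn_cases: rx xr => [->|->|ax] xr.
  + by rewrite eqxx in xr.
  + by rewrite er1 (rt_f RT).
  have [xa|xa] := eqVneq x a; first by rewrite xa (rt_f RT) er1.
  have [xb|xb] := eqVneq x b; first by rewrite xb (rt_f RT) er1.
  have xN : x \notin [:: a, b & p] by rewrite !inE !negb_or xa xb.
  have step_open y : conn n1 e1 a y -> y \notin [:: a, b & p] ->
      [/\ (e1 * n1)%g y = n (e y), conn n1 e1 a (n (e y)) & n (e y) \notin [:: a, b & p]].
    move=> ay yN; have [_ yr1 yr2 e1y] := open_conn ay.
    have E : (e1 * n1)%g y = n (e y).
      rewrite open_faceE //; case: eqP => [H|_].
        by move: yN; rewrite -cl open_faceE // H eqxx mem_head.
      by case: eqP yN => // ->; rewrite !inE eqxx orbT.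
    rewrite -E cl; split=> //; apply: conn_trans ay _.
    rewrite permM; exact: conn_trans (conn1r _ _ _) (conn1l _ _ _).
  have [E1 c1 N1] := step_open x ax xN; have [E2 c2 N2] := step_open _ c1 N1.
  have [E3 _ _] := step_open _ c2 N2.
  by rewrite -E3 -E2 -E1 inn1.
have H y : y \in p -> y \notin porbit n r.
  move=> yp; have ay : conn n1 e1 a y by apply: conn_outer.
  have [_ yr1 yr2 _] := open_conn ay.
  rewrite porbit_r -porbit_open1 ?open_a //; apply/negP => H.
  by case/negP: ap; rewrite (sep _ _ _ _ H) // ?mem_head // inE yp orbT.
move=> x y; rewrite !inE => /predU1P[->|xp] /predU1P[->|yp] // xy.
- by have := H _ yp; rewrite xy.
- by have := H _ xp; rewrite porbit_sym xy.
have ax : conn n1 e1 a x by apply: conn_outer.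
have ay : conn n1 e1 a y by apply: conn_outer.
have [_ yr1 yr2 _] := open_conn ay.
by apply: sep; rewrite ?inE ?xp ?yp ?orbT // porbit_open1.
Qed.
End Open.
End Disk.

(** * Cutting a disk at a vertex which the boundary visits twice *)

Section Cut.
Variable D : finType.
Variables (n e : {perm D}) (a b g : D) (pR pL : seq D).

(** The boundary [a, b, pR, g, pL] visits one vertex at [b] and at [g], the darts that follow [e a]
    and [e (last b pR)] around it. Exchanging these images splits that vertex, and the boundary into
    [a, g, pL] and [b, pR]. *)
Definition cut_node : {perm D} := (tperm (e a) (e (last b pR)) * n)%g.

Let l := last b pR.
Let h := e l.
Let n2 := cut_node.

Hypothesis same_vertex : h \in porbit n (e a).
Hypothesis apart : ~~ conn n2 e a b.
Hypothesis nea : n (e a) = b.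

Lemma cut_h : n2 h = b.
Proof. by rewrite permM tpermR. Qed.

Lemma conn_hb x : conn n2 e h x = conn n2 e b x.
Proof.
have hb : conn n2 e h b by rewrite -cut_h conn1l.
by apply/idP/idP; apply: conn_trans; rewrite // conn_sym.
Qed.

Lemma conn_aea x : conn n2 e (e a) x = conn n2 e a x.
Proof.
have ha : conn n2 e a (e a) := conn1r _ _ _.
by apply/idP/idP; apply: conn_trans; rewrite // conn_sym.
Qed.

Lemma sides x : conn n2 e a x -> conn n2 e b x -> False.
Proof.
rewrite [conn _ _ b x]conn_sym => ax xb.
by case/negP: apart; apply: conn_trans ax xb.
Qed.

Lemma same_vertex' : e a \in porbit n h.
Proof. by rewrite porbit_sym. Qed.

Lemma conn_join z : conn n e a z = conn n2 e a z || conn n2 e b z.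
Proof.
rewrite (conn_cut e a z same_vertex') -/l -/h -[(tperm _ _ * _)%g]/n2.
rewrite [conn _ _ a (e a)]conn_sym conn_aea conn_refl conn_hb [conn _ _ a h]conn_sym conn_hb.
by rewrite [conn _ _ b a]conn_sym (negPf apart) orbF.
Qed.

Lemma porbit_joinE x y : (y \in porbit n x) =
  [|| y \in porbit n2 x, (e a \in porbit n2 x) && (y \in porbit n2 h)
    | (h \in porbit n2 x) && (y \in porbit n2 (e a))].
Proof. exact: porbit_cut same_vertex'. Qed.

Lemma porbit_join_same x y : conn n2 e x y ->
  (y \in porbit n x) = (y \in porbit n2 x).
Proof.
move=> xy; rewrite porbit_joinE; case: (y \in porbit n2 x) => //=.
apply/negbTE/negP => H.
suff : conn n2 e (e a) h by rewrite conn_aea conn_sym conn_hb conn_sym (negPf apart).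
case/orP: H => /andP[/(conn_porbitl e) h1 /(conn_porbitl e) h2].
  by apply: conn_trans (conn_trans _ xy) _; [rewrite conn_sym|rewrite conn_sym; exact: h2].
by apply: conn_trans h2 (conn_trans _ h1); rewrite conn_sym.
Qed.

(** Only the vertex that was cut has darts on both sides. *)
Lemma porbit_cross x y : conn n2 e a x -> conn n2 e b y -> y \in porbit n x ->
  e a \in porbit n2 x /\ y \in porbit n2 h.
Proof.
move=> ax yb; rewrite porbit_joinE => /or3P[xy|/andP[]//|/andP[xh _]].
  by case: (sides (conn_trans ax (conn_porbitl e xy))).
case: (sides (conn_trans ax (conn_porbitl e xh))).
by rewrite conn_sym conn_hb conn_refl.
Qed.

Lemma cut_face : (e * n2)%g = (tperm a l * (e * n))%g.
Proof.
apply/permP => z; rewrite !permM; congr (n _).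
by case: (tpermP a l z) => [->|->|/eqP za /eqP zl]; rewrite ?tpermL ?tpermR // tpermD //
  (inj_eq perm_inj) eq_sym.
Qed.

Lemma cut_faceE z : z != a -> z != l -> (e * n2)%g z = (e * n)%g z.
Proof. by move=> za zl; rewrite cut_face permM tpermD // eq_sym. Qed.

Lemma lR : l \in b :: pR. Proof. exact: mem_last. Qed.

Lemma fcycle_join : uniq [:: a, b & pR ++ g :: pL] ->
  fcycle (e * n)%g [:: a, b & pR ++ g :: pL] =
  fcycle (e * n2)%g [:: a, g & pL] && fcycle (e * n2)%g (b :: pR).
Proof. by move=> U; rewrite -cat_cons fcycle_cut // cut_face. Qed.

(** The two face permutations differ at [a] and [l] only, so a face that avoids the boundary is the
    same for both. *)
Lemma step3 n' q q' x (P : pred D) : fcycle (e * n')%g q ->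
  (forall z, conn n2 e x z -> conn n2 e x ((e * n')%g z)) ->
  (forall z, conn n2 e x z -> z \notin q -> (z != a) && (z != l)) ->
  n' = n \/ n' = n2 ->
  conn n2 e x q' -> q' \notin q ->
  (e * n2)%g ((e * n2)%g ((e * n2)%g q')) = (e * n)%g ((e * n)%g ((e * n)%g q')).
Proof.
move=> cq H1 H2 H3 c0 N0.
have S z : conn n2 e x z -> z \notin q ->
    [/\ (e * n2)%g z = (e * n')%g z, (e * n)%g z = (e * n')%g z, conn n2 e x ((e * n')%g z)
      & (e * n')%g z \notin q].
  move=> xz zN; have /andP[za zl] := H2 _ xz zN.
  have E := cut_faceE za zl.
  by rewrite (fcycle_closed _ cq) H1 //; case: H3 => ->; rewrite E.
have [-> -> c1 N1] := S _ c0 N0; have [-> -> c2 N2] := S _ c1 N1.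
by have [-> -> _ _] := S _ c2 N2.
Qed.

Lemma face2_conn x z : conn n2 e x z -> conn n2 e x ((e * n2)%g z).
Proof.
move=> xz; rewrite permM; apply: conn_trans xz _.
exact: conn_trans (conn1r _ _ _) (conn1l _ _ _).
Qed.

Lemma join_predisk : disk n2 e a (g :: pL) -> disk n2 e b pR ->
  predisk n e a (b :: pR ++ g :: pL)
  /\ separated n (a :: pR ++ g :: pL).
Proof.
move=> [[cL uL eeL loL siL innL] sepL] [[cR uR eeR loR siR innR] sepR].
have inL z : z \in [:: a, g & pL] -> conn n2 e a z by apply: face_conn.
have inR z : z \in b :: pR -> conn n2 e b z by apply: face_conn.
have memE z : (z \in [:: a, b & pR ++ g :: pL]) = (z \in b :: pR) || (z \in [:: a, g & pL]).
  by rewrite !inE mem_cat !inE; do !case: (_ == _); case: (_ \in _) => //=; rewrite ?orbT.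
have U : uniq [:: a, b & pR ++ g :: pL].
  have -> : uniq [:: a, b & pR ++ g :: pL] = uniq ((b :: pR) ++ (a :: g :: pL)).
    by rewrite -cat_cons -[a :: _]cat1s uniq_catCA cat1s.
  rewrite cat_uniq uR uL andbT; apply/hasPn => z /inL az; apply/negP => /inR.
  exact: sides az.
have cP := fcycle_join U; rewrite cL cR in cP.
have lN x : x \notin b :: pR -> x != l by apply: contraNneq => ->; apply: lR.
split; first split=> // x.
- by rewrite conn_join => /orP[/eeL|/eeR].
- rewrite conn_join => /orP[ax|bx].
    by rewrite porbit_join_same ?conn1r //; apply: loL.
  by rewrite porbit_join_same ?conn1r //; apply: loR.
- move=> y; rewrite conn_join => cx yx eyx.
  have cy : conn n2 e a y || conn n2 e b y.
    rewrite -conn_join; apply: conn_trans (conn_porbitl e yx).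
    by rewrite conn_join.
  (* Edges on different sides with the same ends would have both ends at the common vertex, hence be
     loops. *)
  have mix u v : conn n2 e a u -> conn n2 e b v -> v \in porbit n u ->
      e v \in porbit n (e u) -> False.
    move=> au bv vu evu.
    have [h1 _] := porbit_cross au bv vu.
    have [h2 _] := porbit_cross (conn_trans au (conn1r _ _ _))
      (conn_trans bv (conn1r _ _ _)) evu.
    case/negP: (loL _ au); rewrite porbit_sym; apply: porbit_trans h2.
    by rewrite porbit_sym.
  case/orP: cx => cx; case/orP: cy => cy.
  + have xy : conn n2 e x y by apply: conn_trans cy; rewrite conn_sym.
    apply: siL => //; first by rewrite -porbit_join_same.
    rewrite -porbit_join_same //.
    by apply: conn_trans (conn_trans xy (conn1r _ _ _)); rewrite conn_sym conn1r.
  + by case: (mix x y).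
  + by case: (mix y x); rewrite // porbit_sym.
  + have xy : conn n2 e x y by apply: conn_trans cy; rewrite conn_sym.
    apply: siR => //; first by rewrite -porbit_join_same.
    rewrite -porbit_join_same //.
    by apply: conn_trans (conn_trans xy (conn1r _ _ _)); rewrite conn_sym conn1r.
- rewrite conn_join memE negb_or => cx /andP[xR xL].
  case/orP: cx => cx.
    rewrite -(step3 (n' := n2) (q := [:: a, g & pL]) (x := a)) //; try by [|right].
    + exact: innL.
    + by move=> z; apply: face2_conn.
    + move=> z az zN; rewrite lN; last by apply/negP => /inR; apply: sides.
      by rewrite andbT; apply: contraNneq zN => ->; apply: mem_head.
  rewrite -(step3 (n' := n2) (q := b :: pR) (x := b)) //; try by [|right].
  + exact: innR.
  + by move=> z; apply: face2_conn.
  + move=> z bz zN; rewrite lN // andbT.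
    by apply/eqP => za; apply: (@sides z) => //; rewrite za conn_refl.
have bR : b \notin pR by case/andP: uR.
have mix x y : x \in [:: a, g & pL] -> y \in pR -> y \in porbit n x -> False.
  move=> xL yR yx; have [|_] := porbit_cross (inL _ xL) _ yx.
    by apply: inR; rewrite inE yR orbT.
  rewrite -eq_porbit_mem; have := porbit_perm n2 1 h; rewrite expg1 cut_h => <-.
  rewrite eq_porbit_mem => H; move: bR.
  by rewrite (sepR _ _ _ _ H) ?yR ?mem_head // inE yR orbT.
have memE2 z : z \in a :: pR ++ g :: pL -> (z \in pR) || (z \in [:: a, g & pL]).
  by rewrite !inE mem_cat !inE => /or4P[]->; rewrite ?orbT.
move=> x y /memE2 /orP[] xc /memE2 /orP[] yc xy.
- apply: sepR; rewrite ?inE ?xc ?yc ?orbT // -porbit_join_same //.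
  have bx : conn n2 e b x by apply: inR; rewrite inE xc orbT.
  by rewrite conn_sym in bx; apply: conn_trans bx (inR _ _); rewrite inE yc orbT.
- by case: (mix y x) => //; rewrite porbit_sym.
- by case: (mix x y).
- apply: sepL => //; rewrite -porbit_join_same //.
  have := inL _ xc; rewrite conn_sym => ax; exact: conn_trans ax (inL _ yc).
Qed.

(** An edge lies on one side only, so the origin of [a] or that of [c] would have to be the common
    vertex. *)
Lemma join_not_adj : disk n2 e a (g :: pL) -> disk n2 e b pR ->
  forall c, c \in pR -> ~~ adj n e a c.
Proof.
move=> [[cL uL eeL loL siL innL] sepL] [[cR uR eeR loR siR innR] sepR] c cpR.
have bc : conn n2 e b c by apply: (face_conn cR); rewrite inE cpR orbT.
apply/adjP => -[z za zc].
have [az|bz] := orP (etrans (esym (conn_join z)) (conn_porbitl e za)).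
  have [_] := porbit_cross (conn_trans az (conn1r _ _ _)) bc
    (etrans (porbit_sym _ _ _) zc).
  have := porbit_perm n2 1 h; rewrite expg1 cut_h => E.
  rewrite -eq_porbit_mem -E eq_porbit_mem => H; case/andP: uR.
  by rewrite (sepR _ _ _ _ H) ?cpR ?mem_head // inE cpR orbT.
have [h1 _] := porbit_cross (conn_refl _ _ _) bz za.
by case/negP: (loL _ (conn_refl _ _ _)).
Qed.

Lemma cut_disks : predisk n e a (b :: pR ++ g :: pL) ->
  separated n [:: a, g & pL] -> separated n (b :: pR) ->
  disk n2 e a (g :: pL) /\ disk n2 e b pR.
Proof.
move=> [c0 U ee lo si inn] sepL sepR.
have memE z : (z \in [:: a, b & pR ++ g :: pL]) = (z \in b :: pR) || (z \in [:: a, g & pL]).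
  by rewrite !inE mem_cat !inE; do !case: (_ == _); case: (_ \in _) => //=; rewrite ?orbT.
have := U.
have -> : uniq [:: a, b & pR ++ g :: pL] = uniq ((b :: pR) ++ (a :: g :: pL)).
  by rewrite -cat_cons -[a :: _]cat1s uniq_catCA cat1s.
rewrite cat_uniq => /and3P[uR _ uL].
have := c0; rewrite fcycle_join // => /andP[cL cR].
have inL z : z \in [:: a, g & pL] -> conn n2 e a z by apply: face_conn.
have inR z : z \in b :: pR -> conn n2 e b z by apply: face_conn.
have sub x y : y \in porbit n2 x -> y \in porbit n x.
  by rewrite porbit_joinE => ->.
have lN x : x \notin b :: pR -> x != l by apply: contraNneq => ->; apply: lR.
have joinL x : conn n2 e a x -> conn n e a x by rewrite conn_join => ->.
have joinR x : conn n2 e b x -> conn n e a x by rewrite conn_join orbC => ->.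
split; split.
- split=> // x.
  + by move/joinL/ee.
  + by move/joinL/lo; apply: contra; apply: sub.
  + by move=> y /joinL ax /sub h1 /sub h2; apply: si.
  + move=> ax xN.
    rewrite (step3 (n' := n2) (q := [:: a, g & pL]) (x := a)) //; try by [|right].
    * apply: inn; first exact: joinL.
      rewrite memE negb_or xN andbT; apply/negP => /inR; exact: sides ax.
    * by move=> z; apply: face2_conn.
    * move=> z az zN; rewrite lN; last by apply/negP => /inR; apply: sides.
      by rewrite andbT; apply: contraNneq zN => ->; apply: mem_head.
- by move=> x y xL yL /sub; apply: sepL.
- split=> // x.
  + by move/joinR/ee.
  + by move/joinR/lo; apply: contra; apply: sub.
  + by move=> y /joinR ax /sub h1 /sub h2; apply: si.
  + move=> bx xN.
    rewrite (step3 (n' := n2) (q := b :: pR) (x := b)) //; try by [|right].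
    * apply: inn; first exact: joinR.
      rewrite memE negb_or xN /=; apply/negP => /inL ax; exact: sides ax bx.
    * by move=> z; apply: face2_conn.
    * move=> z bz zN; rewrite lN // andbT.
      by apply/eqP => za; apply: (@sides z) => //; rewrite za conn_refl.
- by move=> x y xL yL /sub; apply: sepR.
Qed.

End Cut.

(* The way a triangulation is taken apart by deleting root edges: [Cover c] is
   [c] with a new root edge covering the first two outer edges, so that one
   vertex becomes interior; [Join c d] glues [c] and [d] at a vertex and
   closes them with a new root edge. *)
Inductive code := Edge | Join of code & code | Cover of code.

(** The number of outer edges besides the root edge. *)
Fixpoint border c := match c with
  | Edge => 1
  | Join c d => border c + border d
  | Cover c => (border c).-1
  end.

(* How many times [Cover] can be applied before it creates a double edge. *)
Fixpoint slack c := match c with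
  | Edge => 0
  | Join _ d => (border d).-1
  | Cover c => (slack c).-1
  end.

Fixpoint nedges c := match c with
  | Edge => 1
  | Join c d => (nedges c + nedges d).+1
  | Cover c => (nedges c).+1
  end.

Fixpoint valid_code c := match c with
  | Edge => true
  | Join c d => valid_code c && valid_code d
  | Cover c => valid_code c && (0 < slack c)
  end.

(** * Reading a disk as a code *)

Section Coding.
Variable D : finType.
Implicit Types (n e : {perm D}) (r x y z : D) (p : seq D).

Definition darts n e r : {set D} := [set z | conn n e r z].

(** All stages share [D]: deleted darts are fixed points, and the halves of a [Join] live in the
    same [n2] and [e1], told apart by their roots [a] and [b]. That the halves are separated is part
    of the relation. *)
Fixpoint coded c n e r p : Prop :=
  let a := n r in let b := n (e a) in
  let n1 := open_node n e r in let e1 := open_edge e r in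
  match c with
  | Edge => [/\ n r = r, n (e r) = e r, e r != r, e (e r) = r & p = [:: e r]]
  | Cover c' => root_triangle n e r /\ coded c' n1 e1 a (b :: p)
  | Join c1 c2 => root_triangle n e r /\
      exists pR g pL, let n2 := cut_node n1 e1 a b pR in
      [/\ p = pR ++ g :: pL, e1 (last b pR) \in porbit n1 (e1 a), ~~ conn n2 e1 a b,
          coded c1 n2 e1 a (g :: pL) & coded c2 n2 e1 b pR]
  end.

Lemma porbit_mul_conj n e x y : e y \in porbit (n * e) (e x) -> y \in porbit (e * n) x.
Proof.
move=> H; rewrite -[y](permK e).
apply: (porbit_ind (P := fun w => (e^-1)%g w \in porbit (e * n) x)) H => [z|].
  rewrite permM permK -{2}[z](permKV e) -(permM e n) => H.
  by rewrite porbit_closed.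
by rewrite permK porbit_id.
Qed.

(** Planarity enters here: were [a] and [b] still connected, [planar_cut] would put [a] on the face
    [b :: pR], to which it does not belong. *)
Lemma cut_apart n e a b g pR pL : planar n e ->
  fcycle (e * n)%g [:: a, b & pR ++ g :: pL] -> uniq [:: a, b & pR ++ g :: pL] ->
  e (last b pR) \in porbit n (e a) -> n (e a) = b ->
  planar (cut_node n e a b pR) e /\ ~~ conn (cut_node n e a b pR) e a b.
Proof.
move=> pl cp U sv nea; set l := last b pR; set n2 := cut_node _ _ _ _ _.
have lin : l \in b :: pR by apply: mem_last.
have aN : a \notin b :: pR.
  by move: U; rewrite -cat_cons cons_uniq mem_cat negb_or => /andP[/andP[]].
have al : e a != e l by rewrite (inj_eq perm_inj); apply: contraNneq aN => ->.
have sv' : e a \in porbit n (e l) by rewrite porbit_sym.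
have [pl2 H] := planar_cut al sv' pl; split=> //.
apply/negP => ab; case/negP: aN.
move: cp; rewrite (fcycle_join _ _ U) => /andP[_ cR].
rewrite -(cycle_porbit _ cR lin); apply: porbit_mul_conj; apply: H.
have h1 : conn n2 e a (e a) := conn1r _ _ _.
have h2 : conn n2 e (e l) b by rewrite -(@cut_h _ n e a b pR nea) conn1l.
apply: conn_trans (conn_trans _ ab) _; rewrite conn_sym //.
Qed.

Lemma leaf_disk n e r : n r = r -> n (e r) = e r -> e r != r -> e (e r) = r ->
  disk n e r [:: e r] /\ #|darts n e r| = 2.
Proof.
move=> nr ner er eer.
have cE z : conn n e r z = (z == r) || (z == e r).
  apply/idP/orP => [|[/eqP->|/eqP->]]; rewrite ?conn_refl ?conn1r //.
  apply: (conn_ind (P := fun w => w == r \/ w == e r)) => [w|w|]; last by left.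
    by case=> /eqP->; rewrite ?nr ?ner eqxx; [left|right].
  by case=> /eqP->; rewrite ?eer eqxx; [right|left].
have nfix x : conn n e r x -> n x = x by rewrite cE => /orP[]/eqP->.
have pfix x y : conn n e r x -> y \in porbit n x -> x = y.
  by move=> /nfix nx; rewrite porbit_sym => /(porbit_fix nx).
have ee x : conn n e r x -> e (e x) = x by rewrite cE => /orP[]/eqP->; rewrite !eer.
split; last first.
  suff -> : darts n e r = [set r; e r] by rewrite cards2 eq_sym er.
  by apply/setP=> z; rewrite !inE cE.
split; first split=> //.
- by rewrite /= !permM ner eer nr !eqxx.
- by rewrite /= inE eq_sym er.
- move=> x cx; apply/negP => /(pfix _ _ cx); move: cx; rewrite cE => /orP[]/eqP-> /eqP.
    by rewrite eq_sym (negPf er).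
  by rewrite eer (negPf er).
- by move=> x y cx xy _; apply: pfix.
- by move=> x; rewrite cE !inE => ->.
by move=> x y; rewrite !inE -!cE => cx _; apply: pfix.
Qed.

Lemma card_open n e r : root_triangle n e r ->
  #|darts n e r| = (#|darts (open_node n e r) (open_edge e r) (n r)|).+2.
Proof.
move=> RT.
rewrite (cardsD1 r) (cardsD1 (e r)) !inE conn_refl conn1r (rt_e RT) !add1n.
congr (_.+2); apply: eq_card => z; rewrite !inE conn_open //.
by case: (z == r); case: (z == e r); case: (conn _ _ _ _).
Qed.

Lemma card_join n e a b g pR pL : e (last b pR) \in porbit n (e a) ->
  ~~ conn (cut_node n e a b pR) e a b -> n (e a) = b ->
  fcycle (e * cut_node n e a b pR)%g [:: a, g & pL] ->
  #|darts n e a| = #|darts (cut_node n e a b pR) e a| + #|darts (cut_node n e a b pR) e b|.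
Proof.
move=> sv ncn nea _; set n2 := cut_node _ _ _ _ _ in ncn *.
rewrite -cardsUI [X in _ + X]eq_card0 ?addn0 => [|z].
  by apply: eq_card => z; rewrite !inE; apply: conn_join.
by rewrite !inE; apply/negP => /andP[h1 h2]; apply: (sides ncn h1 h2).
Qed.

(** From the origin of [r], the deleted edge reaches only the origin of [n (e r)], which is
    excluded. *)
Lemma adj_open n e r p x : root_triangle n e r -> disk n e r p -> e r \notin p ->
  x \in p -> x != n (e r) ->
  adj n e r x = adj (open_node n e r) (open_edge e r) (n r) x.
Proof.
move=> RT dM er xp xc; case: (dM) => -[cp up ee lo si inn] sep.
have rr := conn_refl n e r.
have a1x : conn (open_node n e r) (open_edge e r) (n r) x.
  by apply: conn_outer cp _ up er.
have [_ xr xr' _] := open_conn RT a1x.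
have cin : n (e r) \in r :: p.
  by rewrite -(permM e n) (fcycle_closed _ cp) mem_head.
apply/adjP/adjP => -[z za zx].
  have [E|zr] := eqVneq z r.
    case/eqP: xc; apply: sep; rewrite // ?inE ?xp ?orbT //.
    by rewrite porbit_closed -E.
  have zr' : z != e r by apply: contraTneq za => ->; apply: lo.
  have a1z : conn (open_node n e r) (open_edge e r) (n r) z.
    by rewrite conn_open // zr zr' !andbT; apply: conn_porbitl.
  have [_ _ _ e1z] := open_conn RT a1z.
  have [h1 h2 _] := open_conn' RT a1z.
  exists z; first by rewrite porbit_open1 ?open_a // -porbit_r.
  by rewrite e1z porbit_open1.
have a1z := conn1a (open_a _ _ _) za.
have [_ zr zr' e1z] := open_conn RT a1z.
have [h1 h2 _] := open_conn' RT a1z.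
exists z; first by rewrite porbit_r -(porbit_open1 RT) ?open_a.
by rewrite -(porbit_open1 RT) // -e1z.
Qed.

(** The third conclusion tells what [slack] measures: how many boundary vertices, counted from the
    second one of [p], come before the first neighbor of the root's origin. The new edge of a
    [Cover] ends at the first vertex so counted, hence positive slack means that no double edge
    arises. *)
Lemma coded_sound c n e r p : valid_code c -> coded c n e r p ->
  [/\ disk n e r p, size p = border c, find (adj n e r) (behead p) = slack c
    & #|darts n e r| = (nedges c).*2].
Proof.
elim: c n e r p => [|c1 IH1 c2 IH2|c IH] n e r p /=.
- move=> _ [nr ner er eer ->].
  by have [] := leaf_disk nr ner er eer.
- case/andP=> v1 v2 [RT [pR [g [pL [pE sv ncn C1 C2]]]]]; subst p.
  have [d1 s1 _ k1] := IH1 _ _ _ _ v1 C1.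
  have [d2 s2 _ k2] := IH2 _ _ _ _ v2 C2.
  move: sv ncn d1 k1 d2 k2 {C1 C2}.
  set n1 := open_node n e r; set e1 := open_edge e r.
  set a := n r; set b := n (e a) => sv ncn d1 k1 d2 k2.
  have nea : n1 (e1 a) = b by rewrite /e1 open_edge_a // /n1 open_node_ea.
  have [pd sep] := join_predisk sv ncn nea d1 d2.
  have nadj := join_not_adj sv ncn nea d1 d2.
  have [q pE] := close_head RT (pd_cycle pd).
  have cardE := card_join sv ncn nea (pd_cycle d1.1).
  have [rp er] := close_root_notin RT (pd_cycle pd).
  case: pR => [|c pR] in sv ncn d1 k1 d2 k2 s2 pd sep nadj pE cardE rp er *.
    (* An empty [pR] would make the edge of [b] a loop. *)
    case: d2 => -[] /= /andP[]; rewrite permM => /eqP E _ _ _ /(_ b (conn_refl _ _ _)).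
    by rewrite porbit_sym -{1}E porbit_step.
  case: pE => cE qE.
  have dM : disk n e r ((c :: pR) ++ g :: pL).
    by apply: close_disk => //; rewrite -cE; apply: nadj; apply: mem_head.
  have up := pd_uniq dM.1.
  split=> //.
  + by rewrite size_cat s1 s2 addnC.
  + rewrite /= find_cat.
    have xN x : x \in pR ++ g :: pL -> x != n (e r).
      rewrite -cE => xp; apply: contraTneq xp => ->.
      by move: up => /= /and3P[].
    (* No vertex of the right boundary is a neighbor of the origin of [a], while the edge of [a]
       reaches that of [g]: the search stops after [border c2 - 1] vertices. *)
    have -> : has (adj n e r) pR = false.
      apply/negbTE/hasPn => x xp.
      rewrite (adj_open RT dM er) ?xN ?mem_cat ?inE ?xp ?orbT //.
      by apply: nadj; rewrite inE xp orbT.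
    rewrite /= (adj_open RT dM er) ?xN ?mem_cat ?inE ?eqxx ?orbT //.
    suff -> : adj n1 e1 a g by rewrite addn0 -s2.
    apply/adjP; exists a; first exact: porbit_id.
    case: (d1) => -[] /= /andP[]; rewrite permM => /eqP E _ _ _ _ _ _ _.
    rewrite porbit_sym (porbit_joinE sv) -{1}E ?porbit_step //.
  + by rewrite card_open // cardE k1 k2 -doubleD.
- case/andP=> v sl [RT C].
  have [d s f k] := IH _ _ _ _ v C.
  have pd := d.1.
  have [q pE] := close_head RT (pd_cycle pd).
  have [rp er] := close_root_notin RT (pd_cycle pd).
  have nadj : ~~ adj (open_node n e r) (open_edge e r) (n r) (n (e r)).
    by move: f sl; rewrite pE /=; case: ifP => // _ <-.
  have dM : disk n e r p.
    apply: close_disk => // x y; rewrite !inE => xp yp.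
    by apply: d.2; rewrite !inE; [move: xp|move: yp]; case/orP=> ->; rewrite ?orbT.
  split=> //.
  + by rewrite -s.
  + rewrite -f pE /= (negPf nadj) /=.
    apply: eq_in_find => x xq; apply: (adj_open RT dM er); first by rewrite pE inE xq orbT.
    have := pd_uniq dM.1; rewrite pE /= => /and3P[_ cq _].
    by apply: contraNneq cq => <-.
  + by rewrite card_open // k.
Qed.

(** The code is a [Cover] or a [Join] according to whether the boundary left by the root edge passes
    once or twice through the apex of its triangle. *)
Lemma coded_exists n e r p : planar n e -> disk n e r p ->
  exists2 c, valid_code c & coded c n e r p.
Proof.
have [k] := ubnP #|darts n e r|; elim: k => // k IH in n e r p * => kE pl dM.
case: (dM) => -[cp up ee lo si inn] sep.
have [[nr ner pE]|[RT er]] := disk_cases dM.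
  have rr := conn_refl n e r.
  by exists Edge => //=; split=> //; [apply: contraNneq (lo _ rr) => ->; apply: porbit_id|apply: ee].
have pd := open_predisk RT dM er.
have [sep1 ba nadj] := open_separated RT dM er.
have pl1 := planar_open r pl.
set n1 := open_node n e r in pd sep1 ba nadj pl1 *.
set e1 := open_edge e r in pd nadj pl1 *.
set a := n r in pd sep1 ba nadj *; set b := n (e a) in pd ba *.
have [q pE] := close_head RT (pd_cycle pd).
have cardE := card_open RT; rewrite -/n1 -/e1 -/a in cardE.
have [|gN] := boolP (has (fun g => g \in porbit n1 b) p); last first.
  have d1 : disk n1 e1 a (b :: p).
    split=> // x y xp yp xy; have /hasPn gN' := gN.
    have H u v : u = b -> v \in [:: a, b & p] -> v \in porbit n1 u -> u = v.
      move=> ->; rewrite !inE => /or3P[/eqP->|/eqP-> //|/gN'/negbTE->] //.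
      by rewrite porbit_sym (negPf ba).
    have [xb|xb] := eqVneq x b; first exact: H.
    have [yb|yb] := eqVneq y b; first by apply/esym/H; rewrite // porbit_sym.
    by apply: sep1; move: xp yp; rewrite ?inE ?(negPf xb) ?(negPf yb).
  have [c vc cc] : exists2 c, valid_code c & coded c n1 e1 a (b :: p).
    by apply: IH => //; rewrite -ltnS; apply: leq_trans kE; rewrite cardE !ltnS leqnSn.
  exists (Cover c) => //=; rewrite vc /=.
  have [_ _ <- _] := coded_sound vc cc.
  by rewrite pE /= (negPf nadj).
case/hasP=> g gp gb; case/splitPr: gp (sep) => pR pL sep' in cp up er pd sep1 pE cardE *.
(* [g] is not the first dart of [p], whose origin is joined to that of [b] by an edge; hence [pR] is
   not empty. *)
have cN : ~~ (n (e r) \in porbit n1 b).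
  have [_ cr cr' _] := open_conn RT (open_c RT).
  rewrite porbit_open1 ?open_b // porbit_closed.
  have eb : n (e b) = e r := rt_f RT.
  rewrite -eb porbit_closed; apply: lo.
  by have [] := open_conn RT (open_b RT).
have [c [pR' pRE]] : exists c pR', pR = c :: pR'.
  move: pE; case: (pR) => [|c pR'] pE; last by exists c, pR'.
  by case: pE gb => -> _ gb; rewrite gb in cN.
have nea : n1 (e1 a) = b by rewrite /e1 open_edge_a // /n1 open_node_ea.
have lg : n1 (e1 (last b pR)) = g.
  have := pd_cycle pd; rewrite /= rcons_cat cat_path /= => /and3P[_ _ /andP[/eqP]].
  by rewrite permM.
have sv : e1 (last b pR) \in porbit n1 (e1 a).
  by rewrite porbit_sym -porbit_closed nea porbit_sym -porbit_closed lg.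
have [pl2 ncn] := cut_apart pl1 (pd_cycle pd) (pd_uniq pd) sv nea.
have sepL : separated n1 [:: a, g & pL].
  move=> x y xL yL; apply: sep1; rewrite !inE mem_cat.
    by move: xL; rewrite !inE => /or3P[]->; rewrite ?orbT.
  by move: yL; rewrite !inE => /or3P[]->; rewrite ?orbT.
have gpR : g \notin pR.
  by move: up; rewrite /= cat_uniq => /and4P[_ _ /hasPn/(_ g (mem_head _ _))].
have bpR y : y \in pR -> y \in porbit n1 b -> b = y.
  move=> yp yb; case/negP: gpR; rewrite -(sep1 y g) //.
  - by rewrite inE mem_cat yp orbT.
  - by rewrite inE mem_cat mem_head !orbT.
  - by apply: porbit_trans gb _; rewrite porbit_sym.
have sepR : separated n1 (b :: pR).
  move=> x y; rewrite !inE => /predU1P[->|xp] /predU1P[->|yp] xy //.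
  - exact: bpR.
  - by apply/esym/bpR; rewrite // porbit_sym.
  - by apply: sep1; rewrite // inE mem_cat ?xp ?yp !orbT.
have [dL dR] := cut_disks sv ncn nea pd sepL sepR.
have cardE2 := card_join sv ncn nea (pd_cycle dL.1).
have [c1 v1 C1] : exists2 c, valid_code c & coded c (cut_node n1 e1 a b pR) e1 a (g :: pL).
  by apply: IH => //; rewrite -ltnS; apply: leq_trans kE; rewrite cardE cardE2 !ltnS leqW // leq_addr.
have [c2 v2 C2] : exists2 c, valid_code c & coded c (cut_node n1 e1 a b pR) e1 b pR.
  by apply: IH => //; rewrite -ltnS; apply: leq_trans kE; rewrite cardE cardE2 !ltnS leqW // leq_addl.
exists (Join c1 c2); first by rewrite /= v1 v2.
by split=> //; exists pR, g, pL; split.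
Qed.
End Coding.

(** * Transport of codes along isomorphisms of components *)

Section LocalIso.
Variables D D' : finType.
Implicit Types (n e : {perm D}) (f : D -> D').

(** Nothing is asked of [f] outside the component of [r], where deleted darts and the other half of
    a cut may lie. *)
Record local_iso n e (r : D) (n' e' : {perm D'}) (r' : D') f : Prop := LocalIso {
  li_root : f r = r';
  li_n : forall x, conn n e r x -> f (n x) = n' (f x);
  li_e : forall x, conn n e r x -> f (e x) = e' (f x);
  li_inj : forall x y, conn n e r x -> conn n e r y -> f x = f y -> x = y
}.

Section Transport.
Variables (n e : {perm D}) (r : D) (n' e' : {perm D'}) (r' : D') (f : D -> D').
Hypothesis L : local_iso n e r n' e' r' f.

Lemma li_eq x y : conn n e r x -> conn n e r y -> (f x == f y) = (x == y).
Proof.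
by move=> rx ry; apply/eqP/eqP => [/(li_inj L rx ry)|->].
Qed.

Lemma li_conn x y : conn n e r x -> conn n e x y -> conn n' e' (f x) (f y).
Proof.
move=> rx; pose P w := conn n e r w /\ conn n' e' (f x) (f w).
suff H : conn n e x y -> P y by move/H => [].
apply: (conn_ind (P := P)) => [z [rz xz]|z [rz xz]|]; last by split=> //; apply: conn_refl.
  split; first exact: conn_trans rz (conn1l _ _ _).
  by rewrite (li_n L rz); apply: conn_trans xz (conn1l _ _ _).
split; first exact: conn_trans rz (conn1r _ _ _).
by rewrite (li_e L rz); apply: conn_trans xz (conn1r _ _ _).
Qed.

Lemma li_conn_inv x y' : conn n e r x -> conn n' e' (f x) y' ->
  exists2 y, conn n e x y & y' = f y.
Proof.
move=> rx; apply: (conn_ind (P := fun w => exists2 y, conn n e x y & w = f y)).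
- move=> _ [y xy ->]; exists (n y); first exact: conn_trans xy (conn1l _ _ _).
  by rewrite (li_n L) //; apply: conn_trans rx xy.
- move=> _ [y xy ->]; exists (e y); first exact: conn_trans xy (conn1r _ _ _).
  by rewrite (li_e L) //; apply: conn_trans rx xy.
- by exists x; rewrite // conn_refl.
Qed.

Lemma li_porbit x y : conn n e r x -> y \in porbit n x -> f y \in porbit n' (f x).
Proof.
move=> rx; pose P w := conn n e r w /\ f w \in porbit n' (f x).
suff H : y \in porbit n x -> P y by move/H => [].
apply: (porbit_ind (P := P)) => [z [rz xz]|]; last by rewrite /P porbit_id.
split; first exact: conn_trans rz (conn1l _ _ _).
by rewrite (li_n L rz) porbit_closed.
Qed.

Lemma li_triangle : root_triangle n e r -> root_triangle n' e' r'.
Proof.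
have rr := conn_refl n e r.
have cn x : conn n e r x -> conn n e r (n x).
  by move=> rx; apply: conn_trans rx (conn1l _ _ _).
have ce x : conn n e r x -> conn n e r (e x).
  by move=> rx; apply: conn_trans rx (conn1r _ _ _).
have N := li_n L; have E := li_e L.
case=> *; rewrite -(li_root L).
by split; rewrite -?(E, N) ?li_eq ?(cn, ce) //; congr f.
Qed.

Lemma li_open : root_triangle n e r ->
  local_iso (open_node n e r) (open_edge e r) (n r)
            (open_node n' e' r') (open_edge e' r') (n' r') f.
Proof.
move=> RT; have RT' := li_triangle RT.
have rr := conn_refl n e r.
have rr1 : conn n e r (e r) := conn1r _ _ _.
have rE := li_root L.
have r'E : f (e r) = e' r' by rewrite (li_e L) ?rE.
have sub x : conn (open_node n e r) (open_edge e r) (n r) x -> conn n e r x.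
  by case/(open_conn RT).
split=> [|x /sub rx|x /sub rx|x y /sub rx /sub ry]; last exact: (li_inj L).
- by rewrite (li_n L) ?rE.
- have rn : conn n e r (n x) by apply: conn_trans rx (conn1l _ _ _).
  rewrite (open_nodeE RT) (open_nodeE RT') -r'E -rE -(li_n L rx) !li_eq //.
  by do !case: ifP => // _; rewrite !(li_n L).
- rewrite (open_edgeE RT) (open_edgeE RT') -r'E -rE !li_eq //.
  by do !case: ifP => // _; rewrite !(li_e L).
Qed.

Lemma li_tperm x y z : conn n e r x -> conn n e r y -> conn n e r z ->
  f (tperm x y z) = tperm (f x) (f y) (f z).
Proof.
move=> rx ry rz; case: (tpermP x y z) => [->|->|/eqP zx /eqP zy]; rewrite ?tpermL ?tpermR //.
by rewrite tpermD // eq_sym li_eq.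
Qed.

(** The root [s] is left open because the cut produces two maps in the same permutations. *)
Lemma li_cut b pR s : conn n e r (last b pR) -> conn n e r s ->
  (forall z, conn (cut_node n e r b pR) e s z -> conn n e r z) ->
  local_iso (cut_node n e r b pR) e s
            (cut_node n' e' r' (f b) (map f pR)) e' (f s) f.
Proof.
move=> rl rs sub; have rE := li_root L; have rr := conn_refl n e r.
split=> // [x /sub rx|x /sub rx|x y /sub rx /sub ry]; last exact: (li_inj L).
  have re : conn n e r (e r) := conn1r _ _ _.
  have rel : conn n e r (e (last b pR)) by apply: conn_trans rl (conn1r _ _ _).
  rewrite permM [RHS]permM last_map -rE -!(li_e L) // -li_tperm // (li_n L) //.
  by case: tpermP.
exact: (li_e L).
Qed.

End Transport.

Lemma conn_cut_sub n e a b (pR : seq D) s z : e (last b pR) \in porbit n (e a) ->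
  conn n e a s ->
  conn (cut_node n e a b pR) e s z -> conn n e a z.
Proof.
move=> sv as1 sz; apply: conn_trans as1 _.
move: sz; apply: conn_sub => w; last exact: conn1r.
rewrite permM; apply: conn_trans (conn1l _ _ _).
case: tpermP => [->|->|_ _]; last exact: conn_refl.
  exact: conn_porbitl.
by apply: conn_porbitl; rewrite porbit_sym.
Qed.
End LocalIso.

Lemma coded_iso (D D' : finType) c (n e : {perm D}) r p (n' e' : {perm D'}) r' f :
  valid_code c -> coded c n e r p -> local_iso n e r n' e' r' f ->
  coded c n' e' r' (map f p).
Proof.
elim: c n e r p n' e' r' => [|c1 IH1 c2 IH2|c IH] n e r p n' e' r' /=.
- move=> _ [nr ner er eer ->] L.
  have rr := conn_refl n e r; have re : conn n e r (e r) := conn1r _ _ _.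
  have r'E : f (e r) = e' r' by rewrite (li_e L) ?(li_root L).
  rewrite /= -r'E -(li_root L) -!(li_n L) -?(li_e L) // nr ner eer; split=> //.
  by rewrite (li_eq L).
- case/andP=> v1 v2 [RT [pR [g [pL [pE sv ncn C1 C2]]]]] L; subst p.
  have RT' := li_triangle L RT; have L1 := li_open L RT.
  have ca := open_conn RT (open_a n e r); have cb := open_conn RT (open_b RT).
  have [d1 _ _ _] := coded_sound v1 C1.
  have [d2 _ _ _] := coded_sound v2 C2.
  move: sv ncn d1 d2 L1 C1 C2.
  set n1 := open_node n e r; set e1 := open_edge e r; set a := n r; set b := n (e a).
  set n1' := open_node n' e' r'; set e1' := open_edge e' r'; set a' := n' r'.
  set b' := n' (e' a') => sv ncn d1 d2 L1 C1 C2.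
  have aE : f a = a' by rewrite /a (li_n L) ?(li_root L) ?conn_refl.
  have bE : f b = b'.
    have [ra _ _ _] := ca.
    rewrite /b (li_n L) ?(li_e L) ?aE //; exact: conn_trans ra (conn1r _ _ _).
  have ab : conn n1 e1 a b by apply: open_b.
  have lb : conn n1 e1 a (last b pR).
    apply: (conn_cut_sub sv ab); apply: face_conn (pd_cycle d2.1) _; exact: mem_last.
  have sub s z := @conn_cut_sub D n1 e1 a b pR s z sv.
  have L2 := li_cut L1 lb (conn_refl _ _ _) (fun z => sub _ _ (conn_refl _ _ _)).
  have L3 := li_cut L1 lb ab (fun z => sub _ _ ab).
  rewrite aE bE -/n1' -/e1' in L2 L3.
  split=> //; exists (map f pR), (f g), (map f pL); split.
  + by rewrite map_cat.
  + have cea : conn n1 e1 a (e1 a) := conn1r _ _ _.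
    have := li_porbit L1 cea sv.
    by rewrite !(li_e L1) ?aE ?conn_refl // -bE last_map.
  + apply/negP => H; have := li_conn_inv L2 (conn_refl _ _ _).
    rewrite aE => /(_ _ H) [y ay]; rewrite -bE => E.
    have yb : b = y by apply: (li_inj L1) => //; apply: sub ay; apply: conn_refl.
    by move: ay; rewrite -yb => ay; case/negP: ncn.
  + exact: (IH1 _ _ _ _ _ _ _ v1 C1 L2).
  + exact: (IH2 _ _ _ _ _ _ _ v2 C2 L3).
- case/andP=> v _ [RT C] L; split; first exact: li_triangle L RT.
  have L1 := li_open L RT; have := IH _ _ _ _ _ _ _ v C L1.
  rewrite /= (li_n L) ?(li_e L) ?(li_n L) ?(li_root L) ?conn_refl ?conn1l //.
  by apply: conn_trans (conn1l _ _ _) (conn1r _ _ _).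
Qed.

(** * Uniqueness of the code of a disk *)

Section Uniqueness.

Lemma disk_outer_eq (D : finType) (n e : {perm D}) r p q : disk n e r p -> disk n e r q -> p = q.
Proof. by case=> [[cp up _ _ _ _] _] [[cq uq _ _ _ _] _]; apply: fcycle_uniq cp up cq uq. Qed.

Lemma uniq_split (T : eqType) (x : T) (p1 p2 q1 q2 : seq T) :
  uniq (p1 ++ x :: p2) -> p1 ++ x :: p2 = q1 ++ x :: q2 -> p1 = q1 /\ p2 = q2.
Proof.
move=> U E; have sz : size p1 = size q1.
  have i1 : index x (p1 ++ x :: p2) = size p1.
    rewrite index_cat /= eqxx addn0.
    by move: U; rewrite cat_uniq /= negb_or => /and3P[_ /andP[/negbTE-> _] _].
  have i2 : index x (q1 ++ x :: q2) = size q1.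
    rewrite index_cat /= eqxx addn0.
    by move: U; rewrite E cat_uniq /= negb_or => /and3P[_ /andP[/negbTE-> _] _].
  by rewrite -i1 -i2 E.
by move/eqP: E; rewrite eqseq_cat // eqseq_cons eqxx /= => /andP[/eqP-> /eqP->].
Qed.

Lemma coded_outer (D : finType) c (n e : {perm D}) r p c' p' :
  valid_code c -> coded c n e r p -> valid_code c' -> coded c' n e r p' -> p = p'.
Proof.
move=> v C v' C'; have [d _ _ _] := coded_sound v C; have [d' _ _ _] := coded_sound v' C'.
exact: disk_outer_eq d d'.
Qed.

Lemma coded_join_apex (D : finType) (n e : {perm D}) r pR g pL :
  let n1 := open_node n e r in let e1 := open_edge e r in
  let a := n r in let b := n (e a) in let n2 := cut_node n1 e1 a b pR in
  root_triangle n e r -> e1 (last b pR) \in porbit n1 (e1 a) ->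
  disk n2 e1 a (g :: pL) -> g \in porbit n1 b.
Proof.
move=> n1 e1 a b n2 RT sv dL.
have nea : n1 (e1 a) = b by rewrite /e1 open_edge_a // /n1 open_node_ea.
have : fcycle (e1 * n2)%g [:: a, g & pL] := pd_cycle dL.1.
rewrite /= => /andP[/eqP]; rewrite permM permM tpermL => <- _.
have -> : porbit n1 b = porbit n1 (e1 a).
  by have := porbit_perm n1 1 (e1 a); rewrite expg1 nea.
by rewrite porbit_closed.
Qed.

(** [Cover] and [Join] exclude each other, as the first makes the apex occur only once on the
    boundary. In a [Join], [g] is the only dart of [p] at the apex, which determines [pR] and
    [pL]. *)
Lemma coded_det (D : finType) c c' (n e : {perm D}) r p :
  valid_code c -> coded c n e r p -> valid_code c' -> coded c' n e r p -> c = c'.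
Proof.
elim: c c' n e r p => [|c1 IH1 c2 IH2|c IH] [|c1' c2'|c'] n e r p //=.
- by move=> _ [nr _ _ _ _] _ [RT]; case/eqP: (rt_a RT).
- by move=> _ [nr _ _ _ _] _ [RT]; case/eqP: (rt_a RT).
- by move=> _ [RT _] _ [nr _ _ _ _]; case/eqP: (rt_a RT).
- move=> V [RT [pR [g [pL [pE sv ncn C1 C2]]]]] V' [_ [pR' [g' [pL' [pE' sv' ncn' C1' C2']]]]].
  case/andP: (V) => v1 v2; case/andP: (V') => v1' v2'.
  have [d _ _ _] := @coded_sound D (Join c1 c2) n e r p V
    (conj RT (ex_intro _ pR (ex_intro _ g (ex_intro _ pL (And5 pE sv ncn C1 C2))))).
  have [d1 _ _ _] := coded_sound v1 C1; have [d1' _ _ _] := coded_sound v1' C1'.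
  have [d2 _ _ _] := coded_sound v2 C2.
  have gb := coded_join_apex RT sv d1; have gb' := coded_join_apex RT sv' d1'.
  have nea : open_node n e r (open_edge e r (n r)) = n (e (n r)).
    by rewrite open_edge_a // open_node_ea.
  have [pd sep] := join_predisk sv ncn nea d1 d2.
  have gp : g \in p by rewrite pE mem_cat mem_head orbT.
  have gp' : g' \in p by rewrite pE' mem_cat mem_head orbT.
  have E : g = g'.
    apply: sep; rewrite ?inE -?pE ?gp ?gp' ?orbT //.
    by apply: porbit_trans gb' _; rewrite porbit_sym.
  rewrite -{}E in gp' gb' pE' C1' d1'.
  have U : uniq (pR ++ g :: pL) by rewrite -pE; case/andP: (pd_uniq d.1).
  have [ER EL] := uniq_split U (etrans (esym pE) pE').
  rewrite -{}ER -{}EL in C1' C2'.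
  by rewrite (IH1 _ _ _ _ _ v1 C1 v1' C1') (IH2 _ _ _ _ _ v2 C2 v2' C2').
- move=> /andP[v1 v2] [RT [pR [g [pL [pE sv ncn C1 C2]]]]] /andP[v' _] [_ C'].
  have [d1 _ _ _] := coded_sound v1 C1; have [d' _ _ _] := coded_sound v' C'.
  have gb := coded_join_apex RT sv d1.
  have gp : g \in p by rewrite pE mem_cat mem_head orbT.
  have E : n (e (n r)) = g by apply: (d'.2) => //; rewrite !inE ?gp ?eqxx ?orbT.
  by have := pd_uniq d'.1; rewrite E /= gp /= andbF.
- by move=> _ [RT _] _ [nr _ _ _ _]; case/eqP: (rt_a RT).
- move=> /andP[v' _] [RT C'] /andP[v1 v2] [_ [pR [g [pL [pE sv ncn C1 C2]]]]].
  have [d1 _ _ _] := coded_sound v1 C1; have [d' _ _ _] := coded_sound v' C'.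
  have gb := coded_join_apex RT sv d1.
  have gp : g \in p by rewrite pE mem_cat mem_head orbT.
  have E : n (e (n r)) = g by apply: (d'.2) => //; rewrite !inE ?gp ?eqxx ?orbT.
  by have := pd_uniq d'.1; rewrite E /= gp /= andbF.
- by move=> /andP[v _] [RT C] /andP[v' _] [_ C']; rewrite (IH _ _ _ _ _ v C v' C').
Qed.

End Uniqueness.

(** * Maps with the same code are isomorphic *)

Section Rigidity.
Variables D D' : finType.
Implicit Types f : D -> D'.

(** The place of the root edge is forced: around their vertices, [r] comes just before [n r] and
    [e r] just before [n (e r)], so the map is recovered from the open one. *)
Lemma li_close (n e : {perm D}) r (n' e' : {perm D'}) r' f :
  root_triangle n e r -> root_triangle n' e' r' ->
  local_iso (open_node n e r) (open_edge e r) (n r)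
            (open_node n' e' r') (open_edge e' r') (n' r') f ->
  exists f', local_iso n e r n' e' r' f'.
Proof.
move=> RT RT' L.
pose f' z := if z == r then r' else if z == e r then e' r' else f z.
exists f'.
have f'r : f' r = r' by rewrite /f' eqxx.
have f'r' : f' (e r) = e' r' by rewrite /f' eqxx (negbTE (rt_e RT)).
set n1 := open_node n e r in L; set e1 := open_edge e r in L; set a := n r in L.
set n1' := open_node n' e' r' in L; set e1' := open_edge e' r' in L; set a' := n' r' in L.
have f'E z : conn n1 e1 a z -> f' z = f z.
  by case/(open_conn RT) => _ zr zr' _; rewrite /f' (negPf zr) (negPf zr').
have f'N z : conn n1 e1 a z -> f z != r' /\ f z != e' r'.
  move=> az; have := li_conn L (conn_refl _ _ _) az.
  by rewrite (li_root L) => /(open_conn RT')[_ -> ->].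
have aE : f a = a' := li_root L.
have cea : conn n1 e1 a (e1 a) := conn1r _ _ _.
have bE : f (n (e a)) = n' (e' a').
  rewrite -(open_node_ea RT) -(open_edge_a RT) -/n1 -/e1 -/a (li_n L) // (li_e L) ?conn_refl // aE.
  by rewrite /n1' /e1' open_edge_a // open_node_ea.
have ceb : conn n1 e1 a (e1 (n (e a))).
  exact: conn_trans (open_b RT) (conn1r _ _ _).
have cE : f (n (e r)) = n' (e' r').
  rewrite -(open_node_eb RT) -(open_edge_b RT) -/n1 -/e1 -/a (li_n L) // (li_e L) ?open_b // bE.
  by rewrite /n1' /e1' open_edge_b // open_node_eb.
have close_nodeE (T : finType) (m d : {perm T}) s z : root_triangle m d s ->
    conn (open_node m d s) (open_edge d s) (m s) z ->
    m z = if open_node m d s z == m s then s else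
          if open_node m d s z == m (d s) then d s else open_node m d s z.
  move=> RS /(open_conn RS)[_ zs zs' _].
  rewrite (open_nodeE RS) (negPf zs) (negPf zs').
  have [->|mz] := eqVneq (m z) s; first by rewrite eqxx.
  have [->|mz'] := eqVneq (m z) (d s).
    by rewrite (inj_eq perm_inj) (negbTE (rt_e RS)) eqxx.
  by rewrite !(inj_eq perm_inj) (negPf zs) (negPf zs').
have f'n z : conn n e r z -> f' (n z) = n' (f' z).
  case/(conn_cases RT) => [->|->|az].
  - by rewrite f'r f'E ?aE // conn_refl.
  - by rewrite f'r' f'E ?cE // open_c.
  have az' := li_conn L (conn_refl _ _ _) az; rewrite aE in az'.
  have anz : conn n1 e1 a (n1 z) by apply: conn_trans az (conn1l _ _ _).
  rewrite (close_nodeE _ _ _ _ _ RT az) (f'E z az) (close_nodeE _ _ _ _ _ RT' az') -/n1 -/a -/n1' -/a'.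
  rewrite -(li_n L az) -aE -cE !(li_eq L) ?conn_refl ?open_c //.
  by case: ifP => _; rewrite ?f'r //; case: ifP => _; rewrite ?f'r' // f'E.
have f'e z : conn n e r z -> f' (e z) = e' (f' z).
  case/(conn_cases RT) => [->|->|az].
  - by rewrite f'r f'r'.
  - by rewrite f'r' (rt_ee RT) (rt_ee RT').
  have az' := li_conn L (conn_refl _ _ _) az; rewrite aE in az'.
  have [_ _ aez] := open_conn' RT az.
  have [_ _ _ ez] := open_conn RT az; have [_ _ _ ez'] := open_conn RT' az'.
  by rewrite (f'E _ aez) (f'E z az) -ez' -ez (li_e L).
split=> // x y rx ry.
have e'r' : (r' == e' r') = false by rewrite eq_sym; apply: negbTE (rt_e RT').
case/(conn_cases RT): rx => [->|->|ax]; case/(conn_cases RT): ry => [->|->|ay] //;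
  rewrite ?f'r ?f'r' => /eqP; rewrite ?e'r' ?[e' r' == r']eq_sym ?e'r' //.
- by rewrite f'E // eq_sym; have [/negbTE-> _] := f'N _ ay.
- by rewrite f'E // eq_sym; have [_ /negbTE->] := f'N _ ay.
- by rewrite f'E //; have [/negbTE-> _] := f'N _ ax.
- by rewrite f'E //; have [_ /negbTE->] := f'N _ ax.
- by rewrite !f'E // => /eqP; apply: (li_inj L).
Qed.

Lemma li_join (n e : {perm D}) a b pR (n' e' : {perm D'}) a' b' pR' f1 f2 :
  e (last b pR) \in porbit n (e a) -> e' (last b' pR') \in porbit n' (e' a') ->
  ~~ conn (cut_node n e a b pR) e a b -> ~~ conn (cut_node n' e' a' b' pR') e' a' b' ->
  n (e a) = b -> n' (e' a') = b' ->
  local_iso (cut_node n e a b pR) e a (cut_node n' e' a' b' pR') e' a' f1 ->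
  local_iso (cut_node n e a b pR) e b (cut_node n' e' a' b' pR') e' b' f2 ->
  exists f, local_iso n e a n' e' a' f.
Proof.
move=> sv sv' ap ap' nea nea'.
set n2 := cut_node n e a b pR in ap *; set n2' := cut_node n' e' a' b' pR' in ap' *.
move=> L1 L2; pose f z := if conn n2 e a z then f1 z else f2 z; exists f.
have fL z : conn n2 e a z -> f z = f1 z by rewrite /f => ->.
have fR z : conn n2 e b z -> f z = f2 z.
  by move=> bz; rewrite /f; case: ifP => // az; case: (sides ap az bz).
have cN z : conn n e a z -> conn n2 e a z \/ conn n2 e b z.
  by rewrite (conn_join sv ap nea) => /orP.
have fn2 z : conn n e a z -> f (n2 z) = n2' (f z).
  case/cN => cz; [rewrite (fL z) ?fL|rewrite (fR z) ?fR] => //.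
  - exact: (li_n L1 cz).
  - exact: conn_trans cz (conn1l _ _ _).
  - exact: (li_n L2 cz).
  - exact: conn_trans cz (conn1l _ _ _).
have fe z : conn n e a z -> f (e z) = e' (f z).
  case/cN => cz; [rewrite (fL z) ?fL|rewrite (fR z) ?fR] => //.
  - exact: (li_e L1 cz).
  - exact: conn_trans cz (conn1r _ _ _).
  - exact: (li_e L2 cz).
  - exact: conn_trans cz (conn1r _ _ _).
have f_inj x y : conn n e a x -> conn n e a y -> f x = f y -> x = y.
  have mix u v : conn n2 e a u -> conn n2 e b v -> f u = f v -> u = v.
    move=> au bv; rewrite fL // fR // => E.
    have h1 := li_conn L1 (conn_refl _ _ _) au; rewrite (li_root L1) E in h1.
    have h2 := li_conn L2 (conn_refl _ _ _) bv; rewrite (li_root L2) in h2.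
    by case: (sides ap' h1 h2).
  case/cN => cx /cN[] cy.
  - by rewrite !fL //; apply: (li_inj L1).
  - exact: mix.
  - by move/esym/(mix _ _ cy cx).
  - by rewrite !fR //; apply: (li_inj L2).
have fa : f a = a' by rewrite fL ?conn_refl // (li_root L1).
have ca := conn_refl n e a.
have cea : conn n e a (e a) := conn1r _ _ _.
have ch : conn n e a (e (last b pR)).
  rewrite (conn_join sv ap nea); apply/orP; right.
  by rewrite conn_sym (@conn_hb _ n e a b pR nea) conn_refl.
(* In both maps the second glued dart is the one that the cut permutation sends to the root of the
   right half. *)
have fh : f (e (last b pR)) = e' (last b' pR').
  apply: (@perm_inj _ n2'); rewrite (@cut_h _ n' e' a' b' pR') //.
  rewrite -fn2 // (@cut_h _ n e a b pR) // fR ?conn_refl // (li_root L2) //.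
have nE (T : finType) (m d : {perm T}) s t q z :
    m z = cut_node m d s t q (tperm (d s) (d (last t q)) z).
  by rewrite permM tpermK.
split=> // z az.
rewrite (nE D n e a b pR) (nE D' n' e' a' b' pR') -/n2 -/n2'.
have ct : conn n e a (tperm (e a) (e (last b pR)) z) by case: tpermP.
rewrite fn2 //; congr (n2' _); rewrite -fa -(fe a) // -fh.
case: (tpermP (e a) _ z) => [->|->|/eqP z1 /eqP z2]; rewrite ?tpermL ?tpermR //.
by rewrite tpermD //; apply/eqP => /f_inj E; [case/eqP: z1|case/eqP: z2]; rewrite -E.
Qed.

Lemma coded_rigid c (n e : {perm D}) r p (n' e' : {perm D'}) r' p' :
  coded c n e r p -> coded c n' e' r' p' -> exists f, local_iso n e r n' e' r' f.
Proof.
elim: c n e r p n' e' r' p' => [|c1 IH1 c2 IH2|c IH] n e r p n' e' r' p' /=.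
- move=> [nr ner er eer _] [nr' ner' er' eer' _].
  exists (fun z => if z == r then r' else e' r').
  have cE z : conn n e r z -> z = r \/ z = e r.
    apply: (conn_ind (P := fun z => z = r \/ z = e r)) => [w|w|]; last by left.
      by case=> ->; rewrite ?nr ?ner; [left|right].
    by case=> ->; rewrite ?eer; [right|left].
  have er1 := negbTE er.
  split=> [|x|x|x y]; first by rewrite eqxx.
  + by case/cE => ->; rewrite ?nr ?ner ?eqxx ?er1 ?nr' ?ner'.
  + by case/cE => ->; rewrite ?eer ?eqxx ?er1 ?eer'.
  + case/cE => -> /cE[] ->; rewrite ?eqxx ?er1 //; move/eqP.
      by rewrite eq_sym (negPf er').
    by rewrite (negPf er').
- move=> [RT [pR [g [pL [_ sv ncn C1 C2]]]]] [RT' [pR' [g' [pL' [_ sv' ncn' C1' C2']]]]].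
  have [f1 L1] := IH1 _ _ _ _ _ _ _ _ C1 C1'.
  have [f2 L2] := IH2 _ _ _ _ _ _ _ _ C2 C2'.
  have [||f L] := li_join sv sv' ncn ncn' _ _ L1 L2; try by rewrite open_edge_a // open_node_ea.
  exact: li_close RT RT' L.
- move=> [RT C] [RT' C']; have [f L] := IH _ _ _ _ _ _ _ _ C C'.
  exact: li_close RT RT' L.
Qed.
End Rigidity.

Lemma sub_card (T : finType) (A : {set T}) k : k <= #|A| ->
  exists2 B : {set T}, B \subset A & #|B| = k.
Proof.
elim: k => [|k IH] kA; first by exists set0; rewrite ?sub0set ?cards0.
have [B BA Bk] := IH (ltnW kA).
have : 0 < #|A :\: B| by rewrite cardsD (setIidPr BA) Bk subn_gt0.
case/card_gt0P=> x; rewrite inE => /andP[xB xA].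
exists (x |: B); first by rewrite subUset sub1set xA.
by rewrite cardsU1 xB Bk.
Qed.

Lemma disk_nonempty (D : finType) (n e : {perm D}) r p : disk n e r p -> exists x q, p = x :: q.
Proof.
case: p => [|x q] d; last by exists x, q.
have := pd_cycle d.1; rewrite /= andbT permM => /eqP E.
case/negP: (pd_loop d.1 (conn_refl n e r)).
by rewrite porbit_sym -{1}E porbit_closed porbit_id.
Qed.

(** * Construction of a map with a given code *)

Section Build.
Variable D : finType.
Implicit Types (n e : {perm D}).

Section Insert.
Variables (n1 e1 : {perm D}) (r r' a : D).
Let b := n1 (e1 a).
Let c := n1 (e1 b).
Hypotheses (nr : n1 r = r) (er : e1 r = r) (nr' : n1 r' = r') (er' : e1 r' = r').
Hypotheses (rr' : r != r') (ar : a != r) (ar' : a != r') (ba : b != a) (ca : c != a).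

Definition insert_edge : {perm D} := (tperm r r' * e1)%g.
(** The inverse of [open_node]: [r'] goes between [e1 b] and its image, then [r] between the
    predecessor of [a] and [a]. *)
Definition insert_node : {perm D} :=
  (tperm r ((n1^-1)%g a) * (tperm r' (e1 b) * n1))%g.

Let neq_fix (s : {perm D}) u w : s u = u -> w != u -> s w != u.
Proof. by move=> su; apply: contra_neq => E; apply: (@perm_inj _ s); rewrite su. Qed.

Let br : b != r. Proof. exact: (neq_fix nr (neq_fix er ar)). Qed.
Let br' : b != r'. Proof. exact: (neq_fix nr' (neq_fix er' ar')). Qed.

Lemma insert_edgeE z : insert_edge z = if z == r then r' else if z == r' then r else e1 z.
Proof.
rewrite permM; case: tpermP => [->|->|/eqP/negbTE-> /eqP/negbTE->] //.
  by rewrite eqxx er'.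
by rewrite eqxx er eq_sym (negPf rr').
Qed.

Let m : {perm D} := (tperm r' (e1 b) * n1)%g.
Let q := (n1^-1)%g a.

Let nq : n1 q = a. Proof. exact: permKV. Qed.
Let qeb : q != e1 b. Proof. by apply: contraNneq ca => E; rewrite /c -E nq. Qed.
Let qr : q != r. Proof. by apply: contraNneq ar => E; rewrite -nq E nr. Qed.
Let qr' : q != r'. Proof. by apply: contraNneq ar' => E; rewrite -nq E nr'. Qed.

Lemma insert_nodeE z : insert_node z =
  if z == r then a else if z == q then r else
  if z == r' then c else if z == e1 b then r' else n1 z.
Proof.
have ebr : e1 b != r by apply: neq_fix.
have ebr' : e1 b != r' by apply: neq_fix.
have mr : m r = r by rewrite permM tpermD // eq_sym.
have mq : m q = a by rewrite permM tpermD // eq_sym.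
rewrite permM -/q; case: tpermP => [->|->|/eqP zr /eqP zq].
- by rewrite eqxx mq.
- by rewrite (negPf qr) eqxx mr.
rewrite (negPf zr) (negPf zq) permM; case: tpermP => [->|->|/eqP/negbTE-> /eqP/negbTE->] //.
  by rewrite eqxx.
by rewrite (negPf ebr') eqxx.
Qed.

Lemma insert_triangle : root_triangle insert_node insert_edge r.
Proof.
have Er : insert_edge r = r' by rewrite insert_edgeE eqxx.
have Er' : insert_edge r' = r by rewrite insert_edgeE eqxx eq_sym (negPf rr').
have Nr : insert_node r = a by rewrite insert_nodeE eqxx.
have Ea : insert_edge a = e1 a by rewrite insert_edgeE (negPf ar) (negPf ar').
have Na : insert_node (e1 a) = b.
  have ear : e1 a != r by apply: neq_fix.
  have ear' : e1 a != r' by apply: neq_fix.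
  have eaq : e1 a != q by apply: contraNneq ba => E; rewrite /b E nq.
  have eab : e1 a != e1 b by rewrite (inj_eq perm_inj) eq_sym.
  by rewrite insert_nodeE (negPf ear) (negPf ear') (negPf eaq) (negPf eab).
have Eb : insert_edge b = e1 b by rewrite insert_edgeE (negPf br) (negPf br').
have ebr : e1 b != r by apply: neq_fix.
have ebr' : e1 b != r' by apply: neq_fix.
have Nb : insert_node (e1 b) = r'.
  by rewrite insert_nodeE (negPf ebr) eq_sym (negPf qeb) (negPf ebr') eqxx.
have Nr' : insert_node r' = c.
  by rewrite insert_nodeE eq_sym (negPf rr') eq_sym (negPf qr') eqxx.
split; rewrite ?Er ?Er' ?Nr ?Ea ?Na ?Eb ?Nb ?Nr' //; first by rewrite eq_sym.
  exact: (neq_fix nr (neq_fix er br)).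
exact: (neq_fix nr' (neq_fix er' br')).
Qed.

Lemma open_insert_edge : open_edge insert_edge r = e1.
Proof.
have E : (insert_edge^-1)%g r = r'.
  have -> : r = insert_edge r' by rewrite insert_edgeE eqxx eq_sym (negPf rr').
  by rewrite permK.
by rewrite /open_edge /bypass E /insert_edge mulgA tperm2 mul1g.
Qed.

Lemma open_insert_node : open_node insert_node insert_edge r = n1.
Proof.
have Nq : insert_node q = r by rewrite insert_nodeE (negPf qr) eqxx.
have Er : insert_edge r = r' by rewrite insert_edgeE eqxx.
rewrite /open_node Er.
have -> : bypass insert_node r = m.
  by rewrite /bypass -{2}Nq permK /insert_node mulgA tperm2 mul1g.
have mb : m (e1 b) = r' by rewrite permM tpermR nr'.
by rewrite /bypass -{2}mb permK /m mulgA tperm2 mul1g.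
Qed.
End Insert.

Lemma porbit_tperm_join (s : {perm D}) x y : x \notin porbit s y ->
  x \in porbit (tperm x y * s) y.
Proof.
move=> xy; have := ncyc_mul_tperm s x y; have := ncyc_mul_tperm (tperm x y * s) x y.
have -> : x != y by apply: contraNneq xy => ->; apply: porbit_id.
rewrite mulgA tperm2 mul1g xy; case: (x \in _) => //=; lia.
Qed.

(* Adds a root edge to the disk [n1, e1, a], on the two fixed darts r and r'. *)
Lemma build_root (n1 e1 : {perm D}) (A : {set D}) r r' a q :
  let b := n1 (e1 a) in
  planar n1 e1 -> predisk n1 e1 a (b :: q) -> q != [::] -> darts n1 e1 a = A ->
  r != r' -> r \notin A -> r' \notin A ->
  n1 r = r -> e1 r = r -> n1 r' = r' -> e1 r' = r' ->
  exists n e, [/\ planar n e, root_triangle n e r,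
    open_node n e r = n1, open_edge e r = e1 & n r = a]
    /\ [/\ n (e a) = b, n (e r) = n1 (e1 b), darts n e r = [set r; r'] :|: A &
        forall x, x \notin [set r; r'] :|: A -> n x = n1 x /\ e x = e1 x].
Proof.
move=> b pl pd q0 dA rr' rA r'A nr er nr' er'.
have inA z : conn n1 e1 a z -> z \in A by rewrite -dA inE.
have aA : a \in A by apply: inA; apply: conn_refl.
have ar : a != r by apply: contraNneq rA => <-.
have ar' : a != r' by apply: contraNneq r'A => <-.
case: q q0 pd => // c0 q _ pd.
have := pd_cycle pd; rewrite /= => /and3P[_ /eqP]; rewrite permM => cE _.
have U := pd_uniq pd.
have ba : b != a by move: U; rewrite /= inE negb_or eq_sym => /andP[/andP[]].
have ca : n1 (e1 b) != a.
  by rewrite cE; move: U; rewrite /= !inE !negb_or [a == c0]eq_sym => /andP[/and3P[]].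
pose n := insert_node n1 e1 r r' a; pose e := insert_edge e1 r r'.
have RT : root_triangle n e r by apply: insert_triangle.
have on : open_node n e r = n1 by apply: open_insert_node.
have oe : open_edge e r = e1 by apply: open_insert_edge.
have Nr : n r = a by rewrite /n insert_nodeE // eqxx.
have Er : e r = r' by rewrite /e insert_edgeE // eqxx.
have nea : n (e a) = b.
  by have := open_node_ea RT; have := open_edge_a RT; rewrite on oe Nr /b => -> ->.
have ner : n (e r) = n1 (e1 b).
  by have := open_node_eb RT; have := open_edge_b RT; rewrite on oe Nr nea => -> ->.
exists n, e; split; split=> //.
- by apply: planar_close RT _; rewrite on oe.
- apply/setP=> z; rewrite !inE -dA inE.
  apply/idP/idP => [/(conn_cases RT)[->|->|]|/orP[/orP[]/eqP->|H]].
  + by rewrite eqxx.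
  + by rewrite Er eqxx orbT.
  + by rewrite on oe Nr => ->; rewrite orbT.
  + exact: conn_refl.
  + by rewrite -Er conn1r.
  + have /open_conn[] // : conn (open_node n e r) (open_edge e r) (n r) z.
    by rewrite on oe Nr.
- move=> x; rewrite !inE !negb_or => /andP[/andP[xr xr'] xA].
  have inv (s : {perm D}) : n1 = s \/ e1 = s -> forall z, s z \in A -> z \in A.
    move=> H z; rewrite -dA !inE => az; apply: conn_trans az _; rewrite conn_sym.
    by case: H => <-; [apply: conn1l|apply: conn1r].
  rewrite /n /e insert_nodeE // insert_edgeE // (negPf xr) (negPf xr'); split=> //.
  have -> : (x == (n1^-1)%g a) = false.
    apply/negbTE; apply: contraNneq xA => ->; apply: (inv n1); first by left.
    by rewrite permKV.
  have -> : (x == e1 (n1 (e1 a))) = false; last by [].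
  apply/negbTE; apply: contraNneq xA => ->; apply: inA.
  apply: conn_trans (conn1r _ _ a) _; apply: conn_trans (conn1l _ _ _) (conn1r _ _ _).
Qed.

(** The statement is relative to a planar pair that fixes the free darts [A], so that the two halves
    of a [Join] can be built in turn on disjoint parts of [A], the second without disturbing the
    first. *)
Lemma coded_build c n0 e0 (A : {set D}) : valid_code c -> #|A| = (nedges c).*2 ->
  planar n0 e0 -> (forall x, x \in A -> n0 x = x /\ e0 x = x) ->
  exists n e r p, [/\ planar n e, coded c n e r p, darts n e r = A
    & forall x, x \notin A -> n x = n0 x /\ e x = e0 x].
Proof.
elim: c n0 e0 A => [|c1 IH1 c2 IH2|c IH] n0 e0 A /=.
- move=> _ /eqP/cards2P[r [r' [rr' AE]]] pl fix0.
  have [nr er] : n0 r = r /\ e0 r = r by apply: fix0; rewrite AE !inE eqxx.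
  have [nr' er'] : n0 r' = r' /\ e0 r' = r' by apply: fix0; rewrite AE !inE eqxx orbT.
  pose e := insert_edge e0 r r'.
  have Er : e r = r' by rewrite /e insert_edgeE // eqxx.
  have Er' : e r' = r by rewrite /e insert_edgeE // eqxx eq_sym (negPf rr').
  exists n0, e, r, [:: r']; split.
  + rewrite planarC; apply: planar_join => //; last by rewrite planarC.
      by apply/negP => /(porbit_fix er) E; rewrite E eqxx in rr'.
    by apply/orP; left; apply/negP => /(conn_fix er nr) E; rewrite E eqxx in rr'.
  + by rewrite Er Er' nr nr' eq_sym.
  + apply/setP=> z; rewrite AE !inE; apply/idP/orP => [|[/eqP->|/eqP->]].
    * apply: (conn_ind (P := fun w => w == r \/ w == r')) => [w|w|]; last by left.
        by case=> /eqP->; rewrite ?nr ?nr'; [left|right].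
      by case=> /eqP->; rewrite ?Er ?Er'; [right|left].
    * exact: conn_refl.
    * by rewrite -Er conn1r.
  + move=> x; rewrite AE !inE negb_or => /andP[xr xr']; split=> //.
    by rewrite /e insert_edgeE // (negPf xr) (negPf xr').
- case/andP=> v1 v2 cA pl fix0.
  (* [B] will carry the root edge, [A1] and [A2] the two halves. *)
  have [B BA B2] : exists2 B : {set D}, B \subset A & #|B| = 2.
    by apply: sub_card; rewrite cA doubleS.
  have cAB : #|A :\: B| = (nedges c1).*2 + (nedges c2).*2.
    by rewrite cardsD (setIidPr BA) B2 cA doubleS -doubleD !subSS subn0.
  have [A1 A1A A1c] : exists2 A1 : {set D}, A1 \subset A :\: B & #|A1| = (nedges c1).*2.
    by apply: sub_card; rewrite cAB leq_addr.
  pose A2 := (A :\: B) :\: A1.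
  have A2c : #|A2| = (nedges c2).*2.
    by rewrite cardsD (setIidPr A1A) cAB A1c addKn.
  have subA1 x : x \in A1 -> x \in A /\ x \notin B.
    by move/(subsetP A1A); rewrite inE => /andP[].
  have subA2 x : x \in A2 -> [/\ x \in A, x \notin B & x \notin A1].
    by rewrite !inE => /and3P[].
  have [nL [eL [a [pL [plL C1 dL offL]]]]] :
      exists n e r p, [/\ planar n e, coded c1 n e r p, darts n e r = A1
        & forall x, x \notin A1 -> n x = n0 x /\ e x = e0 x].
    by apply: IH1 => // x /subA1[xA _]; apply: fix0.
  have [n2 [e1 [b [pR [pl2 C2 dR offR]]]]] :
      exists n e r p, [/\ planar n e, coded c2 n e r p, darts n e r = A2
        & forall x, x \notin A2 -> n x = nL x /\ e x = eL x].
    apply: IH2 => // x /subA2[xA _ xA1]; have [-> ->] := offL _ xA1; exact: fix0.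
  (* The second construction left [A1] alone, so the first half persists. *)
  have LI : local_iso nL eL a n2 e1 a id.
    have xA2 x : conn nL eL a x -> x \notin A2 by move=> ax; rewrite inE -dL inE ax.
    by split=> // x /xA2 /offR[h1 h2]; rewrite ?h1 ?h2.
  have C1' := coded_iso v1 C1 LI; rewrite map_id in C1'.
  have [d1 s1 _ _] := coded_sound v1 C1'; have [d2 s2 _ _] := coded_sound v2 C2.
  have dL2 z : conn n2 e1 a z = (z \in A1).
    rewrite -dL inE; apply/idP/idP => [|az].
      by case/(li_conn_inv LI (conn_refl _ _ _)) => y ay ->.
    by have := li_conn LI (conn_refl nL eL a) az.
  have dR2 z : conn n2 e1 b z = (z \in A2) by rewrite -dR inE.
  have ap : ~~ conn n2 e1 a b.
    rewrite dL2; have : b \in A2 by rewrite -dR2 conn_refl.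
    by case/subA2.
  have [g [pL' pLE]] := disk_nonempty d1; subst pL.
  have [c0 [pR' pRE]] := disk_nonempty d2.
  pose h := e1 (last b pR).
  have lR : last b pR \in b :: pR by apply: mem_last.
  have bl : conn n2 e1 b (last b pR) by apply: face_conn (pd_cycle d2.1) _.
  have bh : conn n2 e1 b h by apply: conn_trans bl (conn1r _ _ _).
  have aea : conn n2 e1 a (e1 a) := conn1r _ _ _.
  have n2h : n2 h = b.
    have := pd_cycle d2.1; rewrite /= rcons_path => /andP[_ /eqP].
    by rewrite permM.
  (* The transposition that undoes a cut: it merges the vertices of [e1 a] and [h]. *)
  pose n1 : {perm D} := (tperm (e1 a) h * n2)%g.
  have nea : n1 (e1 a) = b by rewrite permM tpermL.
  have n2E : cut_node n1 e1 a b pR = n2.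
    by rewrite /cut_node -/h /n1 mulgA tperm2 mul1g.
  have eah : e1 a \notin porbit n2 h.
    apply/negP => H; case/negP: ap; rewrite conn_sym.
    apply: conn_trans (conn_trans bh (conn_porbitl _ H)) _; by rewrite conn_sym.
  have eah1 : e1 a != h by apply: contraNneq eah => ->; apply: porbit_id.
  have sv : h \in porbit n1 (e1 a) by rewrite porbit_sym; apply: porbit_tperm_join.
  have pl1 : planar n1 e1.
    apply: planar_join => //; apply/orP; left; apply/negP => H.
    case/negP: ap; apply: conn_trans (conn_trans aea H) _; by rewrite conn_sym.
  have ap1 : ~~ conn (cut_node n1 e1 a b pR) e1 a b by rewrite n2E.
  have d1' : disk (cut_node n1 e1 a b pR) e1 a (g :: pL') by rewrite n2E.
  have d2' : disk (cut_node n1 e1 a b pR) e1 b pR by rewrite n2E.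
  have [pd _] := join_predisk sv ap1 nea d1' d2'.
  have dn1 : darts n1 e1 a = A1 :|: A2.
    by apply/setP=> z; rewrite [LHS]inE (conn_join sv ap1 nea) n2E dL2 dR2 [RHS]inE.
  have [r [r' [rr' BE]]] : exists r r', r != r' /\ B = [set r; r'] by apply/cards2P/eqP.
  have offB x : x \in B -> [/\ n1 x = x, e1 x = x & x \notin A1 :|: A2].
    move=> xB; have xA := subsetP BA _ xB.
    have xA1 : x \notin A1 by apply/negP => /subA1[_]; rewrite xB.
    have xA2 : x \notin A2 by apply/negP => /subA2[_]; rewrite xB.
    have [nx ex] := offR _ xA2; have [nx' ex'] := offL _ xA1; have [nx0 ex0] := fix0 _ xA.
    rewrite inE (negPf xA1) (negPf xA2) ex ex' ex0; split=> //.
    rewrite permM tpermD ?nx ?nx' //.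
      by apply: contraNneq xA1 => <-; rewrite -dL2.
    by apply: contraNneq xA2 => <-; rewrite -dR2.
  have [nr er rN] := offB r ltac:(by rewrite BE !inE eqxx).
  have [nr' er' r'N] := offB r' ltac:(by rewrite BE !inE eqxx orbT).
  rewrite -nea in pd.
  have [|n [e [[pln RT on oe Nr] [neb nec dn off]]]] :=
    build_root pl1 pd _ dn1 rr' rN r'N nr er nr' er'; first by rewrite pRE.
  have AE : [set r; r'] :|: (A1 :|: A2) = A.
    have -> : A1 :|: A2 = A :\: B by rewrite -{1}(setIidPr A1A) setID.
    by rewrite -BE -{1}(setIidPr BA) setID.
  exists n, e, r, (pR ++ g :: pL'); split=> //.
  + split=> //; exists pR, g, pL'; rewrite on oe Nr neb nea.
    by rewrite n2E.
  + by rewrite dn.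
  + move=> x xA; have [|-> ->] := off x; first by rewrite AE.
    have xA1 : x \notin A1 by apply/negP => /subA1[h1]; rewrite h1 in xA.
    have xA2 : x \notin A2 by apply/negP => /subA2[h1]; rewrite h1 in xA.
    have [nx ex] := offR _ xA2; have [nx' ex'] := offL _ xA1.
    rewrite ex ex'; split=> //; rewrite permM tpermD ?nx ?nx' //.
      by apply: contraNneq xA1 => <-; rewrite -dL2.
    by apply: contraNneq xA2 => <-; rewrite -dR2.
- case/andP=> v sl cA pl fix0.
  have [B BA B2] : exists2 B : {set D}, B \subset A & #|B| = 2.
    by apply: sub_card; rewrite cA doubleS.
  have [r [r' [rr' BE]]] : exists r r', r != r' /\ B = [set r; r'] by apply/cards2P/eqP.
  have [n1 [e1 [a [p [pl1 C d1 off1]]]]] :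
      exists n e r p, [/\ planar n e, coded c n e r p, darts n e r = A :\: B
        & forall x, x \notin A :\: B -> n x = n0 x /\ e x = e0 x].
    apply: IH => //; first by rewrite cardsD (setIidPr BA) B2 cA doubleS !subSS subn0.
    by move=> x; rewrite inE => /andP[_ /fix0].
  have [d s f _] := coded_sound v C.
  have [b [q pE]] := disk_nonempty d; subst p.
  have q0 : q != [::] by apply: contraTneq sl => q0; rewrite -f q0.
  have bE : n1 (e1 a) = b.
    by have := pd_cycle d.1; rewrite /= => /andP[/eqP]; rewrite permM.
  have offB x : x \in B -> [/\ n1 x = x, e1 x = x & x \notin A :\: B].
    move=> xB; have xA := subsetP BA _ xB.
    have xAB : x \notin A :\: B by rewrite inE xB.
    have [-> ->] := off1 _ xAB; have [-> ->] := fix0 _ xA; by [].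
  have [nr er rN] := offB r ltac:(by rewrite BE !inE eqxx).
  have [nr' er' r'N] := offB r' ltac:(by rewrite BE !inE eqxx orbT).
  rewrite -bE in d C.
  have [n [e [[pln RT on oe Nr] [neb nec dn off]]]] :=
    build_root pl1 d.1 q0 d1 rr' rN r'N nr er nr' er'.
  have BAB : [set r; r'] :|: (A :\: B) = A.
    by rewrite -BE -{1}(setIidPr BA) setID.
  exists n, e, r, q; split=> //.
  + by split=> //; rewrite on oe Nr neb.
  + by rewrite dn.
  + move=> x xA; have [|-> ->] := off x; first by rewrite BAB.
    by apply: off1; rewrite inE (negPf xA) andbF.
Qed.
End Build.

(* The number of vertices minus 1. *)
Fixpoint weight c := match c with
  | Edge => 1
  | Join c d => weight c + weight d
  | Cover c => weight c
  end.

(** Keeps the truncated predecessor in [border] from acting on 0. *)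
Lemma slack_border c : valid_code c -> slack c < border c.
Proof.
elim: c => //= [c IHc d IHd /andP[vc vd]|c IH /andP[vc sl]].
  by have := IHd vd; have := IHc vc; lia.
by have := IH vc; lia.
Qed.

(** Euler's formula for a triangulated disk, with the number of faces eliminated. *)
Lemma weight_nedges c : valid_code c -> 3 * weight c = nedges c + border c + 1.
Proof.
elim: c => //= [c IHc d IHd /andP[vc vd]|c IH /andP[vc sl]].
  by have := IHd vd; have := IHc vc; lia.
by have := IH vc; have := slack_border vc; lia.
Qed.

(** * Counting vertices, edges and faces *)

Section Counting.
Variable D : finType.
Implicit Types (s n e : {perm D}).

Lemma sum_porbits s : \sum_(X in porbits s) #|X| = #|D|.
Proof.
have P : partition (porbits s) [set: D].
  apply/and3P; split.
  - rewrite eqEsubset subsetT; apply/subsetP=> x _.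
    apply/bigcupP; exists (porbit s x); first exact: imset_f.
    exact: porbit_id.
  - apply/trivIsetP=> _ _ /imsetP[x _ ->] /imsetP[y _ ->].
    move=> xy; rewrite -setI_eq0; apply: contraR xy => /set0Pn[z].
    rewrite inE => /andP[zx zy]; by rewrite eq_porbit_mem; apply: porbit_trans zy; rewrite porbit_sym.
  - by apply/imsetP => -[x _ E]; have := porbit_id s x; rewrite -E inE.
by rewrite -(card_partition P) cardsT.
Qed.

Lemma ncyc_uniform s k : (forall x, #|porbit s x| = k) -> ncyc s * k = #|D|.
Proof.
move=> H; rewrite -(sum_porbits s) /ncyc -sum_nat_const.
by apply: eq_bigr => _ /imsetP[x _ ->]; rewrite H.
Qed.

Lemma comps1 n e r : (forall x, conn n e r x) -> comps n e = 1.
Proof.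
move=> H; rewrite /comps /nclass.
suff -> : [set [set y | conn n e x y] | x : D] = [set [set: D]] by rewrite cards1.
apply/setP=> X; rewrite inE; apply/imsetP/eqP => [[x _ ->]|->].
  apply/setP=> y; rewrite !inE; apply: conn_trans (H y); by rewrite conn_sym.
by exists r => //; apply/setP=> y; rewrite !inE H.
Qed.

(** The starting point for [coded_build], with every dart still free. *)
Lemma planar_id : planar (1%g : {perm D}) 1%g.
Proof.
have z1 : ncyc (1%g : {perm D}) = #|D|.
  by rewrite -[LHS]muln1; apply: ncyc_uniform => x;
     rewrite (_ : porbit 1 x = [set x]) ?cards1 //; apply/setP=> y; rewrite inE;
     apply/idP/eqP => [|->]; rewrite ?porbit_id // => /porbit_fix -> //; rewrite perm1.
have c1 : comps (1%g : {perm D}) 1%g = #|D|.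
  have fixed x y : conn (1%g : {perm D}) 1%g x y = (x == y).
    apply/idP/eqP => [|->]; last exact: conn_refl.
    by move=> xy; apply/esym/(conn_fix _ _ xy); rewrite perm1.
  rewrite /comps /nclass card_imset ?cardsT // => x y /setP/(_ y).
  by rewrite !inE !fixed eqxx => /eqP.
by rewrite /planar /euler_sum mulg1 z1 c1 -addnn addnA.
Qed.

Lemma edge_card e x : e x != x -> e (e x) = x -> #|porbit e x| = 2.
Proof.
move=> ex eex.
have -> : porbit e x = [set x; e x]; last by rewrite cards2 eq_sym ex.
apply/setP=> y; rewrite !inE (@cycle_porbit _ e [:: x; e x]) ?inE ?eqxx //=.
by rewrite eex !eqxx.
Qed.

Lemma face_card (f : {perm D}) x : f x != x -> (#|porbit f x| == 3) = (f (f (f x)) == x).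
Proof.
move=> fx; apply/eqP/eqP => [E|E].
  by have := iter_porbit f x; rewrite E.
have ffx : f (f x) != x.
  by apply: contra_neq fx => H; rewrite -{2}E H.
have c3 : fcycle f [:: x; f x; f (f x)] by rewrite /= E !eqxx.
have U : uniq [:: x; f x; f (f x)].
  by rewrite /= !inE !negb_or ![x == _]eq_sym fx ffx (inj_eq perm_inj) eq_sym fx.
by rewrite (eq_card (fun y => cycle_porbit y c3 (mem_head _ _))) (card_uniqP U).
Qed.

(** One face has [size p + 1] darts and the others have 3, whence the second formula; with a single
    component, [planar] is Euler's formula. *)
Lemma disk_counts n e r p : (forall x, conn n e r x) -> disk n e r p ->
  [/\ (ncyc e).*2 = #|D|, size p + 3 * ncyc (e * n) = #|D| + 2
    & planar n e = (ncyc n + ncyc (e * n) == ncyc e + 2)].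
Proof.
move=> cT dM; case: (dM) => -[cp up ee lo si inn] sep.
have E2 : (ncyc e).*2 = #|D|.
  rewrite -muln2; apply: ncyc_uniform => x; apply: edge_card; last exact: ee.
  by apply: contraNneq (lo x (cT x)) => ->; apply: porbit_id.
have ffix x : (e * n)%g x != x.
  rewrite permM; apply: contraNneq (lo x (cT x)) => E.
  by rewrite porbit_sym -{1}E porbit_step.
split=> //.
  set f := (e * n)%g in cp inn ffix *.
  have rf : porbit f r \in porbits f by apply: imset_f.
  have := sum_porbits f; rewrite (bigD1 _ rf) /=.
  have -> : #|porbit f r| = (size p).+1.
    by rewrite (eq_card (fun y => cycle_porbit y cp (mem_head _ _))) (card_uniqP up).
  rewrite (eq_bigr (fun=> 3)) => [|X /andP[/imsetP[x _ ->]]].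
    rewrite sum_nat_const => <-.
    have -> : #|[pred X | (X \in porbits f) && (X != porbit f r)]| = (ncyc f).-1.
      rewrite /ncyc (cardsD1 (porbit f r) (porbits f)) rf /=.
      by apply: eq_card => X; rewrite !inE andbC.
    have : 0 < ncyc f by apply/card_gt0P; exists (porbit f r).
    by case: (ncyc f) => // k _; rewrite mulnC mulnS; lia.
  move=> xr; apply/eqP; rewrite face_card // inn //.
  apply: contra xr => xp; rewrite eq_porbit_mem (cycle_porbit _ cp) ?mem_head //.
rewrite /planar /euler_sum (comps1 cT) (ncycC n e).
move: (ncyc n) (ncyc e) (ncyc (e * n)) #|D| E2 => x y z d; clear => E2.
by apply/eqP/eqP; lia.
Qed.

End Counting.

(** * Rooted disks and rooted triangulations *)

Section Frozen.
Variable D : finType.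
Implicit Types (M : plane_map D) (r x y : D) (p : seq D).

Record rooted_disk M r p : Prop := RootedDisk {
  rd_planar : planar (node M) (edge M);
  rd_disk : disk (node M) (edge M) r p;
  rd_conn : forall x, conn (node M) (edge M) r x;
  rd_outer : outer M = [set x in r :: p];
  rd_root : root_edge M = [set r; edge M r]
}.

Lemma porbit_edge (e : {perm D}) x : e (e x) = x -> porbit e x = [set x; e x].
Proof.
move=> eex; apply/setP=> y; rewrite !inE (@cycle_porbit _ e [:: x; e x]) ?inE ?eqxx //=.
by rewrite eex !eqxx.
Qed.

Lemma origin_eq M x y : (origin M x == origin M y) = (x \in porbit (node M) y).
Proof. exact: eq_porbit_mem. Qed.

Lemma rooted_disk_triangulation M r p : rooted_disk M r p -> rooted_triangulation M.
Proof.
case: M => n e out re [/= pl dM cT outE reE]; rewrite {}outE {}reE {out re}.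
case: (dM) => -[cp up ee lo si inn] sep.
have [E2 _ plE] := disk_counts cT dM.
have ffix x : (e * n)%g x != x.
  rewrite permM; apply: contraNneq (lo x (cT x)) => E.
  by rewrite porbit_sym -{1}E porbit_step.
have outE : [set x in r :: p] = porbit (e * n) r.
  by apply/setP=> y; rewrite inE (cycle_porbit y cp) ?mem_head.
rewrite /rooted_triangulation /=; apply/and3P; split; last 2 first.
- by rewrite /edges /= -porbit_edge ?ee //; apply: imset_f.
- by apply/set0Pn; exists r; rewrite !inE !eqxx.
rewrite /triangulation /simple_plane_graph; apply/andP; split.
  apply/and5P; split; last (apply/andP; split).
  - apply/forallP=> x /=; rewrite ee ?eqxx ?andbT //.
    by apply: contraNneq (lo x (cT x)) => ->; apply: porbit_id.
  - apply/forallP=> x; apply/forallP=> y /=.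
    by have := conn_trans (etrans (conn_sym _ _ _ _) (cT x)) (cT y).
  - by move: pl; rewrite plE.
  - by apply/forallP=> x; rewrite origin_eq porbit_sym /=; apply: lo.
  - apply/forallP=> x; apply/forallP=> y; rewrite !origin_eq; apply/implyP => /andP[/= h1 h2].
    by apply/eqP; apply: si; rewrite // porbit_sym.
  - by rewrite /= outE; apply: imset_f.
have inner : inner_triangles (PlaneMap n e [set x in r :: p] [set r; e r]).
  apply/forall_inP => X /imsetP[x _ ->] /=; apply/implyP.
  rewrite outE eq_porbit_mem => xr; rewrite /face /= face_card // inn //.
  by rewrite -(cycle_porbit x cp (mem_head _ _)).
rewrite inner andbT; apply/orP.
have [[nr ner pE]|[RT er]] := disk_cases dM.
  left; rewrite /single_edge.
  suff : (ncyc e).*2 = 2 by rewrite -[#|_|]/(ncyc e); case: (ncyc e) => [|[]].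
  have er : e r != r by apply: contraNneq (lo r (cT r)) => ->; apply: porbit_id.
  have [_ <-] := leaf_disk nr ner er (ee _ (cT r)).
  by rewrite E2 -cardsT; congr #|pred_of_set _|; apply/setP=> z; rewrite !inE cT.
right; apply/andP; split; last first.
  apply/forall_inP => x; rewrite inE => xo; apply/forall_inP => y; rewrite inE => yo.
  by rewrite origin_eq porbit_sym; apply/implyP => /= xy; apply/eqP/sep.
have -> : #|outer (PlaneMap n e [set x in r :: p] [set r; e r])| = (size p).+1.
  by rewrite /= cardsE (card_uniqP up).
(* A boundary of two darts would consist of parallel edges, hence of one edge, and [e r] would be on
   it. *)
have [c [q pE]] := disk_nonempty dM; rewrite pE.
case: q pE => [|? ?] //= pE; rewrite {}pE in cp er.
move: cp => /=; rewrite !permM => /and3P[/eqP cE /eqP rE _].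
have H1 : e c \in porbit n r by rewrite porbit_sym -{1}rE porbit_closed porbit_id.
have H2 : e (e c) \in porbit n (e r).
  by rewrite ee // -cE porbit_closed porbit_id.
have E := si _ _ (cT r) H1 H2.
by case/negP: er; rewrite inE E ee.
Qed.

Lemma triangulation_root M : rooted_triangulation M ->
  exists2 r, r \in outer M & r \in root_edge M.
Proof. by case/and3P=> _ _ /set0Pn[r]; rewrite inE => /andP[h1 h2]; exists r. Qed.

Lemma triangulation_rooted_disk M r : rooted_triangulation M ->
  r \in outer M -> r \in root_edge M -> exists p, rooted_disk M r p.
Proof.
case: M => n e out re /and3P[/= /andP[S T] reE _] ro rre.
case/and5P: S => /= /forallP inv /forallP con eul /forallP loop /andP[/forallP simp outF].
have ee x : e (e x) = x by have /andP[_ /eqP] := inv x.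
have cT x y : conn n e x y by have /forallP/(_ y) := con x.
have reE' : re = [set r; e r].
  case/imsetP: reE => x _ E; rewrite E /= -porbit_edge //.
  by move: rre; rewrite E -eq_porbit_mem => /eqP.
have outE : out = porbit (e * n) r.
  by case/imsetP: outF ro => x _ ->; rewrite -eq_porbit_mem => /eqP.
have [p [cp up]] := porbit_cycle (e * n)%g r.
have outE' : out = [set x in r :: p].
  by rewrite outE; apply/setP=> y; rewrite inE (cycle_porbit y cp) ?mem_head.
have lo x : e x \notin porbit n x.
  by rewrite porbit_sym -(origin_eq (PlaneMap n e out re)); apply: loop.
have ffix x : (e * n)%g x != x.
  rewrite permM; apply: contraNneq (lo x) => E.
  by rewrite porbit_sym -{1}E porbit_step.
have si x y : y \in porbit n x -> e y \in porbit n (e x) -> x = y.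
  rewrite -!(origin_eq (PlaneMap n e out re)) => h1 h2; apply/esym/eqP.
  by have /forallP/(_ x) := simp y; rewrite h1 /= h2.
have [sep inn] : separated n (r :: p) /\
    forall x, x \notin r :: p -> (e * n)%g ((e * n)%g ((e * n)%g x)) = x.
  case/orP: T => [sing|/andP[/andP[_ /forall_inP sc] /forall_inP tri]]; last first.
    split=> [x y xo yo xy|x xo].
      have xo' : x \in out by rewrite outE' inE.
      have yo' : y \in out by rewrite outE' inE.
      apply/eqP; apply: (implyP (forall_inP (sc x xo') y yo')).
      by rewrite origin_eq porbit_sym.
    apply/eqP; rewrite -face_card //.
    have := tri (porbit (e * n) x); rewrite /faces /= imset_f // => /(_ isT)/implyP; apply.
    by rewrite outE eq_porbit_mem (cycle_porbit x cp) ?mem_head.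
  (* In a single edge there are only the darts [r] and [e r], and [n] fixes both. *)
  have er : e r != r by apply: contraNneq (lo r) => ->; apply: porbit_id.
  have D2 : #|D| = 2.
    rewrite -(@ncyc_uniform _ e 2); last first.
      move=> x; apply: edge_card => //.
      by apply: contraNneq (lo x) => ->; apply: porbit_id.
    by move: sing; rewrite /single_edge -[#|_|]/(ncyc e) => /eqP->.
  have DE x : (x == r) || (x == e r).
    have : [set r; e r] = [set: D].
      by apply/eqP; rewrite eqEcard subsetT cardsT D2 cards2 eq_sym er.
    by move/setP/(_ x); rewrite !inE.
  have nx x : n x = x.
    case/orP: (DE x) => /eqP->.
      case/orP: (DE (n r)) => /eqP // E; have := lo r.
      by rewrite -E porbit_step.
    case/orP: (DE (n (e r))) => /eqP // E; have := lo (e r).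
    by rewrite ee -{1}E porbit_step.
  split=> [x y _ _|x xo]; first by rewrite porbit_sym; move/porbit_fix->.
  have fr : (e * n)%g r = e r by rewrite permM nx.
  case/negP: xo; case/orP: (DE x) => /eqP->; first exact: mem_head.
  by rewrite -fr (fcycle_closed _ cp) mem_head.
have dM : disk n e r p.
  by split=> //; split=> // x *; [apply: si|apply: inn].
exists p; split=> //=.
by have [_ _ ->] := disk_counts (cT r) dM; move: eul.
Qed.

(** Boundary darts have distinct origins, so there are [size p + 1] exterior vertices; the total
    follows by comparing Euler's formula with [weight_nedges]. *)
Lemma disk_vertex_counts M r p c : rooted_disk M r p -> valid_code c ->
  coded c (node M) (edge M) r p ->
  #|exterior_vertices M| = (border c).+1 /\
  #|interior_vertices M| + (border c).+1 = (weight c).+1.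
Proof.
case: M => n e out re [/= pl dM cT outE reE] v C.
have [_ sz _ dc] := coded_sound v C.
have [E2 FE plE] := disk_counts cT dM.
have [cp up ee lo si inn] := dM.1; have sep := dM.2.
set M := PlaneMap n e out re.
have ext : exterior_vertices M = [set porbit n x | x in r :: p].
  apply/setP=> X; rewrite !inE; apply/andP/imsetP => [[/imsetP[x _ XE] /set0Pn[y]]|[x xo ->]].
    rewrite inE /= outE inE => /andP[yX yo]; exists y => //.
    by apply/esym/eqP; rewrite XE eq_porbit_mem; move: yX; rewrite XE.
  split; first exact: imset_f.
  by apply/set0Pn; exists x; rewrite inE /= porbit_id outE inE.
have extc : #|exterior_vertices M| = (border c).+1.
  rewrite ext card_in_imset => [|x y xo yo /eqP].
    by rewrite (card_uniqP up) /= sz.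
  by rewrite eq_porbit_mem => xy; apply/esym/sep.
split=> //.
have sub : exterior_vertices M \subset vertices M.
  by apply/subsetP=> X; rewrite inE => /andP[].
rewrite -extc /interior_vertices cardsD (setIidPr sub) subnK ?subset_leq_card //.
have DE : #|D| = (nedges c).*2.
  by rewrite -dc -cardsT; congr #|pred_of_set _|; apply/setP=> z; rewrite !inE cT.
have w := weight_nedges v.
rewrite -[LHS]/(ncyc n); move: pl; rewrite plE => /eqP.
move: FE E2 w; rewrite DE sz.
move: (ncyc n) (ncyc e) (ncyc (e * n)) (nedges c) (border c) (weight c) => a1 a2 a3 a4 a5 a6.
clear; lia.
Qed.

End Frozen.

(** * Codes of isomorphic triangulations *)

Section Classes.

(** The root edge is preserved as a pair of darts, so [f r] could be [edge N r']. Both darts lie on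
    the boundary only in a single edge, whose code is [Edge] from either end. *)
Lemma iso_coded (D D' : finType) (M : plane_map D) (N : plane_map D') f r c p r' c' p' q q' :
  map_iso M N f -> rooted_disk M r q -> rooted_disk N r' q' ->
  valid_code c -> coded c (node M) (edge M) r p ->
  valid_code c' -> coded c' (node N) (edge N) r' p' -> c = c'.
Proof.
move=> [fB fn fe fo fr] dM dN v C v' C'.
have f_inj := bij_inj fB.
have L : local_iso (node M) (edge M) r (node N) (edge N) (f r) f.
  by split=> // x y _ _; apply: f_inj.
have Cf := coded_iso v C L.
have fro : f r \in outer N by rewrite -fo imset_f // (rd_outer dM) inE mem_head.
have frr : f r \in root_edge N by rewrite -fr imset_f // (rd_root dM) !inE eqxx.
move: frr fro; rewrite (rd_root dN) (rd_outer dN) !inE => /orP[/eqP E _|/eqP E].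
  rewrite E in Cf.
  by apply: (coded_det v Cf v'); rewrite (coded_outer v Cf v' C').
rewrite E => H; have ero : edge N r' \in r' :: q' by rewrite inE.
have [[nr ner _]|[RT er]] := disk_cases (rd_disk dN); last first.
  by move: ero; rewrite inE (negPf er) orbF (negPf (rt_e RT)).
have cE : c = Edge.
  case: c Cf {v C} => //= [c1 c2|c1] [RT _]; case/eqP: (rt_a RT); by rewrite E ner.
have c'E : c' = Edge.
  by case: c' C' {v'} => //= [c1 c2|c1] [RT _]; case/eqP: (rt_a RT).
by rewrite cE c'E.
Qed.

Lemma coded_map_iso (D D' : finType) (M : plane_map D) (N : plane_map D') r r' c p p' q q' :
  rooted_disk M r q -> rooted_disk N r' q' -> valid_code c ->
  coded c (node M) (edge M) r p -> coded c (node N) (edge N) r' p' ->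
  exists f, map_iso M N f.
Proof.
move=> dM dN v C C'.
have [f L] := coded_rigid C C'; exists f.
have cM := rd_conn dM; have cN := rd_conn dN.
have Cf := coded_iso v C L.
have [d _ _ _] := coded_sound v C.
have [d' _ _ _] := coded_sound v C'.
have qE := disk_outer_eq d (rd_disk dM); have qE' := disk_outer_eq d' (rd_disk dN).
have pE := coded_outer v Cf v C'.
have f_inj : injective f by move=> x y; apply: (li_inj L).
split.
(* Every dart of [N] is connected to the root, hence in the image of [f]; the default [r] is never
   reached. *)
- exists (fun y => if [pick x | f x == y] is Some x then x else r) => [x|y].
    by case: pickP => [z /eqP/f_inj //|/(_ x)]; rewrite eqxx.
  case: pickP => [z /eqP //|H].
  have [|x _ E] := li_conn_inv L (conn_refl _ _ r) (y' := y).
    by rewrite (li_root L).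
  by have := H x; rewrite E eqxx.
- by move=> x; apply: (li_n L).
- by move=> x; apply: (li_e L).
- rewrite (rd_outer dM) (rd_outer dN) -qE -qE' -pE -(li_root L) -map_cons.
  apply/setP=> y; rewrite inE; apply/imsetP/mapP => [[x]|[x xo ->]].
    by rewrite inE => xo ->; exists x.
  by exists x; rewrite ?inE.
- by rewrite (rd_root dM) (rd_root dN) imsetU1 imset_set1 (li_e L) // (li_root L).
Qed.

Lemma build_disk c : valid_code c ->
  exists d (M : plane_map 'I_d) r p, rooted_disk M r p /\ coded c (node M) (edge M) r p.
Proof.
move=> v; exists (nedges c).*2.
have [|x _|n [e [r [p [pl C dE _]]]]] :=
    @coded_build _ c 1%g 1%g [set: 'I_(nedges c).*2] v _ (planar_id _).
- by rewrite cardsT card_ord.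
- by rewrite perm1.
exists (PlaneMap n e [set x in r :: p] [set r; e r]), r, p; split=> //.
have [d _ _ _] := coded_sound v C.
split=> //= x.
by have := in_setT x; rewrite -dE inE.
Qed.
End Classes.

(** * Trees, and the bijection that turns width into spine *)

Inductive tree := Leaf | Node of tree & tree & nat.

Fixpoint width t := if t is Node l _ j then width l + j else 1.
Fixpoint spine t := if t is Node _ r _ then (spine r).+1 else 1.
Fixpoint leaves t := if t is Node l r _ then leaves l + leaves r else 1.
Fixpoint valid_tree t :=
  if t is Node l r j then [&& valid_tree l, valid_tree r, 0 < j & j <= width r] else true.

Lemma valid_node l r j :
  valid_tree (Node l r j) = [&& valid_tree l, valid_tree r, 0 < j & j <= width r].
Proof. by []. Qed.

Lemma width_gt0 t : 0 < width t.
Proof. by elim: t => //= l IHl r _ j; rewrite addn_gt0 IHl. Qed.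

Lemma leaves_gt0 t : 0 < leaves t.
Proof. by elim: t => //= l IHl r _ j; rewrite addn_gt0 IHl. Qed.

Lemma spine_gt0 t : 0 < spine t.
Proof. by case: t. Qed.

(* Reading the spine of a tree bottom-up as a sequence of operations on a stack
   ("pop until j entries are left, then push width l entries"), [graft p q k] is
   the sequence for q with its last k - 1 operations played on top of the
   bottom entry, followed by the sequence for p. *)
Fixpoint graft_leaf q k := match k, q with
  | k'.+2, Node l q' j => Node l (graft_leaf q' k'.+1) j.+1
  | _, _ => Node q Leaf 1
  end.

Fixpoint graft p q k :=
  if p is Node l p' j then Node l (graft p' q k) j else graft_leaf q k.

(** The test on [j] tells apart the two origins of a leaf as first component: [graft] above a leaf
    keeps a label, which [width Leaf] bounds by 1, whereas [graft_leaf] raises a label to at least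
    2. [Leaf] is no graft, and the index 0 marks it. *)
Fixpoint ungraft t : tree * tree * nat :=
  if t is Node l r j then
    if r is Leaf then (Leaf, l, 1) else
    let: (p, q, k) := ungraft r in
    if p is Leaf then
      if 1 < j then (Leaf, Node l q j.-1, k.+1) else (Node l p j, q, k)
    else (Node l p j, q, k)
  else (Leaf, Leaf, 0).

Definition graft_args p q k := [&& valid_tree p, valid_tree q, 0 < k & k <= spine q].

Lemma graft_leafP q k : valid_tree q -> 0 < k <= spine q ->
  [/\ valid_tree (graft_leaf q k), width (graft_leaf q k) = (width q).+1,
      spine (graft_leaf q k) = k.+1, leaves (graft_leaf q k) = (leaves q).+1
    & ungraft (graft_leaf q k) = (Leaf, q, k)].
Proof.
elim: q k => [|l _ q IH j] [|[|k]] //=.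
  by move=> ->; rewrite addn1 addn1.
move=> /and4P[vl vq j0 jq] kq; have [v tv sp lv un] := IH k.+1 vq kq.
rewrite vl v tv sp lv un !ltnS jq j0 addnS addnS; split=> //.
by case: (graft_leaf q k.+1) un => // *; rewrite ltnS j0.
Qed.

(** The spine behaves under [graft] as the width does under [Node]: it gains [k], which is at most
    the spine of [q]. *)
Lemma graftP p q k : graft_args p q k ->
  [/\ valid_tree (graft p q k), width (graft p q k) = (if p is Leaf then (width q).+1 else width p),
      spine (graft p q k) = spine p + k, leaves (graft p q k) = leaves p + leaves q
    & ungraft (graft p q k) = (p, q, k)].
Proof.
elim: p => [|l _ p IH j] /and4P[vp vq k0 kq].
  have [|v tv sp lv un] := @graft_leafP q k vq; first by rewrite k0.
  by rewrite /= v tv sp lv un.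
have := vp; rewrite /= => /and4P[vl vp' j0 jp].
have [|v tv sp lv un] := IH; first by rewrite /graft_args vp' vq k0.
rewrite /= vl v j0 sp lv un addSn addnA; split=> //.
  by rewrite tv; case: (p) jp => //= jp; apply: leq_trans jp _.
case: (graft p q k) un => [|? ? ?] un.
  by case: un => _ _ k0E; rewrite -k0E in k0.
by case: (p) jp => //= jp; rewrite ltnNge jp.
Qed.

Lemma ungraftP t : valid_tree t -> 1 < leaves t ->
  let: (p, q, k) := ungraft t in graft_args p q k /\ graft p q k = t.
Proof.
elim: t => // l _ r IH j; rewrite valid_node => /and4P[vl vr j0 jr] _.
case: r IH vr jr => [|rl rr rj] IH vr jr.
  rewrite /graft_args /= vl spine_gt0; split=> //.
  by case: j j0 jr => [|[]] //; case: (l).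
have := IH vr; set r := Node rl rr rj in vr jr *.
have r1 : 1 < leaves r by have := leaves_gt0 rl; have := leaves_gt0 rr; rewrite /r /=; lia.
have -> : ungraft (Node l r j) =
  (let: (p, q, k) := ungraft r in
    if p is Leaf then
      if 1 < j then (Leaf, Node l q j.-1, k.+1) else (Node l p j, q, k)
    else (Node l p j, q, k)) by [].
case: (ungraft r) => [[p q] k] /(_ r1)[A E].
have [v tv sp _ _] := graftP A; have /and4P[vp vq k0 kq] := A.
case: p A E v tv sp vp => [|pl pr pj] A E v tv sp vp; last first.
  by rewrite -E tv in jr; rewrite /graft_args valid_node vl vp j0 jr vq k0 kq -E.
rewrite -E tv in jr; case: ltnP => j1.
  split; first by rewrite /graft_args /= vl vq ltnS kq !andbT /=; lia.
  by case: j j0 j1 jr => [|[|j]] //= _ _ _; case: k k0 {A kq} E {v tv sp} => //= k _ <-.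
have -> : j = 1 by lia.
by rewrite /graft_args /= vl vq k0 kq; split=> //; rewrite -E.
Qed.

Fixpoint unfold t := if t is Node l r j then graft (unfold l) (unfold r) j else Leaf.

Lemma unfoldP t : valid_tree t ->
  [/\ valid_tree (unfold t), spine (unfold t) = width t & leaves (unfold t) = leaves t].
Proof.
elim: t => //= l IHl r IHr j /and4P[/IHl[vl sl ll] /IHr[vr sr lr] j0 jr].
have [|v _ sp lv _] := @graftP (unfold l) (unfold r) j.
  by rewrite /graft_args vl vr j0 sr.
by rewrite v sp lv sl ll lr.
Qed.

Lemma unfold_args l r j : valid_tree (Node l r j) -> graft_args (unfold l) (unfold r) j.
Proof.
rewrite /= => /and4P[/unfoldP[vl _ _] /unfoldP[vr sr _] j0 jr].
by rewrite /graft_args vl vr j0 sr.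
Qed.

Lemma unfold_inj t t' : valid_tree t -> valid_tree t' -> unfold t = unfold t' -> t = t'.
Proof.
have neq l r j : valid_tree (Node l r j) -> unfold (Node l r j) <> Leaf.
  move=> v; have [_ _ sp _ _] := graftP (unfold_args v); rewrite /= => E.
  move: v sp; rewrite E /= => /and4P[_ _ j0 _].
  by have := spine_gt0 (unfold l); lia.
elim: t t' => [|l IHl r IHr j] [|l' r' j'] // v v'.
- by move/esym/neq; case.
- by move/neq; case.
rewrite /= => E; have [_ _ _ _ u] := graftP (unfold_args v).
have [_ _ _ _ u'] := graftP (unfold_args v').
move: v v' => /= /and4P[vl vr _ _] /and4P[vl' vr' _ _].
by move: u'; rewrite -E u => -[/(IHl _ vl vl')-> /(IHr _ vr vr')-> ->].
Qed.

(** Induction on the number of leaves, since the parts that [ungraft] returns need not be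
    subtrees. *)
Lemma unfold_surj u : valid_tree u -> exists2 t, valid_tree t & unfold t = u.
Proof.
have [n] := ubnP (leaves u); elim: n u => // n IH u un v.
case: u un v => [|l r j] un v; first by exists Leaf.
have l1 : 1 < leaves (Node l r j).
  by have := leaves_gt0 l; have := leaves_gt0 r => /=; lia.
have := ungraftP v l1; case: (ungraft _) => [[p q] k] [A E].
have [_ _ _ lE _] := graftP A; have /and4P[vp vq k0 kq] := A.
have lp := leaves_gt0 p; have lq := leaves_gt0 q.
have [|tp vtp tpE] := IH p _ vp; first by rewrite -E lE in un; lia.
have [|tq vtq tqE] := IH q _ vq; first by rewrite -E lE in un; lia.
exists (Node tp tq k); last by rewrite /= tpE tqE.
rewrite /= vtp vtq k0 /=; have [_ <- _] := unfoldP vtq.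
by rewrite tqE.
Qed.

(** * Trees as codes of triangulations *)

(** The label [j] of a node is one more than the slack left after the run of [Cover], so
    [j = width r] stands for an empty run. *)
Fixpoint tree_code t :=
  if t is Node l r j then iter (width r - j) Cover (Join (tree_code l) (tree_code r)) else Edge.

Lemma iter_coverP k c : slack (iter k Cover c) = slack c - k
  /\ border (iter k Cover c) = border c - k /\ weight (iter k Cover c) = weight c.
Proof.
elim: k => [|k [IH1 [IH2 IH3]]]; first by rewrite /= !subn0.
by rewrite iterS /= IH1 IH2 IH3 !subnS.
Qed.

Lemma valid_iter_cover k c : valid_code (iter k Cover c) = valid_code c && (k <= slack c).
Proof.
elim: k => [|k IH]; first by rewrite andbT.
rewrite iterS /= IH; have [-> _] := iter_coverP k c.
by case: valid_code => //=; rewrite subn_gt0; apply/andP/idP => [[]|/[dup]/ltnW].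
Qed.

Lemma tree_codeP t : valid_tree t ->
  [/\ valid_code (tree_code t), border (tree_code t) = width t
    & weight (tree_code t) = leaves t].
Proof.
elim: t => //= l IHl r IHr j /and4P[/IHl[vl bl wl] /IHr[vr br wr] j0 jr].
have [_ [-> ->]] := iter_coverP (width r - j) (Join (tree_code l) (tree_code r)).
rewrite valid_iter_cover /= vl vr bl br wl wr; split=> //; last by lia.
by rewrite -subn1 leq_sub2l.
Qed.

Lemma iter_cover_inj k k' c d c' d' :
  iter k Cover (Join c d) = iter k' Cover (Join c' d') -> [/\ k = k', c = c' & d = d'].
Proof.
elim: k k' => [|k IH] [|k'] //; first by case.
by rewrite !iterS => -[/IH[-> -> ->]].
Qed.

Lemma tree_code_inj t t' : valid_tree t -> valid_tree t' ->
  tree_code t = tree_code t' -> t = t'.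
Proof.
elim: t t' => [|l IHl r IHr j] [|l' r' j'] //=.
- by move=> _ _; case: (width r' - j').
- by move=> _ _; case: (width r - j).
move=> /and4P[vl vr _ jr] /and4P[vl' vr' _ jr'] /iter_cover_inj[E El Er].
have rE := IHr _ vr vr' Er; rewrite -rE in E jr' *.
by rewrite (IHl _ vl vl' El); congr Node; lia.
Qed.

Lemma tree_code_surj c : valid_code c -> exists2 t, valid_tree t & tree_code t = c.
Proof.
elim: c => [|c IHc d IHd|c IH] /=.
- by exists Leaf.
- case/andP=> /IHc[t vt <-] /IHd[u vu <-]; exists (Node t u (width u)).
    by rewrite /= vt vu width_gt0 leqnn.
  by rewrite /= subnn.
case/andP=> /IH[t vt <-]; case: t vt => //= l r j /and4P[vl vr j0 jr].
have [-> _] := iter_coverP (width r - j) (Join (tree_code l) (tree_code r)).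
have [_ br _] := tree_codeP vr; rewrite /= br => sl.
exists (Node l r j.-1); first by rewrite /= vl vr /=; lia.
by rewrite /= (_ : width r - j.-1 = (width r - j).+1) //; lia.
Qed.

(** * Chord diagrams on arbitrary endpoints, and allowed positions *)

Section Chords.
Variable n : nat.
Implicit Types (c d e r : chord n) (S A K : {set chord n}) (y z : nat).

Definition pt (q : chord n * bool) : nat := if q.2 then sink q.1 else source q.1.
Definition points S : {set chord n * bool} := [set q | q.1 \in S].

Record matching S : Prop := Matching {
  mt_lt : forall c, c \in S -> source c < sink c;
  mt_inj : {in points S &, injective pt}
}.

Definition rn_in S : rel (chord n) :=
  [rel c d | [&& c \in S, d \in S & right_neighbor c d]].

Definition escapes S c z := [exists d, connect (rn_in S) c d && (z < sink d)].

Definition open S y c := [&& c \in S, source c <= y & y < sink c].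

(* In terms of a new root chord with sink just after y: it crosses some chord of
   S and does not create a top cycle. *)
Definition allowed S y :=
  [exists c, open S y c] &&
  [forall d, forall c, [&& open S y d, open S y c & source d < source c]
    ==> ~~ escapes S c (sink d)].

(* r, d and a shortest chain of right neighbors from c to a chord ending after d
   form a top cycle. *)
Definition clean S := forall r d c, r \in S -> d \in S -> c \in S ->
  source r < source d -> source d < source c -> source c < sink r ->
  sink r < sink d -> sink r < sink c -> ~~ escapes S c (sink d).

Lemma in_points S q : (q \in points S) = (q.1 \in S).
Proof. by rewrite inE. Qed.

Lemma matching_sub S A : A \subset S -> matching S -> matching A.
Proof.
move=> /subsetP AS [lt inj]; split=> [c /AS/lt //|q q'].
by rewrite !in_points => /AS h1 /AS h2; apply: inj; rewrite in_points.
Qed.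

Section Matching.
Variable S : {set chord n}.
Hypothesis MS : matching S.

Lemma source_inj c d : c \in S -> d \in S -> source c = source d -> c = d.
Proof.
move=> cS dS E; have := @mt_inj _ MS (c, false) (d, false).
by rewrite !in_points => /(_ cS dS E)[].
Qed.

Lemma sink_inj c d : c \in S -> d \in S -> sink c = sink d -> c = d.
Proof.
move=> cS dS E; have := @mt_inj _ MS (c, true) (d, true).
by rewrite !in_points => /(_ cS dS E)[].
Qed.

Lemma source_neq_sink c d : c \in S -> d \in S -> source c != sink d.
Proof.
move=> cS dS; apply/eqP => E; have := @mt_inj _ MS (c, false) (d, true).
by rewrite !in_points => /(_ cS dS E)[].
Qed.

End Matching.

Lemma rn_reach_in S c d : connect (rn_in S) c d -> c \in S -> d \in S.
Proof.
case/connectP=> p; elim: p c => [|x p IH] c /= => [_ -> //|].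
by case/andP=> /and3P[_ xS _] px dE _; apply: IH px dE xS.
Qed.

Lemma rn_reach_source S c d : connect (rn_in S) c d -> source c <= source d.
Proof.
case/connectP=> p; elim: p c => [|x p IH] c /= => [_ -> //|].
case/andP=> /and3P[_ _ /and3P[cx _ _]] px dE.
exact: leq_trans (ltnW cx) (IH _ px dE).
Qed.

(** The chords of the chain cover the interval from [source c] to [sink e]; one whose interval
    contains [source d] ends before [sink d], hence has [d] as a right neighbor. *)
Lemma rn_chain S c e d : connect (rn_in S) c e -> c \in S -> d \in S ->
  source c < source d -> source d < sink e -> sink e < sink d ->
  connect (rn_in S) c d.
Proof.
case/connectP=> p; elim/last_ind: p e => [|p x IH] e /=.
  by move=> _ -> cS dS h1 h2 h3; apply: connect1; rewrite /rn_in /= cS dS /right_neighbor h1 h2 h3.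
rewrite rcons_path last_rcons => /andP[pp /and3P[lS xS /and3P[lx xl ls]]] -> cS dS h1 h2 h3.
have cl : connect (rn_in S) c (last c p) by apply/connectP; exists p.
case: (ltnP (source x) (source d)) => xd.
  have cx : connect (rn_in S) c x.
    by apply: connect_trans cl (connect1 _); rewrite /rn_in /= lS xS /right_neighbor lx xl ls.
  by apply: connect_trans cx (connect1 _); rewrite /rn_in /= xS dS /right_neighbor xd h2 h3.
by apply: (IH (last c p)) => //; [exact: leq_ltn_trans xd xl|exact: ltn_trans ls h3].
Qed.

Lemma connected_ind S (P : chord n -> Prop) c : connected S -> c \in S -> P c ->
  (forall d d', d \in S -> d' \in S -> P d -> crossing d d' -> P d') ->
  forall d, d \in S -> P d.
Proof.
move=> /forall_inP/(_ c) H cS Pc step d dS.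
have /forall_inP/(_ d dS)/connectP[p] := H cS.
elim: p c {H} cS Pc => [|x p IH] c cS Pc /=; first by move=> _ ->.
by case/andP=> /and3P[_ xS cx] px; apply: IH => //; apply: step cx.
Qed.

Lemma crossing_sym c d : crossing c d = crossing d c.
Proof. by rewrite /crossing orbC. Qed.

Lemma crossing_overlap c d : crossing c d -> source d < sink c.
Proof.
case/orP=> /and3P[h1 h2 h3] //.
exact: ltn_trans h1 (ltn_trans h2 h3).
Qed.

Lemma crossing_nested c d : crossing c d -> source d <= source c -> sink c <= sink d -> False.
Proof.
case/orP=> /and3P[h1 h2 h3]; first by rewrite leqNgt h1.
by move=> _; rewrite leqNgt h3.
Qed.

(** Otherwise the chords that end at or before [z] would be closed under crossing. *)
Lemma connected_straddle S z c e : connected S -> matching S -> c \in S -> sink c <= z ->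
  e \in S -> z < source e -> exists2 d, d \in S & source d <= z < sink d.
Proof.
move=> cS MS cin cz ein ze.
have [/existsP[d /andP[dS dz]]|H] := boolP [exists d, (d \in S) && (source d <= z < sink d)].
  by exists d.
have noo d : d \in S -> source d <= z -> sink d <= z.
  move=> dS dz; rewrite leqNgt; apply: contra H => zd.
  by apply/existsP; exists d; rewrite dS dz.
suff ez : sink e <= z.
  by have := leq_trans (ltn_trans ze (mt_lt MS ein)) ez; rewrite ltnn.
apply: (connected_ind (P := fun d => sink d <= z) cS cin cz) => // d d' dS d'S dz X.
by apply: noo => //; apply: ltnW; apply: leq_trans (crossing_overlap X) dz.
Qed.

Definition is_root S r := r \in S /\ forall c, c \in S -> source r <= source c.

(** Among the chords other than [r] open at this position, let [c] have the least source. If no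
    chain of right neighbors from [c] passed [sink r], the chords that end within reach of these
    chains would be closed under crossing and cut off from [r]. So [r] and [c] violate the condition
    of [allowed]. *)
Lemma not_allowed_under_root S r q : connected S -> matching S -> is_root S r ->
  q \in points S -> source r < pt q < sink r -> ~~ allowed S (pt q).
Proof.
move=> cS MS [rS rmin] qS /andP[rq qr].
set y := pt q in rq qr *.
have ltS := mt_lt MS.
(* If only [r] were open at the sink of [c0], the chords other than [r] that end no later would be
   closed under crossing. *)
have [c0 c0S c0r] : exists2 c, open S y c & c != r.
  case: q qS @y rq qr => [c0 [|]]; rewrite in_points /= => c0S rq qr; last first.
    exists c0; first by rewrite /open c0S leqnn ltS.
    by apply: contraTneq rq => ->; rewrite /= ltnn.
  rewrite /pt /= in rq qr *.
  have [/existsP[c /andP[h1 h2]]|H] := boolP [exists c, open S (sink c0) c && (c != r)].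
    by exists c.
  have c0r : c0 != r by apply: contraTneq qr => ->; rewrite ltnn.
  have [] : r != r /\ sink r <= sink c0; last by rewrite eqxx.
  apply: (connected_ind (P := fun d => d != r /\ sink d <= sink c0) cS c0S) => //.
  move=> d d' dS d'S [dr dc0] X.
  have [d'r|d'r] := eqVneq d' r.
    by subst d'; case: (crossing_nested X (rmin d dS)); apply: leq_trans dc0 (ltnW qr).
  split=> //; rewrite leqNgt; apply: contra H => h.
  apply/existsP; exists d'; rewrite d'r /open d'S h !andbT.
  exact: ltnW (leq_trans (crossing_overlap X) dc0).
have [c /andP[cO cr] cmin] := @arg_minnP _ c0 (fun c => open S y c && (c != r)) (@source n)
  (introT andP (conj c0S c0r)).
have /and3P[cin cy yc] := cO.
apply/negP => /andP[_ /forallP/(_ r)/forallP/(_ c)/implyP].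
have rc : source r < source c.
  rewrite ltn_neqAle rmin // andbT; apply: contraNneq cr => /esym/(source_inj MS cin rS) //.
  by move->.
have rO : open S y r by rewrite /open rS qr ltnW.
rewrite rO cO rc => /(_ isT)/negP; apply.
have [e ce emax] := @arg_maxnP _ c (connect (rn_in S) c) (@sink n) (connect0 _ _).
apply/existsP; exists e; rewrite ce /= ltnNge; apply/negP => er.
have eS := rn_reach_in ce cin.
have sce := rn_reach_source ce.
have er' : sink e < sink r.
  rewrite ltn_neqAle er andbT; apply/eqP => /(sink_inj MS eS rS) E.
  by move: sce; rewrite E leqNgt rc.
have [] : r != r /\ sink r <= sink e; last by rewrite eqxx.
apply: (connected_ind (P := fun d => d != r /\ sink d <= sink e) cS cin) => //.
  by split=> //; apply: emax; apply: connect0.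
move=> d d' dS d'S [dr de] X.
have ld := ltS d dS; have ld' := ltS d' d'S.
have [d'r|d'r] := eqVneq d' r.
  by subst d'; case: (crossing_nested X (rmin d dS)); apply: ltnW (leq_ltn_trans de er').
split=> //; rewrite leqNgt; apply/negP => h.
have ce' : sink c <= sink e by apply: emax; apply: connect0.
have d'e : source d' < sink e := leq_trans (crossing_overlap X) de.
(* A chord starting after [c] would be reached by a chain itself; one starting before [c] would be
   open at [y] with a smaller source. *)
case: (ltngtP (source c) (source d')) => cd.
- have : sink d' <= sink e := emax d' (rn_chain ce cin d'S cd d'e h).
  by rewrite leqNgt h.
- have := cmin d'; rewrite /open d'S d'r (leq_trans (ltnW cd) cy).
  rewrite (ltn_trans (leq_trans yc ce') h) => /(_ isT).
  by rewrite leqNgt cd.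
- by have E := source_inj MS cin d'S cd; subst d'; move: h; rewrite ltnNge ce'.
Qed.

End Chords.

(** * The intersection order and its first terminal chord *)

Section IntersectionOrder.
Variable n : nat.
Implicit Types (c d e r : chord n) (S A K : {set chord n}).

Lemma mem_standard_order S c : (c \in standard_order S) = (c \in S).
Proof. by rewrite mem_sort mem_enum. Qed.

Lemma standard_order_root S r : matching S -> is_root S r ->
  exists s, standard_order S = r :: s.
Proof.
move=> MS [rS rmin].
have : sorted (fun c d => source c <= source d) (standard_order S).
  by apply: sort_sorted => c d; apply: leq_total.
have : r \in standard_order S by rewrite mem_standard_order.
have mem c : c \in standard_order S -> c \in S by rewrite mem_standard_order.
case: (standard_order S) mem => // h s mem rs.
rewrite /= path_sortedE; last by move=> ? ? ?; apply: leq_trans.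
case/andP=> /allP hmin _; exists s; congr (_ :: _).
have hS := mem h (mem_head _ _); apply: (source_inj MS hS rS).
apply/eqP; rewrite eqn_leq rmin // andbT.
by move: rs; rewrite inE => /predU1P[->|/hmin].
Qed.

Lemma component_sub S c : component S c \subset S.
Proof. by apply/subsetP=> d; rewrite inE => /andP[]. Qed.

Lemma standard_order0 S : #|S| = 0 -> standard_order S = [::].
Proof. by move/eqP; rewrite cards_eq0 => /eqP->; rewrite /standard_order enum_set0. Qed.

(** Lets the order of a component be used although the recursion reaches it with the depth left over
    from the whole diagram. *)
Lemma intersection_order_stable k l S : #|S| <= k -> #|S| <= l ->
  intersection_order_rec k S = intersection_order_rec l S.
Proof.
elim: k l S => [|k IH] [|l] S //=; rewrite ?leqn0.
- by move=> /eqP/standard_order0->.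
- by move=> _ /eqP/standard_order0->.
move=> Sk Sl; have mem := mem_standard_order S.
case: (standard_order S) mem => // r s mem; congr (r :: flatten _).
have rS : r \in S by rewrite -mem mem_head.
have Sr : #|S :\ r| < #|S| by rewrite [X in _ < X](cardsD1 r) rS.
apply: eq_map => c; have := subset_leq_card (component_sub (S :\ r) c) => cS.
apply: IH.
  by rewrite -ltnS; apply: leq_trans Sk; apply: leq_ltn_trans cS Sr.
by rewrite -ltnS; apply: leq_trans Sl; apply: leq_ltn_trans cS Sr.
Qed.

Lemma intersection_order_sub k S : {subset intersection_order_rec k S <= S}.
Proof.
elim: k S => //= k IH S c; have mem := mem_standard_order S.
case: (standard_order S) mem => // r s mem.
have rS : r \in S by rewrite -mem mem_head.
rewrite inE => /predU1P[->//|/flattenP[_ /mapP[d _ ->] /IH]].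
by move/(subsetP (component_sub _ _)); rewrite inE => /andP[].
Qed.

Lemma crossing_connect_sym S : connect_sym (crossing_in S).
Proof.
apply: sym_connect_sym => c d; rewrite /crossing_in /= crossing_sym.
by case: (c \in S); case: (d \in S).
Qed.

Lemma crossing_connect_sub A S c d : A \subset S ->
  connect (crossing_in A) c d -> connect (crossing_in S) c d.
Proof.
move=> /subsetP AS; apply: connect_sub => x y /and3P[/AS xS /AS yS xy].
by apply: connect1; rewrite /crossing_in /= xS yS.
Qed.

Lemma connected_from S r : (forall c, c \in S -> connect (crossing_in S) r c) -> connected S.
Proof.
move=> H; apply/forall_inP => c cS; apply/forall_inP => d dS.
by apply: connect_trans (H d dS); rewrite crossing_connect_sym H.
Qed.

Lemma connectedP S c d : connected S -> c \in S -> d \in S -> connect (crossing_in S) c d.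
Proof. by move=> /forall_inP/(_ c) H /H/forall_inP/(_ d). Qed.

Lemma component_eq S K c : K \subset S -> connected K -> c \in K ->
  (forall d e, d \in K -> e \in S -> crossing d e -> e \in K) -> component S c = K.
Proof.
move=> KS cK cin closed; apply/setP=> d; rewrite inE; apply/andP/idP => [[dS]|dK].
  case/connectP=> p; elim: p c cin => [|x p IH] c cin /=; first by move=> _ ->.
  by case/andP=> /and3P[_ xS cx] px; apply: IH => //; apply: closed cx.
split; first exact: (subsetP KS).
exact: crossing_connect_sub KS (connectedP cK cin dK).
Qed.

Lemma is_root_exists S c : c \in S -> exists r, is_root S r.
Proof.
by move=> cS; have [r rS rmin] := arg_minnP (@source n) cS; exists r.
Qed.

(** The order lists [r], then [K], then the other components. As [find] returns the length of the
    list when the search fails, [has] is carried along to keep the search within [K]. *)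
Lemma t1_rec S K r k0 : matching S -> is_root S r -> ~~ terminal S r ->
  is_root (S :\ r) k0 -> component (S :\ r) k0 = K ->
  (forall c, c \in K -> terminal S c = terminal K c) ->
  has (terminal K) (intersection_order K) ->
  t1 S = (t1 K).+1 /\ has (terminal S) (intersection_order S).
Proof.
move=> MS rtS ntr rtS' compE term hasK.
have [rS _] := rtS.
have [k kE] : exists k, #|S| = k.+1 by exists #|S :\ r|; rewrite (cardsD1 r) rS.
have [s sE] := standard_order_root MS rtS.
have MS' : matching (S :\ r) by apply: matching_sub MS; apply: subD1set.
have [s' sE'] := standard_order_root MS' rtS'.
have root0 : component_root (S :\ r) k0.
  by apply/forall_inP => d /(subsetP (component_sub _ _)); apply: rtS'.2.
have Kk : #|K| <= k.
  rewrite -compE; apply: leq_trans (subset_leq_card (component_sub _ _)) _.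
  by rewrite -ltnS -kE [X in _ < X](cardsD1 r) rS.
have [rest ioE] : exists rest, intersection_order S = r :: intersection_order K ++ rest.
  rewrite /intersection_order kE /= sE sE' /= root0 /= compE.
  by rewrite (intersection_order_stable Kk (leqnn _)); eexists.
have eqt : {in intersection_order K, terminal S =1 terminal K}.
  by move=> c /intersection_order_sub; apply: term.
have hasS : has (terminal S) (intersection_order K) by rewrite (eq_in_has eqt).
rewrite /t1 ioE /= (negPf ntr) find_cat has_cat hasS; split=> //.
by rewrite (eq_in_find eqt).
Qed.

End IntersectionOrder.

(** * Gluing two diagrams at an allowed endpoint *)

Section Insertion.
Variable n : nat.
Implicit Types (c d e : chord n) (p q : chord n * bool) (y z : nat).

(** Stated by comparing endpoints, so that the same record serves to take a diagram apart and to put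
    one together. *)
Record insertion (A K : {set chord n}) (r : chord n) (x : chord n * bool) : Prop := Insertion {
  in_r : r \in A;
  in_rA : forall q, q \in points A -> q != (r, false) -> source r < pt q;
  in_rK : forall p, p \in points K -> source r < pt p;
  in_x : x \in points K;
  in_gap : forall p q, p \in points K -> q \in points A -> q != (r, false) ->
    if pt p <= pt x then pt p < pt q else pt q < pt p;
  in_allowed : allowed K (pt x)
}.

Definition nallowed (S : {set chord n}) := #|[set q in points S | allowed S (pt q)]|.
Definition nallowed_from (S : {set chord n}) y :=
  #|[set q in points S | (y <= pt q) && allowed S (pt q)]|.

Variables (A K : {set chord n}) (r : chord n) (x : chord n * bool).
Hypotheses (I : insertion A K r x) (MA : matching A) (MK : matching K).
Let S := A :|: K.

Let rt_ne c b : c != r -> (c, b) != (r, false).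
Proof. by apply: contraNneq => -[->]. Qed.

Let rt_true c : (c, true) != (r, false).
Proof. by rewrite xpair_eqE andbF. Qed.

Lemma in_gap_le p q : p \in points K -> q \in points A -> q != (r, false) ->
  (pt p <= pt x) = (pt p < pt q).
Proof.
move=> pK qA qr; have := in_gap I pK qA qr; case: (leqP (pt p) (pt x)) => _ /= h; rewrite ?h //.
by rewrite ltnNge ltnW.
Qed.

Lemma in_gap_gt p q : p \in points K -> q \in points A -> q != (r, false) ->
  (pt x < pt p) = (pt q < pt p).
Proof.
move=> pK qA qr; have := in_gap I pK qA qr; case: (leqP (pt p) (pt x)) => _ /= h; rewrite ?h //.
by rewrite ltnNge ltnW.
Qed.

Lemma in_neq p q : p \in points K -> q \in points A -> pt p != pt q.
Proof.
move=> pK qA; have [->|qr] := eqVneq q (r, false).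
  by have := in_rK I pK; rewrite neq_ltn orbC => ->.
by have := in_gap I pK qA qr; case: ifP => _; rewrite neq_ltn => ->; rewrite ?orbT.
Qed.

Lemma in_disjoint c : c \in A -> c \in K -> False.
Proof.
move=> cA cK; have := @in_neq (c, true) (c, true); rewrite !in_points => /(_ cK cA).
by rewrite eqxx.
Qed.

Lemma in_matching : matching S.
Proof.
split=> [c|p q]; first by rewrite inE => /orP[/(mt_lt MA)|/(mt_lt MK)].
rewrite !in_points !inE -!in_points => /orP[pA|pK] /orP[qA|qK] E.
- exact: (mt_inj MA).
- by have := in_neq qK pA; rewrite E eqxx.
- by have := in_neq pK qA; rewrite E eqxx.
- exact: (mt_inj MK).
Qed.

Lemma in_root : is_root S r.
Proof.
split=> [|c]; first by rewrite inE (in_r I).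
rewrite inE => /orP[cA|cK].
  have [->//|cr] := eqVneq c r.
  by have := @in_rA _ _ _ _ I (c, false); rewrite in_points => /(_ cA (rt_ne false cr))/ltnW.
by have := @in_rK _ _ _ _ I (c, false); rewrite in_points => /(_ cK)/ltnW.
Qed.

Lemma in_rootA : is_root A r.
Proof.
split=> [|c cA]; first exact: in_r I.
by apply: in_root.2; rewrite inE cA.
Qed.

(** The two endpoints of [c] lie in one gap of [K], so no endpoint of [d] separates them. *)
Lemma in_nocross c d : c \in A -> c != r -> d \in K -> crossing c d = false.
Proof.
move=> cA cr dK; apply/negbTE/negP.
have g := in_gap I _ _ (rt_ne _ cr).
have := g (d, false) false; have := g (d, false) true.
have := g (d, true) false; have := g (d, true) true.
rewrite !in_points /pt /= => /(_ dK cA) h1 /(_ dK cA) h2 /(_ dK cA) h3 /(_ dK cA) h4.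
case/orP=> /and3P[k1 k2 k3].
  case: (leqP (source d) (pt x)) h3 h4 => _ h3 h4.
    by move: k1; rewrite ltnNge ltnW.
  by move: k2; rewrite ltnNge ltnW.
case: (leqP (sink d) (pt x)) h1 h2 => _ h1 h2.
  by move: k2; rewrite ltnNge ltnW.
by move: k3; rewrite ltnNge ltnW.
Qed.

Lemma in_rn_root c d : c \in S -> right_neighbor c r = false.
Proof.
by move=> cS; apply/negbTE; rewrite /right_neighbor ltnNge in_root.2.
Qed.

Lemma in_reachK c e : c \in K -> connect (rn_in S) c e -> e \in K /\ connect (rn_in K) c e.
Proof.
move=> cK /connectP[s]; elim: s c cK => [|d s IH] c cK /= => [_ ->|]; first by rewrite connect0.
case/andP=> /and3P[cS dS cd] ds eE.
have dK : d \in K.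
  move: dS; rewrite inE => /orP[dA|//]; have [dr|dr] := eqVneq d r.
    by move: cd; rewrite dr in_rn_root.
  by have := in_nocross dA dr cK; rewrite /crossing cd orbT.
have [eK de] := IH d dK ds eE; split=> //.
by apply: connect_trans (connect1 _) de; rewrite /rn_in /= cK dK.
Qed.

Lemma in_reachA c e : c \in A -> c != r -> connect (rn_in S) c e ->
  [/\ e \in A, e != r & connect (rn_in A) c e].
Proof.
move=> cA cr /connectP[s]; elim: s c cA cr => [|d s IH] c cA cr /= => [_ ->|].
  by rewrite connect0.
case/andP=> /and3P[cS dS cd] ds eE.
have dr : d != r by apply: contraTneq cd => ->; rewrite in_rn_root.
have dA : d \in A.
  by move: dS; rewrite inE => /orP[//|/(in_nocross cA cr)]; rewrite /crossing cd.
have [eA er de] := IH d dA dr ds eE; split=> //.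
by apply: connect_trans (connect1 _) de; rewrite /rn_in /= cA dA.
Qed.

Lemma escapes_mono (B T : {set chord n}) c z : B \subset T -> escapes B c z -> escapes T c z.
Proof.
move=> /subsetP BT /existsP[d /andP[cd zd]]; apply/existsP; exists d; rewrite zd andbT.
apply: connect_sub cd => u v /and3P[/BT uT /BT vT uv].
by apply: connect1; rewrite /rn_in /= uT vT.
Qed.

Lemma in_escK c z : c \in K -> escapes S c z = escapes K c z.
Proof.
move=> cK; apply/idP/idP; last by apply: escapes_mono; apply: subsetUr.
case/existsP=> d /andP[/(in_reachK cK)[_ cd] zd].
by apply/existsP; exists d; rewrite cd.
Qed.

Lemma in_escA c z : c \in A -> c != r -> escapes S c z = escapes A c z.
Proof.
move=> cA cr; apply/idP/idP; last by apply: escapes_mono; apply: subsetUl.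
case/existsP=> d /andP[/(in_reachA cA cr)[_ _ cd] zd].
by apply/existsP; exists d; rewrite cd.
Qed.

(* All the endpoints of A other than source r lie in one gap of K. *)
Lemma in_openK q c : q \in points A -> q != (r, false) -> c \in K ->
  open S (pt q) c = open K (pt x) c.
Proof.
move=> qA qr cK; rewrite /open inE cK orbT /=.
have cf : (c, false) \in points K by rewrite in_points.
have ct : (c, true) \in points K by rewrite in_points.
rewrite -[source c]/(pt (c, false)) -[sink c]/(pt (c, true)).
rewrite (in_gap_le cf qA qr) (in_gap_gt ct qA qr).
by have := in_neq cf qA; rewrite leq_eqVlt => /negbTE->.
Qed.

(** At its own source the root is the only open chord. *)
Lemma root_allowed (B : {set chord n}) s : matching B -> is_root B s -> allowed B (source s).
Proof.
move=> MB [sB smin]; have os c : open B (source s) c -> c = s.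
  case/and3P=> cB cs _; apply: (source_inj MB cB sB); apply/eqP.
  by rewrite eqn_leq cs smin.
apply/andP; split; first by apply/existsP; exists s; rewrite /open sB leqnn (mt_lt MB).
apply/forallP=> d; apply/forallP=> c; apply/implyP=> /and3P[/os-> /os->].
by rewrite ltnn.
Qed.

(** [sink r] lies in the gap just after [x], and [source r] before all of [K]. *)
Lemma in_cross c : c \in K -> open K (pt x) c = right_neighbor r c.
Proof.
move=> cK; have rA : (r, true) \in points A by rewrite in_points (in_r I).
have cf : (c, false) \in points K by rewrite in_points.
have rc : source r < source c := in_rK I cf.
have <- : open S (pt (r, true)) c = open K (pt x) c by apply: in_openK.
rewrite /open /right_neighbor inE cK orbT rc /=.
have := in_neq cf rA; rewrite /pt /= => /negbTE E.
by rewrite [source c <= _]leq_eqVlt E.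
Qed.

Hypotheses (cA : connected A) (cK : connected K).

Lemma in_connected : connected S.
Proof.
apply: (@connected_from _ _ r) => c; rewrite inE => /orP[cin|cin].
  by apply: crossing_connect_sub (connectedP cA (in_r I) cin); apply: subsetUl.
have /andP[/existsP[d dO] _] := in_allowed I; have /and3P[dK _ _] := dO.
apply: connect_trans (connect1 _) (crossing_connect_sub _ (connectedP cK dK cin)).
  by rewrite /crossing_in /= !inE (in_r I) dK orbT /= /crossing -in_cross // dO.
exact: subsetUr.
Qed.

(** Only a violation whose first chord is [r] could be new. With both other chords in [K] it is
    excluded by [allowed]; with one in each part, by position: the chords of [K] crossed by [r]
    begin before and end after the gap that holds [A]. *)
Lemma in_clean : clean A -> clean K -> clean S.
Proof.
move=> clA clK s d c; rewrite !inE => sS dS cS sd dc cs ssd ssc.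
have AS : A \subset S by apply: subsetUl.
have cr : c != r.
  apply: contraTneq (ltn_trans sd dc) => ->; rewrite -leqNgt; apply: in_root.2.
  by rewrite inE.
have dr : d != r.
  by apply: contraTneq sd => ->; rewrite -leqNgt; apply: in_root.2; rewrite inE.
have rsd : right_neighbor s d by apply/and3P; split=> //; apply: ltn_trans dc cs.
have rsc : right_neighbor s c by apply/and3P; split=> //; apply: ltn_trans sd dc.
have [sr|sr] := eqVneq s r; last first.
  case/orP: sS => sin.
    have dA : d \in A by case/orP: dS => // /(in_nocross sin sr); rewrite /crossing rsd.
    have cA' : c \in A by case/orP: cS => // /(in_nocross sin sr); rewrite /crossing rsc.
    by rewrite in_escA //; apply: (clA s).
  have dK : d \in K.
    by case/orP: dS => // dA; have := in_nocross dA dr sin; rewrite /crossing rsd orbT.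
  have cK' : c \in K.
    by case/orP: cS => // cA'; have := in_nocross cA' cr sin; rewrite /crossing rsc orbT.
  by rewrite in_escK //; apply: (clK s).
subst s; case/orP: dS => din; case/orP: cS => cin.
- by rewrite in_escA //; apply: (clA r) => //; apply: in_r I.
- have oc : open K (pt x) c by rewrite in_cross.
  have := @in_gap_le (c, false) (d, false); rewrite !in_points => /(_ cin din (rt_ne _ dr)).
  have /and3P[_ -> _] := oc; rewrite /pt /= => /esym.
  by rewrite ltnNge ltnW.
- apply/negP => /existsP[e /andP[ce de]].
  have [eA er _] := in_reachA cin cr ce.
  have /and3P[_ _ xd] : open K (pt x) d by rewrite in_cross.
  have := @in_gap_gt (d, true) (e, true); rewrite !in_points => /(_ din eA (rt_ne _ er)).
  by rewrite /pt /= xd => /esym; rewrite ltnNge ltnW.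
- have od : open K (pt x) d by rewrite in_cross.
  have oc : open K (pt x) c by rewrite in_cross.
  rewrite in_escK //.
  by have /andP[_ /forallP/(_ d)/forallP/(_ c)/implyP] := in_allowed I; rewrite od oc; apply.
Qed.

(** Endpoints of [K] up to [x] come to lie under the root; beyond the gap the same chords are open
    as in [K] alone. *)
Lemma in_allowedK q : q \in points K ->
  allowed S (pt q) = (pt x < pt q) && allowed K (pt q).
Proof.
move=> qK; have rA : (r, true) \in points A by rewrite in_points (in_r I).
have qS : q \in points S by rewrite in_points inE -[q.1 \in K]in_points qK orbT.
case: ltnP => xq /=.
  have openE c : open S (pt q) c = open K (pt q) c.
    rewrite /open inE; have [cA'|cN] := boolP (c \in A) => //=.
    have -> : (c \in K) = false by apply/negP => /(in_disjoint cA').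
    have ct : (c, true) \in points A by rewrite in_points.
    have h : sink c < pt q.
      by have := in_gap_gt qK ct (rt_true c); rewrite xq => /esym.
    by rewrite [pt q < _]ltnNge (ltnW h) !andbF.
  rewrite /allowed; congr (_ && _); first by apply: eq_existsb => c; apply: openE.
  apply: eq_forallb => d; apply: eq_forallb => c; rewrite !openE.
  case oc: (open K (pt q) c); rewrite ?andbF //.
  by rewrite in_escK //; case/and3P: oc.
apply/negbTE; apply: (not_allowed_under_root in_connected in_matching in_root) => //.
rewrite (in_rK I) //=.
by have := in_gap_le qK rA (rt_true r); rewrite xq => /esym.
Qed.

Definition last_point q := q \in points A /\ forall p, p \in points A -> pt p <= pt q.

Lemma last_pointP : exists q, last_point q.
Proof.
have rA : (r, true) \in points A by rewrite in_points (in_r I).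
by have [q qA qmax] := arg_maxnP (@pt n) rA; exists q; split=> // p /qmax.
Qed.

Lemma last_not_allowed q : last_point q -> allowed A (pt q) = false.
Proof.
case=> qA qmax; apply/negbTE; rewrite /allowed negb_and; apply/orP; left.
apply/existsPn => c; apply/negP => /and3P[cin _].
have := qmax (c, true); rewrite in_points => /(_ cin).
by rewrite /pt /= leqNgt => /negbTE->.
Qed.

(** Some chord of [K] is open all along the gap, so an open chord always exists there. This affects
    only the last endpoint of [A], at which no chord of [A] is open. Pairs of open chords with one
    in each part never violate the condition. *)
Lemma in_allowedA l q : last_point l -> q \in points A ->
  allowed S (pt q) = allowed A (pt q) || (q == l).
Proof.
move=> lastl qA; have [lA lmax] := lastl.
have AS : A \subset S by apply: subsetUl.
have qS : q \in points S by rewrite in_points inE -[q.1 \in A]in_points qA.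
have [->|qr] := eqVneq q (r, false).
  have -> : pt (r, false) = source r by [].
  by rewrite (root_allowed in_matching in_root) (root_allowed MA in_rootA).
have rq := in_rA I qA qr.
have rA : (r, true) \in points A by rewrite in_points (in_r I).
have [qsr|srq] := ltnP (pt q) (sink r).
  rewrite (negbTE (not_allowed_under_root in_connected in_matching in_root qS _)) ?rq //.
  rewrite (negbTE (not_allowed_under_root cA MA in_rootA qA _)) ?rq //.
  apply/esym/negbTE; apply: contraTneq qsr => ->; rewrite -leqNgt.
  exact: (lmax (r, true)).
have openA c : c \in A -> open S (pt q) c = open A (pt q) c.
  by move=> cin; rewrite /open inE cin.
have rNo c : open A (pt q) c -> c != r.
  by apply: contraTneq => ->; rewrite /open [_ < sink r]ltnNge srq !andbF.
have pairsE : allowed S (pt q) = [forall d, forall c,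
    [&& open A (pt q) d, open A (pt q) c & source d < source c] ==> ~~ escapes A c (sink d)].
  rewrite /allowed.
  have -> : [exists c, open S (pt q) c].
    have /andP[/existsP[d dO] _] := in_allowed I; apply/existsP; exists d.
    by rewrite (in_openK qA) //; case/and3P: dO.
  apply/forallP/forallP => H d; apply/forallP => c; apply/implyP => /and3P[od oc dc].
    have /and3P[dA _ _] := od; have /and3P[cA' _ _] := oc.
    rewrite -in_escA ?(rNo c) //.
    by have /forallP/(_ c)/implyP := H d; rewrite !openA // od oc dc; apply.
  have /and3P[dS _ _] := od; have /and3P[cS _ _] := oc.
  move: dS cS; rewrite !inE => /orP[dA|dK] /orP[cA'|cK'].
  - rewrite !openA // in od oc; rewrite in_escA ?(rNo c) //.
    by have /forallP/(_ c)/implyP := H d; rewrite od oc dc; apply.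
  - rewrite (in_openK qA) // in oc; rewrite openA // in od.
    have /and3P[_ cx _] := oc.
    have := @in_gap_le (c, false) (d, false); rewrite !in_points.
    by move=> /(_ cK' dA (rt_ne _ (rNo d od))); rewrite cx /pt /= => /esym; rewrite ltnNge ltnW.
  - rewrite (in_openK qA) // in od; rewrite openA // in oc.
    have cr := rNo c oc; have /and3P[_ _ xd] := od.
    apply/negP => /existsP[e /andP[/(in_reachA cA' cr)[eA er _] de]].
    have := @in_gap_gt (d, true) (e, true); rewrite !in_points => /(_ dK eA (rt_ne _ er)).
    by rewrite /pt /= xd => /esym; rewrite ltnNge ltnW.
  - rewrite !(in_openK qA) // in od oc; rewrite in_escK //.
    by have /andP[_ /forallP/(_ d)/forallP/(_ c)/implyP] := in_allowed I; rewrite od oc dc; apply.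
have [ql|ql] := eqVneq q l.
  rewrite orbT pairsE; apply/forallP=> d; apply/forallP=> c; apply/implyP=> /and3P[/and3P[dA _]].
  by rewrite ltnNge ql (lmax (d, true)) // in_points.
rewrite orbF pairsE /allowed; set P := (X in X = _ && X); case: P; rewrite ?andbF // andbT.
apply/esym/existsP.
case: l lA {lastl ql} lmax ql => [e be] lA lmax ql.
have eA : e \in A by rewrite in_points in lA.
have se := mt_lt MA eA.
have qe : pt q < sink e.
  have : pt q <= pt (e, true) by apply: leq_trans (lmax _ qA) _; case: be {lA lmax ql}; rewrite /pt //= ltnW.
  rewrite leq_eqVlt => /predU1P[E|//].
  have qE : q = (e, true) by apply: (mt_inj MA qA _ E); rewrite in_points.
  case/eqP: ql; rewrite qE; congr (_, _).
  have : pt (e, true) <= pt (e, be) by apply: lmax; rewrite in_points.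
  by case: (be) => //; rewrite /pt /= leqNgt se.
have [eq|qse] := leqP (source e) (pt q).
  by exists e; rewrite /open eA eq.
have [d dA /andP[d1 d2]] := connected_straddle cA MA (in_r I) srq eA qse.
by exists d; rewrite /open dA d1.
Qed.

(** The gain of [l] and the loss of [x] cancel, which gives the recursion of the width. *)
Lemma in_nallowed : nallowed S = nallowed A + nallowed_from K (pt x).
Proof.
have [l lastl] := last_pointP; have lA := lastl.1.
rewrite /nallowed /nallowed_from.
set aS := [set q in points S | _]; set aA := [set q in points A | _].
set aK := [set q in points K | _].
have xK : x \in aK by rewrite inE (in_x I) leqnn (in_allowed I).
have disj q : q \in points A -> q \in points K -> False.
  by rewrite !in_points; apply: in_disjoint.
have -> : aS = (l |: aA) :|: (aK :\ x).
  apply/setP=> q; rewrite !inE.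
  have [qA|qA] := boolP (q.1 \in A).
    have qN : (q.1 \in K) = false by apply/negP => /(in_disjoint qA).
    by rewrite (in_allowedA lastl) ?in_points // qN /= !andbF orbF orbC.
  have -> : (q == l) = false by apply: contraNF qA => /eqP->; rewrite -in_points.
  have [qK|//] := boolP (q.1 \in K); rewrite /= ?andbF //.
  rewrite in_allowedK ?in_points // ltn_neqAle andbA; congr (_ && _ && _).
  congr (~~ _); apply/eqP/eqP => E; last by rewrite E.
  by apply: (mt_inj MK); rewrite ?in_points // -in_points (in_x I).
rewrite cardsU.
have -> : (l |: aA) :&: (aK :\ x) = set0.
  apply/setP=> q; rewrite !inE; apply/negP => /andP[/orP[/eqP->|/andP[h _]] /and3P[_ h' _]].
    by apply: (disj l) => //; rewrite in_points.
  by apply: (disj q); rewrite in_points.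
rewrite cards0 subn0 cardsU1 inE (last_not_allowed lastl) andbF /= add1n.
by rewrite (cardsD1 x aK) xK addSn addnS.
Qed.

Lemma in_rootK k0 : is_root K k0 -> is_root (S :\ r) k0.
Proof.
case=> kK kmin; split.
  rewrite !inE kK orbT andbT; apply: contraTneq kK => ->.
  by apply/negP; apply: in_disjoint; apply: in_r I.
move=> c; rewrite !inE => /andP[cr /orP[cin|]]; last exact: kmin.
have kx : source k0 <= pt x.
  have := in_x I; rewrite in_points => /[dup] xK /kmin h; apply: leq_trans h _.
  by rewrite /pt; case: (x.2) => //; apply: ltnW; apply: mt_lt MK _ xK.
have := @in_gap_le (k0, false) (c, false); rewrite !in_points => /(_ kK cin (rt_ne _ cr)).
by rewrite /pt /= kx => /esym/ltnW.
Qed.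

Lemma in_component k0 : k0 \in K -> component (S :\ r) k0 = K.
Proof.
move=> kK; apply: component_eq => //.
  apply/subsetP=> c cin; rewrite !inE cin orbT andbT; apply: contraTneq cin => ->.
  by apply/negP; apply: in_disjoint; apply: in_r I.
move=> d e dK; rewrite !inE => /andP[er /orP[eA|//]].
by rewrite crossing_sym (in_nocross eA er dK).
Qed.

Lemma in_t1 : has (terminal K) (intersection_order K) ->
  t1 S = (t1 K).+1 /\ has (terminal S) (intersection_order S).
Proof.
move=> hasK; have /andP[/existsP[d dO] _] := in_allowed I; have /and3P[dK _ _] := dO.
have [k0 kroot] := is_root_exists dK.
apply: (t1_rec in_matching in_root _ (in_rootK kroot) (in_component kroot.1)) => //.
  by rewrite negbK; apply/existsP; exists d; rewrite inE dK orbT -in_cross.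
move=> c cin; congr (~~ _); apply/existsP/existsP => -[e /andP[ein ce]]; exists e; rewrite ce.
  rewrite andbT; move: ein; rewrite inE => /orP[eA|//].
  have [er|er] := eqVneq e r.
    by move: ce; rewrite er in_rn_root // inE cin orbT.
  by have := in_nocross eA er cin; rewrite /crossing ce orbT.
by rewrite inE ein orbT.
Qed.

End Insertion.

(** * The tree of a chord diagram *)

Section Arch.
Variable n : nat.
Implicit Types (c d e r : chord n) (S A K : {set chord n}) (p q x : chord n * bool).

(* K is the component of S minus its root r which contains the second smallest
   source. The endpoints of A = S :\: K other than source r lie in the gap of K
   just after the point x; j is the rank of x, from the right, among the points
   of K after which this may happen. *)
Fixpoint arch t S : Prop :=
  if t is Node l k j then
    exists A K r x, [/\ arch l A, arch k K, insertion A K r x, S = A :|: K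
      & j = nallowed_from K (pt x)]
  else exists2 c, source c < sink c & S = [set c].

Lemma arch_leaf c : source c < sink c ->
  [/\ matching [set c], connected [set c], clean [set c], t1 [set c] = 1
    & has (terminal [set c]) (intersection_order [set c])] /\ nallowed [set c] = 1.
Proof.
move=> cc; have inS d : d \in [set c] -> d = c by move/set1P.
have M : matching [set c].
  split=> [d /inS->//|[d b] [d' b']]; rewrite !in_points => /inS/= -> /inS/= ->.
  case: b; case: b'; rewrite /pt //= => E; by move: cc; rewrite E ltnn.
have root : is_root [set c] c by split=> [|d /inS->]; rewrite ?set11.
have term : terminal [set c] c.
  by apply/existsPn => d; rewrite inE negb_and; case: eqP => //= ->; rewrite /right_neighbor ltnn.
have [s sE] := standard_order_root M root.
have ioE : exists s', intersection_order [set c] = c :: s'.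
  by rewrite /intersection_order cards1 /= sE; eexists.
case: ioE => s' ioE; split; first split=> //.
- apply: (@connected_from _ _ c) => d /inS->; exact: connect0.
- by move=> r d e /inS-> /inS->; rewrite ltnn.
- by rewrite /t1 ioE /= term.
- by rewrite ioE /= term.
rewrite /nallowed (_ : [set q in _ | _] = [set (c, false)]) ?cards1 //.
apply/setP=> -[d b]; rewrite !inE xpair_eqE; have [->|//] := eqVneq d c.
rewrite /=; case: b => /=.
  apply/negbTE; rewrite negb_and; apply/orP; left; apply/existsPn => e.
  by rewrite /open inE; case: eqP => //= ->; rewrite /pt /= ltnn andbF.
rewrite -[pt _]/(source c); exact: root_allowed M root.
Qed.

Lemma nallowed_from_gt0 K x : x \in points K -> allowed K (pt x) -> 0 < nallowed_from K (pt x).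
Proof. by move=> xK ax; apply/card_gt0P; exists x; rewrite inE xK leqnn. Qed.

Lemma nallowed_from_le K y : nallowed_from K y <= nallowed K.
Proof.
by apply: subset_leq_card; apply/subsetP=> q; rewrite !inE => /and3P[-> _ ->].
Qed.

Lemma arch_sound t S : arch t S ->
  [/\ matching S, connected S, clean S, t1 S = spine t
    & has (terminal S) (intersection_order S)]
  /\ [/\ nallowed S = width t, #|S| = leaves t & valid_tree t].
Proof.
elim: t S => [|l IHl k IHk j] S /=.
  move=> [c cc ->]; have [[M C cl tt ht] na] := arch_leaf cc.
  by split; split=> //; rewrite cards1.
move=> [A [K [r [x [/IHl[[MA CA clA tA htA] [naA sA vA]]
  /IHk[[MK CK clK tK htK] [naK sK vK]] I -> ->]]]]].
have [t1E hasE] := in_t1 I MA MK CK htK.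
split; split=> //.
- exact: in_matching I MA MK.
- exact: (in_connected I CA CK).
- exact: (in_clean I).
- by rewrite t1E tK.
- by rewrite (in_nallowed I) // naA.
- rewrite cardsU (_ : A :&: K = set0) ?cards0 ?subn0 ?sA ?sK //.
  apply/setP=> c; rewrite !inE; apply/negP => /andP[]; exact: (in_disjoint I).
- rewrite vA vK /= -naK nallowed_from_le andbT.
  by apply: nallowed_from_gt0; [apply: in_x I|apply: in_allowed I].
Qed.

Lemma clean_sub A S : A \subset S -> clean S -> clean A.
Proof.
move=> AS cl r d c rA dA cA h1 h2 h3 h4 h5.
apply: contra (cl r d c _ _ _ h1 h2 h3 h4 h5); try exact: (subsetP AS).
exact: escapes_mono.
Qed.

Lemma component_connected S c : c \in S -> connected (component S c).
Proof.
move=> cS; apply: (@connected_from _ _ c) => d; rewrite inE => /andP[_ cd].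
have closed e : connect (crossing_in S) c e -> e \in component S c \/ e = c.
  case/connectP=> s; elim/last_ind: s e => [|s f IH] e /=; first by move=> _ ->; right.
  rewrite rcons_path last_rcons => /andP[ps X] ->; left.
  rewrite inE; case/and3P: (X) => _ -> _; apply: connect_trans (connect1 X).
  by apply/connectP; exists s.
have cC : c \in component S c by rewrite inE cS connect0.
have mem e : connect (crossing_in S) c e -> e \in component S c.
  by move/closed => [|->].
case/connectP: cd => s; elim/last_ind: s d => [|s f IH] d /=; first by move=> _ ->; apply: connect0.
rewrite rcons_path last_rcons => /andP[ps X] ->.
have cl : connect (crossing_in S) c (last c s) by apply/connectP; exists s.
apply: connect_trans (IH _ ps erefl) (connect1 _).
case/and3P: (X) => _ _ xx; rewrite /crossing_in /= (mem _ cl) (mem _ (connect_trans cl (connect1 X))).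
exact: xx.
Qed.

Lemma root_points S r q : matching S -> is_root S r -> q \in points S -> q != (r, false) ->
  source r < pt q.
Proof.
move=> MS [rS rmin]; case: q => c b; rewrite in_points /= => cS qr.
have h : source r <= pt (c, b).
  by apply: leq_trans (rmin c cS) _; case: b {qr}; rewrite /pt //= ltnW ?(mt_lt MS).
rewrite ltn_neqAle h andbT; apply: contra qr => /eqP E; apply/eqP/esym.
by apply: (mt_inj MS) => //; rewrite in_points.
Qed.

(** * Taking a connected clean diagram apart *)

Section Decompose.
Variables (S : {set chord n}) (r k0 : chord n).
Hypotheses (MS : matching S) (CS : connected S) (clS : clean S).
Hypotheses (rootS : is_root S r) (root0 : is_root (S :\ r) k0).
Let K := component (S :\ r) k0.
Let A := S :\: K.

Let k0K : k0 \in K. Proof. by rewrite inE root0.1 connect0. Qed.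
Let KS : K \subset S :\ r. Proof. exact: component_sub. Qed.
Let inKS c : c \in K -> c \in S /\ c != r.
Proof. by move/(subsetP KS); rewrite !inE => /andP[]. Qed.

Let closedK d e : d \in K -> e \in S -> e != r -> crossing d e -> e \in K.
Proof.
rewrite !inE => /andP[dS kd] eS er X; rewrite eS er; apply: connect_trans kd (connect1 _).
by rewrite /crossing_in /= !inE dS er eS.
Qed.

Let rA : r \in A.
Proof. by rewrite inE rootS.1 andbT; apply/negP => /inKS[_]; rewrite eqxx. Qed.

Let inAS c : c \in A -> c \in S /\ c \notin K.
Proof. by rewrite inE => /andP[]. Qed.

Let ltS := mt_lt MS.

Let cK : connected K.
Proof. exact: component_connected root0.1. Qed.

(** A path in [S] from a chord of [A] can enter [K] only through [r], and by then it has reached its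
    goal. *)
Let cA : connected A.
Proof.
apply: (@connected_from _ _ r) => c cA; rewrite crossing_connect_sym.
have [//|ncr] := boolP (connect (crossing_in A) c r).
have [cS cNK] := inAS cA.
suff [_ H] : r \in A /\ connect (crossing_in A) c r by rewrite H in ncr.
apply: (connected_ind (P := fun d => d \in A /\ connect (crossing_in A) c d) CS cS).
- by split; rewrite ?connect0.
- move=> d d' dS d'S [dA cd] X.
  have dr : d != r by apply: contraNneq ncr => <-.
  have d'A : d' \in A.
    rewrite inE d'S andbT; apply/negP => d'K; have [_ /negP] := inAS dA; apply.
    by rewrite crossing_sym in X; apply: closedK d'K dS dr X.
  split=> //; apply: connect_trans cd (connect1 _).
  by rewrite /crossing_in /= dA d'A.
- exact: rootS.1.
Qed.

Let nocross c d : c \in A -> c != r -> d \in K -> crossing d c = false.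
Proof.
move=> cA' cr dK; apply/negbTE/negP => X; have [cS /negP] := inAS cA'; apply.
exact: closedK dK cS cr X.
Qed.

(** [S] being connected, [K] can be left, and only through [r]. *)
Let crossK : exists2 d, d \in K & right_neighbor r d.
Proof.
have [/existsP[d /andP[dK X]]|H] := boolP [exists d, (d \in K) && crossing r d].
  exists d => //; case/orP: X => // /and3P[h _ _].
  by have [dS _] := inKS dK; move: h; rewrite ltnNge rootS.2.
have [k0S _] := inKS k0K.
suff : r \in K by move/inKS => []; rewrite eqxx.
apply: (connected_ind (P := fun d => d \in K) CS k0S k0K); last exact: rootS.1.
move=> d d' dS d'S dK X; have [E|d'r] := eqVneq d' r.
  by case/negP: H; apply/existsP; exists d; rewrite dK crossing_sym -E.
exact: closedK dK d'S d'r X.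
Qed.

Let neqAK p q : p \in points K -> q \in points A -> pt p != pt q.
Proof.
rewrite !in_points => pK qA; have [pS _] := inKS pK; have [qS qK] := inAS qA.
apply/eqP => E; case/negP: qK; rewrite -(_ : p = q) //.
by apply: (mt_inj MS); rewrite ?in_points.
Qed.

(** [K] starts before [d], is connected and crosses [d] nowhere, so none of its chords lies inside
    [d]. *)
Let unnested d p : d \in A -> d != r -> p \in points K ->
  (pt p < source d) = (pt p < sink d).
Proof.
move=> dA dr; case: p => c b; rewrite in_points /= => cin.
have [dS dNK] := inAS dA.
(* The three possible positions of [c]: before, after or around [d]. *)
pose P c := [|| sink c < source d, sink d < source c | (source c < source d) && (sink d < sink c)].
suff H : P c.
  have lc := ltS (inKS cin).1; have ld := ltS dS.
  case: b; rewrite /pt /=; case/or3P: H => [h|h|/andP[h1 h2]].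
  - by rewrite h (ltn_trans h ld).
  - have h1 := ltn_trans h lc; have h2 := ltn_trans ld h1.
    by rewrite ![sink c < _]ltnNge (ltnW h1) (ltnW h2).
  - by rewrite ![sink c < _]ltnNge (ltnW h2) (ltnW (ltn_trans ld h2)).
  - by rewrite (ltn_trans lc h) (ltn_trans (ltn_trans lc h) ld).
  - by rewrite ![source c < _]ltnNge (ltnW h) (ltnW (ltn_trans ld h)).
  - by rewrite h1 (ltn_trans h1 ld).
have k0d : source k0 < source d.
  have [k0S k0r] := inKS k0K.
  rewrite ltn_neqAle root0.2 ?inE ?dr // andbT; apply: contraNneq dNK => E.
  by rewrite -(source_inj MS k0S dS E).
apply: (connected_ind (P := P) cK k0K) cin.
  rewrite /P k0d /=; have := nocross dA dr k0K.
  have := @neqAK (k0, true) (d, false); rewrite !in_points /pt /= => /(_ k0K dA).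
  have := @neqAK (k0, true) (d, true); rewrite !in_points /pt /= => /(_ k0K dA).
  rewrite /crossing /right_neighbor k0d /=.
  case: (ltngtP (sink k0) (source d)) => //= h; case: (ltngtP (sink k0) (sink d)) => //= h' _ _.
  by rewrite orbT.
move=> u v uK vK Pu X; rewrite /P; have := nocross dA dr vK.
have lu := ltS (inKS uK).1; have lv := ltS (inKS vK).1; have ld := ltS dS.
have := @neqAK (v, true) (d, false); rewrite !in_points /pt /= => /(_ vK dA).
have := @neqAK (v, true) (d, true); rewrite !in_points /pt /= => /(_ vK dA).
have := @neqAK (v, false) (d, false); rewrite !in_points /pt /= => /(_ vK dA).
have := @neqAK (v, false) (d, true); rewrite !in_points /pt /= => /(_ vK dA).
have out : ~ (source d < source v /\ sink v < sink d).
  case=> h1 h2; case/or3P: Pu => [h|h|/andP[h h']].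
  - by have := crossing_overlap X; rewrite ltnNge (ltnW (ltn_trans h h1)).
  - rewrite crossing_sym in X; have := crossing_overlap X.
    by rewrite ltnNge (ltnW (ltn_trans h2 h)).
  - rewrite crossing_sym in X; apply: (crossing_nested X); apply: ltnW.
      exact: ltn_trans h h1.
    exact: ltn_trans h2 h'.
rewrite /crossing /right_neighbor.
case: (ltngtP (sink v) (source d)) => //= h1.
case: (ltngtP (sink d) (source v)) => //= h2.
case: (ltngtP (source v) (source d)) => //= h3; case: (ltngtP (sink d) (sink v)) => //= h4.
by case: out.
Qed.

(** Starting from [sink r] and passing from chord to crossing chord, [A] stays in one gap, since its
    chords other than [r] enclose no endpoint of [K]. *)
Let gap q p : q \in points A -> q != (r, false) -> p \in points K ->
  (pt p < pt q) = (pt p < sink r).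
Proof.
move=> qA qr pK.
have H d : d \in A -> (pt p < sink d) = (pt p < sink r).
  move=> dA; apply: (connected_ind (P := fun d => (pt p < sink d) = (pt p < sink r)) cA rA) dA => //.
  move=> u v uA vA Pu X; have [->//|vr] := eqVneq v r.
  have [E|ur] := eqVneq u r.
    subst u; case/orP: X => /and3P[h1 h2 h3]; last first.
      by have [vS _] := inAS vA; move: h1; rewrite ltnNge rootS.2.
    apply/idP/idP => [|h]; last exact: ltn_trans h h3.
    by rewrite -(unnested vA vr pK) => h; apply: ltn_trans h h2.
  rewrite -Pu -(unnested vA vr pK); have o1 := crossing_overlap X.
  rewrite crossing_sym in X; have o2 := crossing_overlap X.
  apply/idP/idP => h; first exact: ltn_trans h o1.
  rewrite (unnested vA vr pK); apply: ltn_trans o2.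
  by rewrite (unnested uA ur pK).
case: q qA qr => d [] dA dr; rewrite in_points /= in dA; first exact: H.
rewrite -(H d dA) /pt /=; apply: unnested => //.
by apply: contraNneq dr => ->.
Qed.

(** [x] is the last endpoint of [K] before [sink r]. The chords of [K] open there are those that [r]
    crosses, so [clean] for [r] yields [allowed] at [x]. *)
Lemma decompose : exists x, [/\ insertion A K r x, S = A :|: K, matching A /\ matching K,
   connected A /\ connected K & [/\ clean A, clean K, #|A| < #|S| & #|K| < #|S|]].
Proof.
have [d dK /and3P[rd dr rd']] := crossK.
have dP : ((d, false) \in points K) && (pt (d, false) < sink r) by rewrite in_points dK.
have [x /andP[xK xr] xmax] := @arg_maxnP _ _
   (fun p => (p \in points K) && (pt p < sink r)) (@pt n) dP.
have KS' : K \subset S by apply/subsetP=> c /inKS[].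
have AS : A \subset S by apply: subsetDl.
have leE p : p \in points K -> (pt p <= pt x) = (pt p < sink r).
  move=> pK; apply/idP/idP => h; first exact: leq_ltn_trans h xr.
  by apply: (xmax p); rewrite pK.
exists x; split.
- split=> //.
  + move=> q; rewrite in_points => qA; apply: (root_points MS rootS) => //.
    by rewrite in_points; have [] := inAS qA.
  + move=> p; rewrite in_points => pK; apply: (root_points MS rootS) => //.
      by rewrite in_points; have [] := inKS pK.
    by apply: contraTneq pK => ->; apply/negP => /inKS[]; rewrite eqxx.
  + move=> p q pK qA qr; rewrite leE // -(gap qA qr pK).
    by case: ltngtP (neqAK pK qA).
  + apply/andP; split.
      apply/existsP; exists d; rewrite /open dK.
      have := leE (d, false); rewrite in_points => /(_ dK); rewrite {1}/pt /= => ->.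
      by rewrite dr (ltn_trans xr rd').
    apply/forallP=> u; apply/forallP=> v; apply/implyP=> /and3P[/and3P[uK ux xu] /and3P[vK vx xv] uv].
    have [uS ur] := inKS uK; have [vS vr] := inKS vK.
    have sinkr w : w \in K -> pt x < sink w -> sink r < sink w.
      move=> wK xw; have := leE (w, true); rewrite in_points => /(_ wK).
      rewrite {1 2}/pt /= leqNgt xw /= => /esym/negbT; rewrite -leqNgt leq_eqVlt.
      by move=> /predU1P[E|//]; have := neqAK (p := (w, true)) (q := (r, true));
         rewrite !in_points => /(_ wK rA); rewrite /pt /= E eqxx.
    apply: contra (clS rootS.1 uS vS _ uv (leq_ltn_trans vx xr) (sinkr _ uK xu) (sinkr _ vK xv)).
      exact: escapes_mono.
    have := @root_points S r (u, false) MS rootS; rewrite in_points => /(_ uS); apply.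
    by apply: contraNneq ur => -[->].
- by rewrite setUC -{1}(setIidPr KS') setID.
- by split; [apply: matching_sub AS MS|apply: matching_sub KS' MS].
- by [].
split; [exact: clean_sub AS clS|exact: clean_sub KS' clS| |].
  apply: proper_card; rewrite properE AS; apply/subsetPn; exists k0; first exact: (inKS k0K).1.
  by rewrite inE k0K.
apply: proper_card; rewrite properE KS'; apply/subsetPn; exists r; first exact: rootS.1.
by apply/negP => /inKS[]; rewrite eqxx.
Qed.
End Decompose.

Lemma arch_exists S : matching S -> connected S -> clean S -> 0 < #|S| -> exists t, arch t S.
Proof.
have [k] := ubnP #|S|; elim: k S => // k IH S Sk MS CS clS /card_gt0P[c cS].
have [r rootS] := is_root_exists cS.
have [E|/set0Pn[d dS]] := eqVneq (S :\ r) set0.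
  exists Leaf, r; first exact: mt_lt MS _ rootS.1.
  by rewrite -(setD1K rootS.1) E setU0.
have [k0 root0] := is_root_exists dS.
have [x [I SE [MA MK] [CA CK] [clA clK cardA cardK]]] := decompose MS CS clS rootS root0.
set K := component _ _ in I SE MK CK clK cardK MA CA clA cardA.
set A := S :\: K in I SE MA CA clA cardA.
have A0 : 0 < #|A| by apply/card_gt0P; exists r; apply: in_r I.
have K0 : 0 < #|K|.
  by apply/card_gt0P; exists x.1; have := in_x I; rewrite in_points.
have [t1 a1] := IH A (leq_trans cardA Sk) MA CA clA A0.
have [t2 a2] := IH K (leq_trans cardK Sk) MK CK clK K0.
by exists (Node t1 t2 (nallowed_from K (pt x))), A, K, r, x.
Qed.

Lemma is_root_uniq S u v : matching S -> is_root S u -> is_root S v -> u = v.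
Proof.
move=> MS [uS um] [vS vm]; apply: (source_inj MS) => //; apply/eqP.
by rewrite eqn_leq um // vm.
Qed.

(** The data of a node can be read off: [r] has the least source, [K] is the component of the next
    one, and [x] is the last endpoint of [K] before the sink of [r]. *)
Lemma arch_det t t' S : arch t S -> arch t' S -> t = t'.
Proof.
elim: t t' S => [|l IHl k IHk j] [|l' k' j'] S.
- by [].
- move=> /arch_sound[_ [_ c1 _]] /arch_sound[_ [_ c2 _]].
  by move: c2; rewrite c1 /=; have := leaves_gt0 l'; have := leaves_gt0 k'; lia.
- move=> /arch_sound[_ [_ c1 _]] /arch_sound[_ [_ c2 _]].
  by move: c2; rewrite c1 /=; have := leaves_gt0 l; have := leaves_gt0 k; lia.
move=> a a'; have [[MS _ _ _ _] _] := arch_sound a.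
move: a a' => /= [A [K [r [x [aA aK I SE ->]]]]] [A' [K' [r' [x' [aA' aK' I' SE' ->]]]]].
have [[MA CA _ _ _] _] := arch_sound aA; have [[MK CK _ _ _] _] := arch_sound aK.
have [[MA' CA' _ _ _] _] := arch_sound aA'; have [[MK' CK' _ _ _] _] := arch_sound aK'.
have rS := in_root I; have rS' := in_root I'.
rewrite -SE in rS; rewrite -SE' in rS'.
have rE := is_root_uniq MS rS rS'; subst r'.
have xK := in_x I; have xK' := in_x I'; rewrite in_points in xK; rewrite in_points in xK'.
have [k0 rk0] := is_root_exists xK; have [k0' rk0'] := is_root_exists xK'.
have R := in_rootK I MK rk0; have R' := in_rootK I' MK' rk0'.
rewrite -SE in R; rewrite -SE' in R'.
have MS' : matching (S :\ r) by apply: matching_sub MS; apply: subD1set.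
have k0E := is_root_uniq MS' R R'; subst k0'.
have KE : K = K'.
  by rewrite -(in_component I CK rk0.1) -(in_component I' CK' rk0'.1) -SE -SE'.
subst K'.
have AE : A = A'.
  have disj B y : insertion B K r y -> B = (B :|: K) :\: K.
    move=> J; apply/setP=> c; rewrite !inE.
    by have [cK|_] := boolP (c \in K); rewrite ?orbF //=; apply/negP => /(in_disjoint J); apply.
  by rewrite (disj _ _ I) (disj _ _ I') -SE -SE'.
subst A'.
have rt : (r, true) \in points A by rewrite in_points (in_r I).
have rtn : (r, true) != (r, false) by rewrite xpair_eqE andbF.
have xE : pt x = pt x'.
  apply/eqP; rewrite eqn_leq (in_gap_le I' (in_x I) rt rtn) (in_gap_le I (in_x I') rt rtn).
  by rewrite -(in_gap_le I (in_x I) rt rtn) -(in_gap_le I' (in_x I') rt rtn) !leqnn.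
by rewrite (IHl _ _ aA aA') (IHk _ _ aK aK') xE.
Qed.

End Arch.

(** * Order isomorphisms of diagrams *)

Section OrderIso.
Variable n : nat.
Implicit Types (c d e r : chord n) (S A K : {set chord n}) (p q x : chord n * bool).
Implicit Types (g : chord n -> chord n).

Definition lift_chord g q : chord n * bool := (g q.1, q.2).

Record order_iso S S' g : Prop := OrderIso {
  oi_image : S' = [set g c | c in S];
  oi_lt : forall p q, p \in points S -> q \in points S ->
    (pt (lift_chord g p) < pt (lift_chord g q)) = (pt p < pt q)
}.

Section Transport.
Variables (S S' : {set chord n}) (g : chord n -> chord n).
Hypotheses (I : order_iso S S' g) (M : matching S).

Lemma oi_le p q : p \in points S -> q \in points S ->
  (pt (lift_chord g p) <= pt (lift_chord g q)) = (pt p <= pt q).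
Proof. by move=> pS qS; rewrite leqNgt (oi_lt I) // -leqNgt. Qed.

Lemma oi_in c : c \in S -> g c \in S'.
Proof. by move=> cS; rewrite (oi_image I) imset_f. Qed.

Lemma oi_points q : q \in points S -> lift_chord g q \in points S'.
Proof. by rewrite !in_points; apply: oi_in. Qed.

Lemma oi_inv c' : c' \in S' -> exists2 c, c \in S & c' = g c.
Proof. by rewrite (oi_image I) => /imsetP. Qed.

Lemma oi_inj : {in S &, injective g}.
Proof.
move=> c d cS dS E; apply: (source_inj M cS dS); apply/eqP.
have cP : (c, false) \in points S by rewrite in_points.
have dP : (d, false) \in points S by rewrite in_points.
rewrite eqn_leq; have := oi_le cP dP; have := oi_le dP cP.
by rewrite /lift_chord /pt /= E !leqnn => <- <-.
Qed.

Lemma oi_src_lt c d : c \in S -> d \in S -> (source (g c) < source (g d)) = (source c < source d).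
Proof.
move=> cS dS; have := oi_lt I (p := (c, false)) (q := (d, false)).
by rewrite !in_points; apply.
Qed.

Lemma oi_snk_lt c d : c \in S -> d \in S -> (sink (g c) < sink (g d)) = (sink c < sink d).
Proof.
move=> cS dS; have := oi_lt I (p := (c, true)) (q := (d, true)).
by rewrite !in_points; apply.
Qed.

Lemma oi_rn c d : c \in S -> d \in S -> right_neighbor (g c) (g d) = right_neighbor c d.
Proof.
move=> cS dS; rewrite /right_neighbor oi_src_lt // oi_snk_lt //.
have := oi_lt I (p := (d, false)) (q := (c, true)); rewrite !in_points => /(_ dS cS).
by rewrite /lift_chord /pt /= => ->.
Qed.

Lemma oi_reach c d : connect (rn_in S) c d -> connect (rn_in S') (g c) (g d).
Proof.
case/connectP=> s; elim: s c => [|x s IH] c /= => [_ ->|]; first exact: connect0.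
case/andP=> /and3P[cS xS cx] ps dE; apply: connect_trans (connect1 _) (IH x ps dE).
by rewrite /rn_in /= !oi_in // oi_rn.
Qed.

Lemma oi_reach_inv c d' : c \in S -> connect (rn_in S') (g c) d' ->
  exists2 d, d' = g d & connect (rn_in S) c d.
Proof.
move=> cS /connectP[s]; elim: s c cS => [|x s IH] c cS /= => [_ ->|].
  by exists c; rewrite ?connect0.
case/andP=> /and3P[_ xS' cx] ps dE; have [x0 xS xE] := oi_inv xS'; subst x.
have [d dE' xd] := IH x0 xS ps dE; exists d => //.
apply: connect_trans (connect1 _) xd; rewrite /rn_in /= cS xS /=.
by rewrite oi_rn in cx.
Qed.

Lemma oi_escapes c d : c \in S -> d \in S ->
  escapes S' (g c) (sink (g d)) = escapes S c (sink d).
Proof.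
move=> cS dS; apply/existsP/existsP => [[e' /andP[/(oi_reach_inv cS)[e -> ce] de]]|[e /andP[ce de]]].
  by exists e; rewrite ce /=; rewrite oi_snk_lt // in de; apply: rn_reach_in ce cS.
by exists (g e); rewrite oi_reach //= oi_snk_lt //; apply: rn_reach_in ce cS.
Qed.

Lemma oi_open q c : q \in points S -> c \in S ->
  open S' (pt (lift_chord g q)) (g c) = open S (pt q) c.
Proof.
move=> qS cS; rewrite /open oi_in // cS /=.
have cf : (c, false) \in points S by rewrite in_points.
have ct : (c, true) \in points S by rewrite in_points.
by have := oi_le cf qS; have := oi_lt I qS ct; rewrite /lift_chord /pt /= => -> ->.
Qed.

Lemma oi_allowed q : q \in points S -> allowed S' (pt (lift_chord g q)) = allowed S (pt q).
Proof.
move=> qS; rewrite /allowed; congr (_ && _).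
  apply/existsP/existsP => [[c' cO]|[c cO]].
    have /and3P[/oi_inv[c cS cE] _ _] := cO; subst c'.
    by exists c; rewrite oi_open in cO.
  by exists (g c); rewrite oi_open //; case/and3P: cO.
apply/forallP/forallP => H d; apply/forallP=> c; apply/implyP=> /and3P[dO cO dc].
  have /and3P[dS _ _] := dO; have /and3P[cS _ _] := cO.
  have /forallP/(_ (g c))/implyP := H (g d); rewrite !oi_open // dO cO oi_src_lt // dc => /(_ isT).
  by rewrite oi_escapes.
have /and3P[/oi_inv[d0 dS dE] _ _] := dO; have /and3P[/oi_inv[c0 cS cE] _ _] := cO.
subst d c; rewrite !oi_open // in dO cO; rewrite oi_src_lt // in dc.
by have /forallP/(_ c0)/implyP := H d0; rewrite dO cO dc => /(_ isT); rewrite oi_escapes.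
Qed.

Lemma oi_nallowed_from q : q \in points S ->
  nallowed_from S' (pt (lift_chord g q)) = nallowed_from S (pt q).
Proof.
move=> qS; rewrite /nallowed_from.
have -> : [set p in points S' | (pt (lift_chord g q) <= pt p) && allowed S' (pt p)] =
    [set lift_chord g p | p in [set p in points S | (pt q <= pt p) && allowed S (pt p)]].
  apply/setP=> p'; rewrite !inE; apply/idP/imsetP => [/and3P[p'S qp ap]|[p]].
    have [c cS cE] := oi_inv p'S.
    have p'E : p' = lift_chord g (c, p'.2) by rewrite /lift_chord -cE; case: (p').
    have pS : (c, p'.2) \in points S by rewrite in_points.
    exists (c, p'.2) => //; rewrite !inE cS.
    rewrite p'E in qp ap.
    by rewrite oi_le // in qp; rewrite oi_allowed // in ap; rewrite qp.
  rewrite !inE => /and3P[pS qp ap] ->; have pS' : p \in points S by rewrite in_points.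
  by rewrite oi_in // oi_le // oi_allowed // qp.
apply: card_in_imset => p p'; rewrite !inE => /and3P[pS _ _] /and3P[p'S _ _].
by case: p p' pS p'S => [c b] [c' b'] /= cS cS' [/oi_inj -> // ->].
Qed.

Lemma oi_root r : is_root S r -> is_root S' (g r).
Proof.
case=> rS rmin; split; first exact: oi_in.
by move=> c' /oi_inv[c cS ->]; rewrite leqNgt oi_src_lt // -leqNgt rmin.
Qed.

End Transport.

(** The count drops strictly from one allowed endpoint to the next. *)
Lemma nallowed_from_inj K p q : matching K -> p \in points K -> q \in points K ->
  allowed K (pt p) -> allowed K (pt q) -> nallowed_from K (pt p) = nallowed_from K (pt q) -> p = q.
Proof.
move=> MK.
have lt (u v : chord n * bool) : u \in points K -> allowed K (pt u) -> pt u < pt v ->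
    nallowed_from K (pt v) < nallowed_from K (pt u).
  move=> uK au uv; apply: proper_card; rewrite properE; apply/andP; split.
    by apply/subsetP=> w; rewrite !inE => /and3P[-> h ->]; rewrite (leq_trans (ltnW uv) h).
  by apply/subsetPn; exists u; rewrite !inE -?in_points ?uK ?leqnn ?au //= leqNgt uv.
move=> pK qK ap aq E; apply: (mt_inj MK pK qK).
case: (ltngtP (pt p) (pt q)) => // h.
  by have := lt _ _ pK ap h; rewrite E ltnn.
by have := lt _ _ qK aq h; rewrite E ltnn.
Qed.

Lemma arch_iso t S S' : arch t S -> arch t S' -> exists g, order_iso S S' g.
Proof.
elim: t S S' => [|l IHl k IHk j] S S' /=.
  move=> [c cc ->] [c' cc' ->]; exists (fun=> c'); split; first by rewrite imset_set1.
  case=> [d b] [d' b']; rewrite !in_points /= !inE => /eqP-> /eqP->.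
  by case: b; case: b'; rewrite /lift_chord /pt /= ?ltnn ?cc ?cc' // ltnNge ltnW // ltnNge ltnW.
move=> [A [K [r [x [aA aK I SE jE]]]]] [A' [K' [r' [x' [aA' aK' I' SE' jE']]]]].
have [[MA _ _ _ _] _] := arch_sound aA; have [[MK _ _ _ _] _] := arch_sound aK.
have [[MA' _ _ _ _] _] := arch_sound aA'; have [[MK' _ _ _ _] _] := arch_sound aK'.
have [gA IA] := IHl _ _ aA aA'; have [gK IK] := IHk _ _ aK aK'.
have rE : gA r = r'.
  have h : is_root A' (gA r) := oi_root IA (in_rootA I).
  exact: is_root_uniq MA' h (in_rootA I').
have xK := in_x I; have xK' := in_x I'.
(* Both have rank [j] from the right among the allowed endpoints, so [gK] matches the two gaps. *)
have xE : lift_chord gK x = x'.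
  have ax : allowed K' (pt (lift_chord gK x)) by rewrite (oi_allowed IK xK) (in_allowed I).
  have E : nallowed_from K' (pt (lift_chord gK x)) = nallowed_from K' (pt x').
    by rewrite (oi_nallowed_from IK MK xK) -jE jE'.
  exact: (nallowed_from_inj MK' (oi_points IK xK) xK' ax (in_allowed I') E).
pose g c := if c \in K then gK c else gA c; exists g.
have gKE q : q \in points K -> lift_chord g q = lift_chord gK q.
  by rewrite in_points /lift_chord /g => ->.
have gAE q : q \in points A -> lift_chord g q = lift_chord gA q.
  rewrite in_points /lift_chord /g => qA.
  by have [/(in_disjoint I qA)|//] := boolP (q.1 \in K).
have gA_r q : q \in points A -> (lift_chord gA q == (r', false)) = (q == (r, false)).
  move=> qA; rewrite -rE; apply/eqP/eqP => [|->//].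
  case: q qA => [c b]; rewrite in_points /lift_chord /= => cA [E ->].
  by rewrite (oi_inj IA MA cA (in_r I) E).
split.
  rewrite SE SE' (oi_image IA) (oi_image IK) imsetU; congr (_ :|: _); apply: eq_in_imset => c cin.
    by rewrite /g; have [/(in_disjoint I cin)|] := boolP (c \in K).
  by rewrite /g cin.
have cross p q : p \in points K -> q \in points A ->
  (pt (lift_chord g p) < pt (lift_chord g q)) = (pt p < pt q) /\
  (pt (lift_chord g q) < pt (lift_chord g p)) = (pt q < pt p).
  move=> pK qA; rewrite gKE // gAE //.
  have pK' := oi_points IK pK; have qA' := oi_points IA qA.
  have [qr|qr] := eqVneq q (r, false).
    have q'r : lift_chord gA q = (r', false) by apply/eqP; rewrite gA_r // qr.
    rewrite q'r qr; have h := in_rK I pK; have h' := in_rK I' pK'.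
    rewrite -[pt (r, false)]/(source r) -[pt (r', false)]/(source r') in h h' *.
    by rewrite h h' [X in X = _ /\ _]ltnNge (ltnW h') [X in _ = X /\ _]ltnNge (ltnW h).
  have qr' : lift_chord gA q != (r', false) by rewrite gA_r.
  rewrite -(in_gap_le I pK qA qr) -(in_gap_le I' pK' qA' qr').
  rewrite -(in_gap_gt I pK qA qr) -(in_gap_gt I' pK' qA' qr') -xE.
  by rewrite (oi_le IK) // (oi_lt IK).
move=> p q; rewrite SE !in_points !inE -!in_points => /orP[pA|pK] /orP[qA|qK].
- by rewrite !gAE // (oi_lt IA).
- by have [] := cross q p qK pA.
- by have [] := cross p q pK qA.
- by rewrite !gKE // (oi_lt IK).
Qed.

Lemma full_rank S q : matching S -> (forall y : 'I_(2 * n), exists2 p, p \in points S & pt p = y) ->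
  q \in points S -> #|[set p in points S | pt p < pt q]| = pt q.
Proof.
move=> MS full qS.
have ptlt p : pt p < 2 * n by case: p => c [] /=; apply: ltn_ord.
pose f p := Ordinal (ptlt p).
rewrite -(card_in_imset (f := f)); last first.
  move=> p p'; rewrite !inE -!in_points => /andP[pS _] /andP[p'S _] /(congr1 val) /=.
  exact: (mt_inj MS).
have -> : [set f p | p in [set p in points S | pt p < pt q]] = [set y : 'I_(2 * n) | y < pt q].
  apply/setP=> y; rewrite inE; apply/imsetP/idP => [[p]|yq].
    by rewrite !inE => /andP[_ h] ->.
  have [p pS pE] := full y; exists p; first by rewrite !inE -in_points pS pE.
  by apply: val_inj.
have q2 := ptlt q.
have -> : [set y : 'I_(2 * n) | y < pt q] = [set widen_ord (ltnW q2) z | z in 'I_(pt q)].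
  apply/setP=> y; rewrite inE; apply/idP/imsetP => [yq|[z _ ->]]; last by rewrite /= ltn_ord.
  by exists (Ordinal yq) => //; apply: val_inj.
rewrite card_imset ?card_ord // => z z' /(congr1 val) /= E; exact: val_inj.
Qed.

(** When all positions are occupied, a position is its own rank, and [g] preserves ranks. *)
Lemma full_iso_eq S S' g : matching S -> matching S' -> order_iso S S' g ->
  (forall y : 'I_(2 * n), exists2 p, p \in points S & pt p = y) ->
  (forall y : 'I_(2 * n), exists2 p, p \in points S' & pt p = y) -> S = S'.
Proof.
move=> MS MS' I full full'.
have ptE q : q \in points S -> pt (lift_chord g q) = pt q.
  move=> qS; rewrite -(full_rank MS' full') ?(oi_points I) // -(full_rank MS full qS).
  have -> : [set p in points S' | pt p < pt (lift_chord g q)] =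
      [set lift_chord g p | p in [set p in points S | pt p < pt q]].
    apply/setP=> p'; rewrite !inE; apply/andP/imsetP => [[p'S h]|[p]].
      have [c cS cE] := oi_inv I p'S.
      have p'E : p' = lift_chord g (c, p'.2) by rewrite /lift_chord -cE; case: (p').
      have pS : (c, p'.2) \in points S by rewrite in_points.
      by exists (c, p'.2); rewrite // !inE cS; rewrite p'E (oi_lt I) // in h.
    rewrite !inE -in_points => /andP[pS h] ->.
    by rewrite -in_points (oi_points I) // (oi_lt I).
  apply: card_in_imset => p p'; rewrite !inE => /andP[pS _] /andP[p'S _].
  by case: p p' pS p'S => [c b] [c' b'] /= cS cS' [/(oi_inj I MS) -> // ->].
have gE c : c \in S -> g c = c.
  move=> cS; have := ptE (c, false); have := ptE (c, true); rewrite !in_points => /(_ cS) h1 /(_ cS) h2.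
  move: h1 h2; rewrite /lift_chord /pt /source /sink /= => /val_inj h1 /val_inj h2.
  by rewrite [LHS]surjective_pairing h1 h2 -surjective_pairing.
rewrite (oi_image I); apply/setP=> c; apply/idP/imsetP => [cS|[d dS ->]].
  by exists c; rewrite // gE.
by rewrite gE.
Qed.

Definition uses S (s : seq 'I_(2 * n)) :=
  forall y : 'I_(2 * n), y \in s <-> exists2 p, p \in points S & pt p = y.

Definition increasing (s : seq 'I_(2 * n)) := pairwise (fun a b : 'I_(2 * n) => a < b) s.

Lemma increasing_uniq s : increasing s -> uniq s.
Proof.
by rewrite uniq_pairwise; apply: sub_pairwise => a b; rewrite ltn_neqAle => /andP[].
Qed.

Lemma uses_size S s : matching S -> uses S s -> uniq s -> size s = 2 * #|S|.
Proof.
move=> MS U us.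
have ptlt p : pt p < 2 * n by case: p => c [] /=; apply: ltn_ord.
pose f p := Ordinal (ptlt p).
rewrite -(card_uniqP us) (_ : #|s| = #|[set f p | p in points S]|); last first.
  apply: eq_card => y; apply/idP/imsetP => [/U[p pS pE]|[p pS ->]].
    by exists p => //; apply: val_inj.
  by apply/U; exists p.
rewrite card_in_imset => [|p p' pS p'S /(congr1 val) /=]; last exact: (mt_inj MS).
have -> : points S = setX S [set: bool] by apply/setP=> q; rewrite !inE andbT.
by rewrite cardsX cardsT card_bool mulnC.
Qed.

Definition points_upto S y := #|[set q in points S | pt q <= y]|.

Lemma oi_points_upto S S' g q : matching S -> order_iso S S' g -> q \in points S ->
  points_upto S' (pt (lift_chord g q)) = points_upto S (pt q).
Proof.
move=> MS I qS; rewrite /points_upto.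
have -> : [set p in points S' | pt p <= pt (lift_chord g q)] =
    [set lift_chord g p | p in [set p in points S | pt p <= pt q]].
  apply/setP=> p'; rewrite !inE; apply/andP/imsetP => [[p'S h]|[p]].
    have [c cS cE] := oi_inv I p'S.
    have p'E : p' = lift_chord g (c, p'.2) by rewrite /lift_chord -cE; case: (p').
    have pS : (c, p'.2) \in points S by rewrite in_points.
    by exists (c, p'.2); rewrite // !inE cS; rewrite p'E (oi_le I) // in h.
  rewrite !inE -in_points => /andP[pS h] ->.
  by rewrite -in_points (oi_points I) // (oi_le I).
apply: card_in_imset => p p'; rewrite !inE => /andP[pS _] /andP[p'S _].
by case: p p' pS p'S => [c b] [c' b'] /= cS cS' [/(oi_inj I MS) -> // ->].
Qed.

End OrderIso.

(** * Construction of a diagram from its tree *)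

Section Build.
Variable n : nat.
Implicit Types (c d e r : chord n) (S A K : {set chord n}) (p q x : chord n * bool).
Implicit Types (s : seq 'I_(2 * n)).

Lemma points_upto_count S s y : matching S -> uses S s -> uniq s ->
  points_upto S y = count (fun z : 'I_(2 * n) => z <= y) s.
Proof.
move=> MS U us; have ptlt p : pt p < 2 * n by case: p => c [] /=; apply: ltn_ord.
pose f p := Ordinal (ptlt p).
rewrite -size_filter -(card_uniqP (filter_uniq _ us)) /points_upto.
rewrite -(card_in_imset (f := f)) => [|p p']; last first.
  rewrite !inE -!in_points => /andP[pS _] /andP[p'S _] /(congr1 val) /=.
  exact: (mt_inj MS).
apply: eq_card => z; rewrite mem_filter; apply/imsetP/andP => [[p]|[zy /U[p pS pE]]].
  by rewrite !inE -in_points => /andP[pS h] ->; split=> //; apply/U; exists p.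
by exists p; [rewrite !inE -in_points pS pE|apply: val_inj].
Qed.

(** Take the last allowed endpoint whose count is still at least [j]: at the next one the count is
    smaller by exactly 1. *)
Lemma nallowed_from_surj K j : matching K -> 0 < j <= nallowed K ->
  exists x, [/\ x \in points K, allowed K (pt x) & nallowed_from K (pt x) = j].
Proof.
move=> MK /andP[j0 jK].
pose P y := [&& y \in points K, allowed K (pt y) & j <= nallowed_from K (pt y)].
have [x0 Px0] : exists x0, P x0.
  have [u uK] : exists u, (u \in points K) && allowed K (pt u).
    have : 0 < nallowed K := leq_trans j0 jK.
    by case/card_gt0P=> u; rewrite inE => uK; exists u.
  have [v /andP[vK av] vmin] :=
    @arg_minnP _ u (fun q => (q \in points K) && allowed K (pt q)) (@pt n) uK.
  exists v; rewrite /P vK av /=; apply: leq_trans jK _; apply: subset_leq_card.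
  apply/subsetP=> w; rewrite !inE -in_points => wK.
  by rewrite (vmin w wK); case/andP: wK => -> ->.
have [x /and3P[xK ax jx] xmax] := arg_maxnP (@pt n) Px0.
exists x; split=> //; apply/eqP; rewrite eqn_leq jx andbT leqNgt; apply/negP => h.
pose T := [set q in points K | (pt x < pt q) && allowed K (pt q)].
have cT : nallowed_from K (pt x) = #|T|.+1.
  rewrite /nallowed_from (cardsD1 x) inE xK leqnn ax add1n; congr _.+1.
  apply: eq_card => q; rewrite !inE; case qK: (q.1 \in K); rewrite ?andbF //=.
  rewrite ltn_neqAle -andbA; congr (_ && _).
  congr (~~ _); apply/eqP/eqP => [->//|E].
  by apply: (mt_inj MK); rewrite // in_points.
have [u uT] : exists u, u \in T.
  by apply/set0Pn; rewrite -card_gt0; move: h j0; rewrite cT ltnS => h j0; apply: leq_trans j0 h.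
have [v vT vmin] := @arg_minnP _ u (fun q => q \in T) (@pt n) uT.
have /and3P[vK xv av] : [&& v \in points K, pt x < pt v & allowed K (pt v)].
  by move: vT; rewrite inE.
have Pv : P v.
  rewrite /P vK av /=; rewrite cT ltnS in h; apply: leq_trans h _; apply: subset_leq_card.
  apply/subsetP=> w wT; have vw := vmin w wT; move: wT; rewrite !inE => /and3P[-> _ ->].
  by rewrite andbT.
by have := xmax v Pv; rewrite /= leqNgt xv.
Qed.

Lemma increasing_cat s1 s2 : increasing (s1 ++ s2) =
  [&& allrel (fun a b : 'I_(2 * n) => a < b) s1 s2, increasing s1 & increasing s2].
Proof. exact: pairwise_cat. Qed.

(** How the endpoints are divided between [A] and [K] depends on the position of the gap, known only
    once [K] is built. So [K] is built on provisional endpoints, then again on the final ones, and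
    [arch_iso] carries the gap over. *)
Lemma arch_build t s : valid_tree t -> increasing s -> size s = 2 * leaves t ->
  exists2 S : {set chord n}, arch t S & uses S s.
Proof.
elim: t s => [|l IHl k IHk j] s.
  case: s => [|a [|b [|]]] //= _; rewrite /increasing /= !andbT => ab _.
  exists [set (a, b)]; first by exists (a, b).
  move=> y; rewrite !inE; split=> [/orP[]/eqP->|[[c [|]]]].
  - by exists ((a, b), false); rewrite ?in_points ?set11.
  - by exists ((a, b), true); rewrite ?in_points ?set11.
  - by rewrite in_points => /set1P/= -> /val_inj <-; rewrite eqxx orbT.
  - by rewrite in_points => /set1P/= -> /val_inj <-; rewrite eqxx.
rewrite valid_node => /and4P[vl vk j0 jk] inc sz.
have sz' : size s = 2 * leaves l + 2 * leaves k by rewrite sz /= mulnDr.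
have l0 := leaves_gt0 l.
have [K0 aK0 U0] : exists2 S : {set chord n}, arch k S & uses S (take (2 * leaves k) s).
  apply: IHk => //; last by rewrite size_takel // sz' leq_addl.
  by move: inc; rewrite -{1}(cat_take_drop (2 * leaves k) s) increasing_cat => /and3P[].
have [[MK0 CK0 _ _ _] [naK0 cardK0 _]] := arch_sound aK0.
have [x0 [x0K ax0 x0j]] : exists x, [/\ x \in points K0, allowed K0 (pt x)
    & nallowed_from K0 (pt x) = j].
  by apply: nallowed_from_surj => //; rewrite j0 naK0.
set b := points_upto K0 (pt x0).
have bk : b <= 2 * leaves k.
  rewrite -cardK0 /b -(_ : #|points K0| = 2 * #|K0|); last first.
    have -> : points K0 = setX K0 [set: bool] by apply/setP=> q; rewrite !inE andbT.
    by rewrite cardsX cardsT card_bool mulnC.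
  by apply: subset_leq_card; apply/subsetP=> q; rewrite !inE => /andP[].
case: s {U0} inc sz sz' => [|h s] inc sz sz'; first by move: sz' l0 => /=; lia.
(* [h] and [s2] are for [A], with [h] the source of the root; [s1] and [s3], before and after the
   gap, are for [K]. *)
pose s1 := take b s; pose s2 := take (2 * leaves l).-1 (drop b s).
pose s3 := drop (2 * leaves l).-1 (drop b s).
have sE : s = s1 ++ s2 ++ s3 by rewrite !cat_take_drop.
have ss : size s = (2 * leaves l).-1 + 2 * leaves k.
  by move: sz' l0 => /=; lia.
have bs : b <= size s by rewrite ss; apply: leq_trans bk (leq_addl _ _).
have z1 : size s1 = b by rewrite size_takel.
have z2 : size s2 = (2 * leaves l).-1.
  by rewrite size_takel // size_drop ss -addnBA // leq_addr.
have z3 : size s3 = 2 * leaves k - b.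
  by rewrite !size_drop ss -addnBA // addKn.
have : increasing ([:: h] ++ s1 ++ s2 ++ s3) by rewrite -sE.
rewrite !increasing_cat !allrel_catr.
case/and3P=> /and3P[/allrelP h1 /allrelP h2 /allrelP h3] _.
case/and3P=> /andP[/allrelP h12 /allrelP h13] i1 /and3P[/allrelP h23 i2 i3].
have hh : h \in [:: h] := mem_head h [::].
have [A aA UA] : exists2 S : {set chord n}, arch l S & uses S (h :: s2).
  apply: IHl => //; last by rewrite /= z2 prednK // muln_gt0.
  rewrite -cat1s increasing_cat i2 !andbT.
  by apply/allrelP => u v u1 v2; apply: h2.
have iK : increasing (s1 ++ s3).
  by rewrite increasing_cat i1 i3 !andbT; apply/allrelP => u v u1 v3; apply: h13.
have [K aK UK] : exists2 S : {set chord n}, arch k S & uses S (s1 ++ s3).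
  by apply: IHk => //; rewrite size_cat z1 z3 subnKC.
have [[MA CA _ _ _] [_ cardA _]] := arch_sound aA.
have [[MK CK _ _ _] [_ cardK _]] := arch_sound aK.
have [g Ig] := arch_iso aK0 aK.
pose x := lift_chord g x0.
have xK : x \in points K := oi_points Ig x0K.
have ax : allowed K (pt x) by rewrite (oi_allowed Ig x0K).
have xj : nallowed_from K (pt x) = j by rewrite (oi_nallowed_from Ig MK0 x0K).
have xb : count (fun z : 'I_(2 * n) => z <= pt x) (s1 ++ s3) = size s1.
  rewrite -(points_upto_count _ MK UK (increasing_uniq iK)) z1.
  exact: oi_points_upto MK0 Ig x0K.
have inS p S s' : uses S s' -> p \in points S -> exists2 y : 'I_(2 * n), y \in s' & pt p = y.
  move=> U pS; have ptlt : pt p < 2 * n by case: (p) => c [] /=; apply: ltn_ord.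
  by exists (Ordinal ptlt) => //; apply/U; exists p.
have [xy xyin xyE] := inS _ _ _ UK xK.
have xs1 : xy \in s1.
  move: xyin; rewrite mem_cat => /orP[//|x3].
  move: xb; rewrite count_cat.
  have -> : count (fun z : 'I_(2 * n) => z <= pt x) s1 = size s1.
    by apply/eqP; rewrite -all_count; apply/allP => z z1'; rewrite xyE ltnW //; apply: h13.
  have : 0 < count (fun z : 'I_(2 * n) => z <= pt x) s3.
    by rewrite -has_count; apply/hasP; exists xy => //; rewrite xyE.
  by case: (count _ s3) => // z _ /eqP; rewrite -[X in _ == X]addn0 eqn_add2l.
have below3 z : z \in s3 -> pt x < z by move=> z3'; rewrite xyE; apply: h13.
have below1 z : z \in s1 -> z <= pt x.
  move: xb; rewrite count_cat.
  have -> : count (fun z : 'I_(2 * n) => z <= pt x) s3 = 0.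
    by apply/eqP; rewrite -leqn0 leqNgt -has_count; apply/hasPn => w w3;
       rewrite -ltnNge below3.
  by rewrite addn0 => /eqP; rewrite -all_count => /allP; apply.
have [[r br] rA rE] : exists2 p, p \in points A & pt p = h by apply/UA; rewrite mem_head.
have rin : r \in A by rewrite in_points in rA.
have srh : source r = h.
  case: br rA rE => // rA rE.
  have [y ys yE] := inS (r, false) _ _ UA (etrans (in_points A (r, false)) rin).
  have := mt_lt MA rin; rewrite -[source r]/(pt (r, false)) yE -[sink r]/(pt (r, true)) rE.
  move: ys; rewrite inE => /predU1P[->|ys]; first by rewrite ltnn.
  by rewrite ltnNge ltnW // h2.
have qA q : q \in points A -> q != (r, false) -> exists2 y : 'I_(2 * n), y \in s2 & pt q = y.
  move=> qin qr; have [y ys yE] := inS _ _ _ UA qin.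
  move: ys; rewrite inE => /predU1P[E|ys]; last by exists y.
  case/eqP: qr; apply: (mt_inj MA) => //; first by rewrite in_points.
  by rewrite yE E -srh.
have I : insertion A K r x.
  split=> //.
  - by move=> q qin qr; have [y ys ->] := qA q qin qr; rewrite srh h2.
  - move=> p /(inS _ _ _ UK)[y ys ->]; rewrite srh; move: ys; rewrite mem_cat => /orP[ys|ys].
      exact: h1.
    exact: h3.
  - move=> p q pK qin qr; have [y ys ->] := qA q qin qr; have [w ws ->] := inS _ _ _ UK pK.
    move: ws; rewrite mem_cat => /orP[ws|ws]; first by rewrite below1 // h12.
    by rewrite leqNgt below3 //= h23.
exists (A :|: K); first by exists A, K, r, x.
move=> y; split=> [|[p]].
  rewrite inE sE !mem_cat => yin.
  have : (y \in h :: s2) || (y \in s1 ++ s3).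
    by rewrite inE mem_cat; case/or4P: yin => ->; rewrite ?orbT.
  by case/orP=> [/UA|/UK] [p pS pE]; exists p => //; move: pS; rewrite !in_points inE => ->; rewrite ?orbT.
rewrite in_points inE -!in_points => pAK pE.
have : (y \in h :: s2) || (y \in s1 ++ s3).
  by case/orP: pAK => pS; apply/orP; [left; apply/UA|right; apply/UK]; exists p.
by rewrite sE !inE !mem_cat => /orP[/orP[]|/orP[]] ->; rewrite ?orbT.
Qed.

End Build.

(** * Top cycles and chains of right neighbors *)

Section TopCycles.
Variable n : nat.
Implicit Types (c d e r : chord n) (S T : {set chord n}).

Lemma rank_mono T (x y : 'I_(2 * n)) : x <= y -> rank T x <= rank T y.
Proof.
move=> xy; apply: subset_leq_card; apply/subsetP => z; rewrite ![_ \in [set y in _ | _]]inE => /andP[-> zx].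
exact: leq_trans zx xy.
Qed.

Lemma rank_reflects_lt T (x y : 'I_(2 * n)) : rank T x < rank T y -> x < y.
Proof. by rewrite ltnNge => h; rewrite ltnNge; apply: contra h; apply: rank_mono. Qed.

Lemma rank_lt T (x y : 'I_(2 * n)) : x \in endpoints T -> x < y -> rank T x < rank T y.
Proof.
move=> xT xy; apply: proper_card; apply/properP; split.
  by apply/subsetP => z; rewrite ![_ \in [set y in _ | _]]inE => /andP[-> zx]; apply: ltn_trans zx xy.
by exists x; rewrite inE ?xT ?xy // ltnn andbF.
Qed.

Lemma rank_lt_card T (x : 'I_(2 * n)) : x \in endpoints T -> rank T x < #|endpoints T|.
Proof.
move=> xT; apply: proper_card; apply/properP; split.
  by apply/subsetP => z; rewrite !inE => /andP[].
by exists x => //; rewrite inE ltnn andbF.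
Qed.

Lemma card_endpoints T : #|endpoints T| <= 2 * #|T|.
Proof.
have sub : endpoints T \subset [set c.1 | c in T] :|: [set c.2 | c in T].
  apply/subsetP => x; rewrite !inE => /existsP[c /andP[cT /orP[]/eqP->]].
    by rewrite (imset_f fst cT).
  by rewrite (imset_f snd cT) orbT.
apply: leq_trans (subset_leq_card sub) _; apply: leq_trans (leq_card_setU _ _) _.
by rewrite [2 * #|T|]mul2n -addnn leq_add // leq_imset_card.
Qed.

(** Counting up, each value is at least its index; counting down from the last, at most. *)
Lemma squeezed_increasing (e : nat -> nat) N :
  (forall j, j.+1 < N -> e j < e j.+1) -> e N.-1 < N -> forall j, j < N -> e j = j.
Proof.
move=> step last.
have lo j : j < N -> j <= e j.
  elim: j => // j IH jN; exact: leq_ltn_trans (IH (ltnW jN)) (step j jN).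
have up i : i < N -> e (N.-1 - i) <= N.-1 - i.
  elim: i => [|i IH] iN; first by rewrite subn0; case: (N) last.
  have := step (N.-1 - i.+1); have -> : (N.-1 - i.+1).+1 = N.-1 - i by lia.
  have := IH (ltnW iN); lia.
move=> j jN; apply/eqP; rewrite eqn_leq lo // andbT.
have := up (N.-1 - j); have -> : N.-1 - (N.-1 - j) = j by lia.
by apply; lia.
Qed.

Lemma top_cycle_chord T i j : i < 2 * #|T| -> j < 2 * #|T| ->
  relabel T = top_cycle #|T| ->
  [exists k : 'I_(#|T|).-1, (i == 2 * k) && (j == 2 * k + 3)]
    || (i == 1) && (j == 2 * #|T| - 2) ->
  exists c, [/\ c \in T, rank T c.1 = i & rank T c.2 = j].
Proof.
move=> iT jT E H; have : (Ordinal iT, Ordinal jT) \in relabel T by rewrite E inE.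
by rewrite inE => /existsP[c /and3P[cT /eqP c1 /eqP c2]]; exists c.
Qed.

(** In a top cycle of [m] chords, with endpoints counted from 0, the chords [(0, 3)], [(1, 2m - 2)]
    and [(2, 5)] violate [clean]: right neighbors lead from the last one to [(2m - 4, 2m - 1)]. *)
Lemma clean_top_cycle_free S : clean S -> top_cycle_free S.
Proof.
move=> cl; apply/forallP => T; apply/implyP => /andP[/subsetP TS m3]; apply/eqP => E.
have [d [dT d1 d2]] : exists c, [/\ c \in T, rank T c.1 = 1 & rank T c.2 = 2 * #|T| - 2].
  by apply: top_cycle_chord => //; [lia|lia|rewrite !eqxx orbT].
have C i : i < #|T|.-1 -> exists c, [/\ c \in T, rank T c.1 = 2 * i & rank T c.2 = 2 * i + 3].
  move=> im; apply: top_cycle_chord => //; [lia|lia|apply/orP; left].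
  by apply/existsP; exists (Ordinal im); rewrite !eqxx.
have [|r [rT r1 r2]] := C 0; first lia.
have [|c [cT c1 c2]] := C 1; first lia.
have lt (x y : 'I_(2 * n)) : rank T x < rank T y -> x < y := @rank_reflects_lt T x y.
have := cl r d c (TS _ rT) (TS _ dT) (TS _ cT).
rewrite /source /sink !lt ?r1 ?r2 ?d1 ?d2 ?c1 ?c2 //; try lia.
do 5 move=> /(_ isT); move/negP; apply.
have reach i : i.+1 < #|T|.-1 ->
    exists c', [/\ c' \in T, rank T c'.2 = 2 * i.+1 + 3, rank T c'.1 = 2 * i.+1
      & connect (rn_in S) c c'].
  elim: i => [|i IH] im; first by exists c; rewrite connect0.
  have [c' [c'T c'2 c'1 cc']] := IH (ltnW im).
  have [c'' [c''T c''1 c''2]] := C _ im; exists c''; split=> //.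
  apply: connect_trans cc' (connect1 _); rewrite /rn_in /= (TS _ c'T) (TS _ c''T) /right_neighbor.
  by rewrite /source /sink !lt // ?c'1 ?c'2 ?c''1 ?c''2; lia.
have [|e [eT e2 _ ce]] := reach (#|T| - 3); first lia.
by apply/existsP; exists e; rewrite ce lt // e2 d2; lia.
Qed.

(** Two reductions shorten the chain: stop at the first chord that ends after [d], and skip a chord
    whose two neighbors in the chain already cross. *)
Lemma shortest_chain S d k (f : nat -> chord n) : matching S -> d \in S ->
  source (f 0) < source d -> sink (f 0) < sink d ->
  (forall i, i < k -> rn_in S (f i) (f i.+1)) ->
  source d < source (f 1) -> sink d < sink (f k) ->
  exists k g, [/\ 0 < k, forall i, i < k -> rn_in S (g i) (g i.+1),
    g 0 = f 0 /\ source d < source (g 1),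
    forall i, i < k -> sink (g i) < sink d
    & sink d < sink (g k) /\ forall i, i.+1 < k -> sink (g i) < source (g i.+2)].
Proof.
move=> MS dS; elim/ltn_ind: k f => k IH f f0d f0d' step f1 fk.
have k0 : 0 < k by case: (k) fk => // /(ltn_trans f0d'); rewrite ltnn.
have fS i : i <= k -> f i \in S.
  by case: i => [|i] ik; [have /and3P[] := step _ k0|have /and3P[] := step _ ik].
have fsrc i : i < k -> source d < source (f i.+1).
  elim: i => // i Hi ik; apply: ltn_trans (Hi (ltnW ik)) _.
  by have /and3P[_ _ /and3P[]] := step _ ik.
have [/forallP H1|] := boolP [forall i : 'I_k, sink (f i) < sink d]; last first.
  case/forallPn=> -[[|i] ik] /=; first by rewrite f0d'.
  rewrite -leqNgt leq_eqVlt => /orP[/eqP/(sink_inj MS dS (fS _ (ltnW ik))) E|h].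
    by have := fsrc i (ltnW ik); rewrite -E ltnn.
  by apply: (IH i.+1 ik f) => // j ji; apply: step; apply: ltn_trans ji ik.
have [/forallP H2|] := boolP [forall i : 'I_k.-1, sink (f i) < source (f i.+2)].
  exists k, f; split=> //; first by move=> i ik; apply: (H1 (Ordinal ik)).
  split=> // i ik; have ik' : i < k.-1 by rewrite -ltnS prednK.
  exact: (H2 (Ordinal ik')).
case/forallPn=> -[i ik] /=; rewrite -leqNgt => h.
have {}ik : i.+1 < k by rewrite -ltnS prednK in ik.
(* The chain without [f i.+1]; [g 0] is still [f 0], and [g 1] still starts after [d]. *)
pose g j := if j <= i then f j else f j.+1.
have kk : k.-1 < k by rewrite prednK.
have g0 : g 0 = f 0 by [].
have gk : g k.-1 = f k by rewrite /g prednK // leqNgt -ltnS prednK // ik.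
rewrite -g0; apply: (IH k.-1 kk g) => //; last 2 first.
- rewrite /g; case: ifP => _ //; apply: fsrc; lia.
- by rewrite gk.
move=> j jk; rewrite /g; case: (ltngtP j i) => ji; last 1 first.
- subst j; have /and3P[iS i1S /and3P[i1 i2 i3]] := step i (ltnW ik).
  have /and3P[_ i2S /and3P[i4 i5 i6]] := step _ ik.
  rewrite /rn_in /= iS i2S /right_neighbor (ltn_trans i1 i4) (ltn_trans i3 i6) andbT /=.
  by rewrite ltn_neqAle h (source_neq_sink MS).
- by apply: step; apply: ltn_trans jk kk.
- by apply: step; rewrite -ltnS prednK in jk.
Qed.

Lemma top_cycle_free_clean S : matching S -> top_cycle_free S -> clean S.
Proof.
move=> MS /forallP tc r d c rS dS cS rd dc cr rd' rc; apply/negP.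
case/existsP=> e /andP[/connectP[p pp eE] de].
pose f0 i := if i is i'.+1 then nth c (c :: p) i' else r.
have [||k [f [k0 step [f0r df1] fd [dfk gap]]]] :=
    @shortest_chain S d (size p).+1 f0 MS dS rd rd' _ dc _.
- case=> [|i] ip; first by rewrite /rn_in /= rS cS /right_neighbor cr rc (ltn_trans rd dc).
  by move/(pathP c): pp => /(_ i ip).
- by have -> : f0 (size p).+1 = e by rewrite eE; apply: (nth_last c (c :: p)).
have {f0r} f0r : f 0 = r := f0r.
have stepS i : i < k -> [/\ source (f i) < source (f i.+1),
    source (f i.+1) < sink (f i) & sink (f i) < sink (f i.+1)].
  by move=> /step/and3P[_ _ /and3P[]].
have fS i : i <= k -> f i \in S.
  by case: i => [|i] ik; [rewrite f0r|have /and3P[] := step _ ik].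
pose T : {set chord n} := d |: [set f i | i : 'I_k.+1].
have fT i : i <= k -> f i \in T.
  by rewrite -ltnS => ik; rewrite !inE; apply/orP; right; apply/imsetP; exists (Ordinal ik).
(* The endpoints of [T] in order: the source of [f i] at [2i], its sink at [2i + 3], and [d] from 1
   to [2k + 2]. *)
pose E j : 'I_(2 * n) := if j == 1 then d.1 else if j == 2 * k + 2 then d.2
  else if odd j then (f (j./2.-1)).2 else (f j./2).1.
have Eev i : i <= k -> E (2 * i) = (f i).1.
  move=> ik; rewrite /E [_ == 1](_ : _ = false); last by lia.
  by rewrite [_ == _ + _](_ : _ = false) ?[2 * i]mul2n ?odd_double ?doubleK //; lia.
have Eod i : i <= k -> E (2 * i + 3) = (f i).2.
  move=> ik; rewrite /E [_ == 1](_ : _ = false); last by lia.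
  rewrite [_ == _ + 2](_ : _ = false); last by lia.
  by rewrite (_ : 2 * i + 3 = i.+1.*2.+1) /= ?odd_double ?uphalf_double //; lia.
have E1 : E 1 = d.1 by [].
have Ed : E (2 * k + 2) = d.2 by rewrite /E eqxx [_ == 1](_ : _ = false) //; lia.
have Estep j : j.+1 < 2 * k + 4 -> E j < E j.+1.
  move=> jk; have [a [jE|jE]] : exists a, j = 2 * a \/ j = (2 * a).+1.
      by exists j./2; lia.
    subst j; case: a jk => [|a] jk; first by rewrite (Eev 0) // E1 f0r.
    have [ak|ak] := ltnP a k.
      rewrite (Eev a.+1 ak) (_ : (2 * a.+1).+1 = 2 * a + 3); last by lia.
      by rewrite (Eod a (ltnW ak)); have [] := stepS a ak.
    rewrite (_ : a = k); last by lia.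
    rewrite (_ : (2 * k.+1).+1 = 2 * k + 3); last by lia.
    by rewrite (_ : 2 * k.+1 = 2 * k + 2) ?Ed ?(Eod k (leqnn k)) //; lia.
  subst j; case: a jk => [|a] jk; first by rewrite (Eev 1) // E1.
  rewrite (_ : (2 * a.+1).+1 = 2 * a + 3); last by lia.
  have ak' : a <= k by lia.
  rewrite (Eod a ak'); have [ak|ak] := ltnP a.+1 k.
    rewrite (_ : (2 * a + 3).+1 = 2 * a.+2); last by lia.
    by rewrite (Eev a.+2 ak); apply: gap.
  rewrite (_ : (2 * a + 3).+1 = 2 * k + 2); last by lia.
  by rewrite Ed; apply: fd; lia.
have ET j : j < 2 * k + 4 -> E j \in endpoints T.
  move=> jk; rewrite inE /E; case: ifP => _.
    by apply/existsP; exists d; rewrite setU11 eqxx.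
  case: ifP => [_|j2]; first by apply/existsP; exists d; rewrite setU11 eqxx orbT.
  by case: ifP => oj; apply/existsP; [exists (f j./2.-1)|exists (f j./2)];
    rewrite eqxx ?orbT fT //; lia.
have cT2 : #|T| <= k + 2.
  rewrite /T cardsU1 addnC (_ : k + 2 = k.+1 + 1) ?leq_add ?leq_b1 //; last by lia.
  by apply: leq_trans (leq_imset_card _ _) _; rewrite card_ord.
(* Ranks increase strictly along [E], and [T] has at most [2k + 4] endpoints, so they are forced;
   that the [k + 2] chords are distinct comes out as well. *)
have Er j : j < 2 * k + 4 -> rank T (E j) = j.
  move=> jk; apply: (squeezed_increasing (e := fun i => rank T (E i)) _ _ jk).
    by move=> i ik; apply: rank_lt; [apply: ET; apply: ltnW|apply: Estep].
  have e3 : (2 * k + 4).-1 < 2 * k + 4 by lia.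
  apply: leq_trans (rank_lt_card (ET _ e3)) (leq_trans (card_endpoints T) _).
  by rewrite (_ : 2 * k + 4 = 2 * (k + 2)) ?leq_mul2l //; lia.
have cT : #|T| = k + 2.
  apply/eqP; rewrite eqn_leq cT2.
  have e3 : 2 * k + 3 < 2 * k + 4 by lia.
  have := leq_trans (rank_lt_card (ET _ e3)) (card_endpoints T); rewrite Er // -addnS => h.
  by rewrite -(@leq_pmul2l 2) // mulnDr.
have sT : T \subset S.
  by apply/subsetP => x; rewrite !inE => /orP[/eqP->//|/imsetP[i _ ->]]; rewrite fS // -ltnS.
have T3 : 2 < #|T| by rewrite cT addn2 !ltnS.
have := tc T; rewrite sT T3 /= => /negP; apply; apply/eqP.
have rf i : i <= k -> rank T (f i).1 = 2 * i /\ rank T (f i).2 = 2 * i + 3.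
  by move=> ik; rewrite -(Eev i ik) -(Eod i ik) !Er //; lia.
have rd1 : rank T d.1 = 1 by rewrite -E1 Er; lia.
have c2T : 2 * #|T| - 2 = 2 * k + 2 by rewrite cT; lia.
have rd2 : rank T d.2 = 2 * #|T| - 2.
  by apply: etrans (esym c2T); rewrite -Ed Er //; lia.
apply/setP => c'; rewrite !inE.
apply/existsP/orP => [[x /and3P[]]|[/existsP[i /andP[/eqP c1 /eqP c2]]|/andP[/eqP c1 /eqP c2]]].
- rewrite !inE => /orP[/eqP->|/imsetP[i _ ->]].
    by rewrite rd1 rd2 => /eqP<- /eqP<-; right; rewrite !eqxx.
  have [|-> ->] := rf i; first by rewrite -ltnS.
  move=> /eqP<- /eqP<-; left; apply/existsP.
  have im : i < #|T|.-1 by rewrite cT addn2.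
  by exists (Ordinal im); rewrite /= !eqxx.
- have ik : i <= k by rewrite -ltnS; apply: leq_trans (ltn_ord i) _; apply/eq_leq; rewrite cT addn2.
  by exists (f i); rewrite fT // c1 c2; have [-> ->] := rf i ik; rewrite !eqxx.
- by exists d; rewrite setU11 rd1 rd2 c1 c2 !eqxx.
Qed.

End TopCycles.

(** * Assembling the bijection *)

(** As [A] is finite, a function can be chosen from the relation without any axiom; [xchoose]
    inverts it because [f a == b] is decidable. *)
Lemma functional_relation_bijective (A : finType) (B : eqType) (R : A -> B -> Prop) :
  (forall a, exists b, R a b) -> (forall b, exists a, R a b) ->
  (forall a b b', R a b -> R a b' -> b = b') ->
  (forall a a' b, R a b -> R a' b -> a = a') ->
  exists f : A -> B, bijective f.
Proof.
move=> totA totB funA funB; have [f Rf] := fin_all_exists totA.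
have surj b : exists a, f a == b.
  by have [a Rab] := totB b; exists a; apply/eqP; apply: funA Rab.
have fK b : f (xchoose (surj b)) = b by apply/eqP/(xchooseP (surj b)).
exists f; exists (fun b => xchoose (surj b)) => // a.
by apply: funB (Rf a); have := Rf (xchoose (surj (f a))); rewrite fK.
Qed.

Section PerfectMatchings.
Variable n : nat.
Implicit Type S : {set chord n}.

Lemma points_surj S : perfect_matching S ->
  forall y : 'I_(2 * n), exists2 p, p \in points S & pt p = y.
Proof.
case/andP=> _ /forallP H y; have /cards1P[c cE] := H y.
have : c \in [set c] by rewrite set11.
rewrite -cE inE => /andP[cS /orP[]/eqP->].
  by exists (c, false); rewrite ?in_points.
by exists (c, true); rewrite ?in_points.
Qed.

Lemma pt_endpoint (c : chord n) b (y : 'I_(2 * n)) : pt (c, b) = y -> (y == c.1) || (y == c.2).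
Proof. by rewrite -!val_eqE /= => <-; case: b; rewrite eqxx ?orbT. Qed.

Lemma perfect_matchingW S : perfect_matching S -> matching S.
Proof.
case/andP=> /forall_inP lt /forallP H; split=> // -[c b] [d b'].
rewrite !in_points /= => cS dS E.
have ptlt : pt (c, b) < 2 * n by case: (b); apply: ltn_ord.
have /cards1P[e eE] := H (Ordinal ptlt).
have ce : c = e by apply/set1P; rewrite -eE inE cS (@pt_endpoint c b).
have de : d = e by apply/set1P; rewrite -eE inE dS (@pt_endpoint d b').
subst c d; congr (_, _); move: E (lt e cS).
by rewrite /pt; case: (b) (b') => [] [] //= ->; rewrite ltnn.
Qed.

Lemma perfect_matching_uses S : matching S -> uses S (enum 'I_(2 * n)) -> perfect_matching S.
Proof.
move=> MS U; apply/andP; split; first exact/forall_inP/(mt_lt MS).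
apply/forallP=> y; have [[c b] cS pE] : exists2 p, p \in points S & pt p = y.
  by apply/U; rewrite mem_enum.
apply/cards1P; exists c; apply/setP => d; rewrite !inE.
rewrite in_points in cS.
apply/andP/eqP => [[dS]|->]; last by split=> //; apply: pt_endpoint pE.
by case/orP=> /eqP yE; [have := @mt_inj _ _ MS (d, false) (c, b)|have := @mt_inj _ _ MS (d, true) (c, b)];
  rewrite !in_points pE yE => /(_ dS cS erefl)[].
Qed.

Lemma perfect_matching_card S : perfect_matching S -> #|S| = n.
Proof.
move=> pm; have U : uses S (enum 'I_(2 * n)).
  by move=> y; rewrite mem_enum; split=> // _; apply: points_surj.
have := uses_size (perfect_matchingW pm) U (enum_uniq _).
by rewrite size_enum_ord => /eqP; rewrite eqn_pmul2l // => /eqP.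
Qed.

Lemma enum_increasing : increasing (enum 'I_(2 * n)).
Proof.
have <- : pairwise ltn (map val (enum 'I_(2 * n))) = increasing (enum 'I_(2 * n)).
  exact: pairwise_map.
by rewrite val_enum_ord -sorted_pairwise; [exact: iota_ltn_sorted|exact: ltn_trans].
Qed.

End PerfectMatchings.

Section Correspondence.
Variables n i : nat.
Hypothesis hin : i <= n.

(** A relation rather than a function, so that neither a representative nor its root dart has to be
    chosen. *)
Definition tree_of_class (t : tree) (X : triangulation_class (n - i) (i + 1)) : Prop :=
  exists M r q p, [/\ X = \pi_(triangulation_class (n - i) (i + 1))%qT M,
    rooted_disk (tagged (val M)) r q
    & coded (tree_code t) (node (tagged (val M))) (edge (tagged (val M))) r p].

Lemma tree_of_class_fun t X Y : valid_tree t ->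
  tree_of_class t X -> tree_of_class t Y -> X = Y.
Proof.
move=> vt [M [r [q [p [-> dM cM]]]]] [N [r' [q' [p' [-> dN cN]]]]].
apply/eqmodP/map_isoP; have [vc _ _] := tree_codeP vt.
exact: coded_map_iso dM dN vc cM cN.
Qed.

Lemma tree_of_class_inj t u X : valid_tree t -> valid_tree u ->
  tree_of_class t X -> tree_of_class u X -> t = u.
Proof.
move=> vt vu [M [r [q [p [-> dM cM]]]]] [N [r' [q' [p' [/eqmodP/map_isoP[f fI] dN cN]]]]].
have [vc _ _] := tree_codeP vt; have [vd _ _] := tree_codeP vu.
exact: tree_code_inj (iso_coded fI dM dN vc cM vd cN).
Qed.

Lemma tree_of_class_exists t : valid_tree t -> width t = i -> leaves t = n ->
  exists X, tree_of_class t X.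
Proof.
move=> vt wt lt; have [vc bc wc] := tree_codeP vt.
have [d [M [r [p [dM cM]]]]] := build_disk vc.
have [ext int] := disk_vertex_counts dM vc cM.
have LM : [&& rooted_triangulation M, #|interior_vertices M| == n - i
    & #|exterior_vertices M| == i + 1].
  (* There are [leaves t + 1], that is [n + 1], vertices in all, of which [i + 1] are exterior. *)
  rewrite (rooted_disk_triangulation dM) ext bc wt addn1 eqxx andbT /=.
  by move: int; rewrite bc wc wt lt addnS => -[<-]; rewrite addnK.
pose L : labelled_triangulation (n - i) (i + 1) :=
  exist _ (Tagged (fun d => plane_map 'I_d) M) LM.
by exists (\pi_(triangulation_class (n - i) (i + 1)) L)%qT; exists L, r, p, p.
Qed.

Lemma class_tree_exists X : exists t,
  [/\ valid_tree t, width t = i, leaves t = n & tree_of_class t X].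
Proof.
elim/quotW: X => M; have /and3P[tri /eqP int /eqP ext] := valP M.
have [r rO rR] := triangulation_root tri.
have [q dM] := triangulation_rooted_disk tri rO rR.
have [c vc cM] := coded_exists (rd_planar dM) (rd_disk dM).
have [t vt tE] := tree_code_surj vc; have [_ bc wc] := tree_codeP vt.
have := disk_vertex_counts dM vc cM; rewrite -tE bc wc int ext.
case; rewrite [LHS]addn1 => -[wi]; rewrite -wi addnS subnK // => -[ln].
by exists t; split=> //; exists M, r, q, q; rewrite tE.
Qed.

End Correspondence.

Theorem theorem7p3 (n i : nat) (hi : 1 <= i) (hin : i <= n) :
  exists f : {C : chord_diagram n |
                [&& connected (val C), top_cycle_free (val C) & t1 (val C) == i]}
             -> triangulation_class (n - i) (i + 1),
    bijective f.
Proof.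
(* The same [t] is read through [unfold] on one side and through [tree_code] on the other: [t1] is
   the spine of [unfold t], hence the width of [t], hence one less than the number of exterior
   vertices. *)
pose R (C : {C : chord_diagram n |
                [&& connected (val C), top_cycle_free (val C) & t1 (val C) == i]})
    (X : triangulation_class (n - i) (i + 1)) :=
  exists t, [/\ valid_tree t, arch (unfold t) (val (val C)) & tree_of_class t X].
apply: (functional_relation_bijective (R := R)).
- move=> C; have /and3P[CS tcf /eqP t1i] := valP C.
  have pm := valP (val C); have MS := perfect_matchingW pm.
  have cS := perfect_matching_card pm.
  have [|u aS] := arch_exists MS CS (top_cycle_free_clean MS tcf).
    by rewrite cS; apply: leq_trans hi hin.
  have [[_ _ _ t1E _] [_ lu vu]] := arch_sound aS.
  have [t vt tu] := unfold_surj vu; have [_ st lt] := unfoldP vt.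
  have [||X tX] := @tree_of_class_exists n i t vt.
  - by rewrite -st tu -t1E.
  - by rewrite -lt tu -lu.
  by exists X, t; rewrite tu.
- move=> X; have [t [vt wt lt tX]] := class_tree_exists hin X.
  have [vu st lu] := unfoldP vt.
  have [|S aS US] := arch_build vu (enum_increasing n).
    by rewrite size_enum_ord lu lt.
  have [[MS CS clS t1E _] _] := arch_sound aS.
  have pm := perfect_matching_uses MS US.
  have CC : [&& connected S, top_cycle_free S & t1 S == i].
    by rewrite CS clean_top_cycle_free // t1E st wt eqxx.
  by exists (Sub (Sub S pm : chord_diagram n) CC), t; rewrite !SubK.
- move=> C X Y [t [vt at1 tX]] [u [vu au uY]].
  have E := unfold_inj vt vu (arch_det at1 au); subst u.
  exact: tree_of_class_fun tX uY.
- move=> C D X [t [vt at1 tX]] [u [vu au uX]].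
  have E := tree_of_class_inj vt vu tX uX; subst u.
  (* Diagrams with the same tree are order isomorphic, hence equal, since perfect matchings use all
     endpoints. *)
  have [g Ig] := arch_iso at1 au.
  have pC := valP (val C); have pD := valP (val D).
  do 2 apply: val_inj.
  exact: full_iso_eq (perfect_matchingW pC) (perfect_matchingW pD) Ig
    (points_surj pC) (points_surj pD).
Qed.
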